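(* Let $\Omega\subset\mathbb{R}^2$ be a bounded domain, with coordinates $(x,z)$. Let $\varepsilon_n>0$ with $\varepsilon_n\searrow 0$, and let $\{u_n\}\subset H^1(\Omega)$ be a sequence for which there are constants $C<\infty$ and $p>6$ (independent of $n$) such that for all $n$ $$\|\partial_x u_n\|_{L^p(\Omega)}\le C,\qquad \partial_x^2u_n\in L^2(\Omega),\qquad E_{\varepsilon_n}(u_n)\le C .$$ Then $\{\partial_x u_n\}$ is relatively compact in $L^q(\Omega)$ for every $1\le q<p$, and $\{\partial_z u_n\}$ is relatively compact in $L^2(\Omega)$.
   Context: For $\varepsilon>0$ and $u\in H^1(\Omega)$ with $\partial_x^2u\in L^2(\Omega)$ (weak derivative), $$E_\varepsilon(u)=\frac12\int_\Omega\left\{\frac{1}{\varepsilon}\Big(\partial_z u-\tfrac12(\partial_x u)^2\Big)^2+\varepsilon(\partial_x^2u)^2\right\}dx\,dz,$$ with the convention $E_\varepsilon(u)=+\infty$ if $\int_\Omega(\partial_zu-\frac12(\partial_xu)^2)^2\,dx\,dz=\infty$. *)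

(* Defs.v *)
From HB Require Import structures.
From mathcomp Require Import all_boot all_order all_algebra.
From mathcomp Require Import all_classical all_reals all_analysis.
Set Implicit Arguments.
Unset Strict Implicit.
Unset Printing Implicit Defensive.
Import Order.TTheory GRing.Theory Num.Theory.
Import numFieldNormedType.Exports.
Local Open Scope classical_set_scope.
Local Open Scope ring_scope.

(* The L^p pseudometric on p-integrable functions.  The library does not
   equip [LfunType] with a topology.  Functions that agree almost everywhere
   are at distance 0, so open, closed and compact sets of this space are the
   preimages of those of the quotient L^p. *)
Section Lfun_pseudometric.
Context d (T : measurableType d) (R : realType).
Variables (mu : {measure set T -> \bar R}) (p : \bar R) (p1 : (1 <= p)%E).
Local Notation ty := (LfunType mu p1).

Definition Lfun_dist (f g : ty) : R := 
  fine ('N[mu]_p[EFin \o (f - g : ty)%R])%E.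

Let ball (f : ty) (e : R) : set ty := [set g | Lfun_dist f g < e].
Let ent : set_system (ty * ty) := entourage_ ball.
Let nbhs (f : ty) : set_system ty := nbhs_ ent f.

Let nbhsE : nbhs = nbhs_ ent. Proof. by []. Qed.

Let ball_center (f : ty) (e : R) : 0 < e -> ball f e f.
Proof.
move=> e0; rewrite /ball/= /Lfun_dist subrr.
suff -> : EFin \o (0 : ty) = cst 0%E by rewrite Lnorm0// gt_eqF// (lt_le_trans _ p1).
by apply/funext.
Qed.

Let ball_sym (f g : ty) (e : R) : ball f e g -> ball g e f.
Proof.
rewrite /ball/= /Lfun_dist -opprB.
by have := LnormrN (g - f : ty) => /= <-.
Qed.

Let ball_triangle (f g h : ty) (e1 e2 : R) :
  ball f e1 g -> ball g e2 h -> ball f (e1 + e2) h.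
Proof.
rewrite /ball/= => fg gh; apply: le_lt_trans (ltrD fg gh).
rewrite /Lfun_dist.
have -> : (f - h : ty) = (f - g : ty) + (g - h : ty) by rewrite addrA subrK.
exact: ler_LnormD.
Qed.

Let entE : ent = entourage_ ball. Proof. by []. Qed.

HB.instance Definition _ := hasNbhs.Build ty nbhs.
HB.instance Definition _ := @Nbhs_isPseudoMetric.Build R ty
  ent nbhsE ball ball_center ball_sym ball_triangle entE.

End Lfun_pseudometric.

Section plane.
Context {R : realType}.

(* Points of the plane are pairs (x, z). *)
Definition leb2 : {measure set (measurableTypeR R * measurableTypeR R) -> \bar R} :=
  (@lebesgue_measure R \x @lebesgue_measure R)%E.

Definition e_x : R * R := (1, 0).
Definition e_z : R * R := (0, 1).

Definition domain (Omega : set (R * R)) : Prop :=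
  [/\ Omega !=set0, open Omega & connected Omega].

(* C^infinity: the iterated partial derivatives of all orders exist and are
   continuous. *)
Definition smooth (phi : R * R -> R) : Prop :=
  forall s : seq (R * R), {subset s <= [:: e_x; e_z]} ->
    let psi := foldr (fun v f => 'D_v f) phi s in
    continuous psi /\ forall v w, v \in [:: e_x; e_z] -> derivable psi w v.

Definition test_function (Omega : set (R * R)) (phi : R * R -> R) : Prop :=
  let supp := closure [set w | phi w != 0] in
  [/\ smooth phi, compact supp & supp `<=` Omega].

Definition loc_integrable (Omega : set (R * R)) (f : R * R -> R) : Prop :=
  forall K : set (R * R), compact K -> K `<=` Omega ->
    leb2.-integrable K (EFin \o f).

Definition is_wderiv (Omega : set (R * R)) (v : R * R) (u g : R * R -> R) :=
  [/\ loc_integrable Omega u, loc_integrable Omega g &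
    forall phi, test_function Omega phi ->
      \int[leb2]_(w in Omega) (u w * 'D_v phi w) =
      - \int[leb2]_(w in Omega) (g w * phi w)].

Definition has_wderiv (Omega : set (R * R)) (v : R * R) (u : R * R -> R) :=
  exists g, is_wderiv Omega v u g.

(* A representative of the weak derivative, which is unique almost everywhere
   on Omega; its values carry no information unless [has_wderiv] holds. *)
Definition wderiv (Omega : set (R * R)) (v : R * R) (u : R * R -> R) :
    R * R -> R :=
  xget (cst 0) [set g | is_wderiv Omega v u g].

(* L^p(Omega) is realized as the space of functions of L^p(R^2) that
   vanish off Omega: a function is extended by zero with [f \_ Omega]. *)
Definition in_Lp (Omega : set (R * R)) (p : R) (f : R * R -> R) : Prop :=
  (f \_ Omega : measurableTypeR R * measurableTypeR R -> R) \in Lfun leb2 p%:E.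

Definition Lp_norm (Omega : set (R * R)) (p : R) (f : R * R -> R) : \bar R :=
  'N[leb2]_p%:E[EFin \o (f \_ Omega)]%E.

Definition in_H1 (Omega : set (R * R)) (u : R * R -> R) : Prop :=
  in_Lp Omega 2 u /\
  forall v, v \in [:: e_x; e_z] ->
    has_wderiv Omega v u /\ in_Lp Omega 2 (wderiv Omega v u).

(* The integrand is nonnegative when 0 < eps, so the integral always makes
   sense in [0, +oo], and it is +oo as soon as one of its two parts is; in
   particular when (d_z u - (d_x u)^2 / 2)^2 is not integrable on Omega. *)
Definition energy (Omega : set (R * R)) (eps : R) (u : R * R -> R) : \bar R :=
  let ux := wderiv Omega e_x u in
  let uz := wderiv Omega e_z u in
  let uxx := wderiv Omega e_x ux in
  ((2^-1)%:E * \int[leb2]_(w in Omega)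
     (eps^-1 * (uz w - 2^-1 * ux w ^+ 2) ^+ 2 + eps * uxx w ^+ 2)%:E)%E.

Definition relatively_compact_Lp (Omega : set (R * R)) (p : R)
    (p1 : (1 <= p%:E)%E) (f : nat -> R * R -> R) : Prop :=
  (forall n, in_Lp Omega p (f n)) /\
  precompact [set g : LfunType leb2 p1 |
                exists n, g = f n \_ Omega :> (R * R -> R)].

End plane.

(* Main.v *)
(* Write m = u_x and r = u_z - m^2/2.  Besides the curl-free field (m, u_z), the
   potential u carries the entropy m^2/2 with flux -m^3/3 - m r, whose production
   -m_x r is bounded in L^1 by the energy, since
   |m_x r| <= (r^2/eps + eps m_x^2)/2.  For two potentials u_1, u_2, testing the
   difference of the entropy balances with cutoff * (u_1 - u_2 - k) and using
   (m_1 - m_2)(m_1^3 - m_2^3)/3 - (m_1^2 - m_2^2)^2/4 = (m_1 - m_2)^4/12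
   bounds the weighted L^4 distance of m_1 and m_2 by sup |u_1 - u_2 - k| plus
   terms that vanish with r.  On a box of size delta^2 x delta^4, u_x in L^6 and
   u_z in L^2 make u oscillate by O(delta), so the u_n split into finitely many
   classes that are uniformly close up to constants, and the u_x split
   accordingly into finitely many classes that are close in L^4_loc.  Mollification
   reduces the H^1 case to smooth potentials.  Interpolation with the L^p bound
   gives total boundedness of u_x in every L^q with q < p; the case q = 4 and
   r -> 0 in L^2 give that of u_z = r + m^2/2; completeness of L^q concludes. *)

From HB Require Import structures.
Require Import Defs.
From mathcomp Require Import all_boot all_order all_algebra.
From mathcomp Require Import all_classical all_reals all_analysis.
From mathcomp Require Import measurable_realfun.
From mathcomp Require Import ring lra.
Set Implicit Arguments.
Unset Strict Implicit.
Unset Printing Implicit Defensive.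
Import Order.TTheory GRing.Theory Num.Theory.
Import numFieldNormedType.Exports.
Local Open Scope classical_set_scope.
Local Open Scope ring_scope.

(** * Integration on boxes of the plane *)

(** The bounds on [u_x] alone give only weak compactness; the gain is a quantitative form of
    compensated compactness, with the potential itself in the test function, so that smallness of
    [u_1 - u_2 - k] takes the place of weak convergence. Total boundedness is expressed by finite
    colourings of the indices: no subsequence is extracted, and successive requirements are met by
    pairing colourings. The proportions of the boxes balance the exponents: on area [delta^6],
    Young's inequality makes the integrals of [|u_x|] and [|u_z|] of order [delta^5] and [delta^3];
    divided by the height [delta^4] and a width of order [delta^2], both give variation of order
    [delta] on suitable lines. Mollification meets an obstacle, since the residue is quadratic in
    [u_x] and does not commute with it; the scale is therefore chosen for each [n] separately, so
    that the error stays below [eps n]. Finally the weights degenerate at the edges of the boxes and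
    near the boundary of [Omega]; the global step works with [min 1 |.|^4], for which a set of small
    measure costs little, and the [L^p] bound then removes the truncation. *)

Notation plane R := (measurableTypeR R * measurableTypeR R)%type.

Section plane_measure.
Context {R : realType}.
Local Notation mu := (@lebesgue_measure R).
Implicit Types (f : R * R -> R).

Definition box (a b c d : R) : set (R * R) := `[a, b]%classic `*` `[c, d]%classic.

(** Squares with rational centre and radius form a countable base of the topology, so an open set is
    a countable union of measurable rectangles. *)
Lemma open_measurable_plane (U : set (R * R)) : open U ->
  measurable (U : set (plane R)).
Proof.
move=> oU.
pose B (t : rat * rat * rat) : set (plane R) :=
  `]ratr t.1.1 - ratr t.2, ratr t.1.1 + ratr t.2[%classic `*`
  `]ratr t.1.2 - ratr t.2, ratr t.1.2 + ratr t.2[%classic.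
have -> : U = \bigcup_(t in [set t | B t `<=` U]) B t.
  apply/seteqP; split => [[x z] Uxz|w [t /= Bt Bw]]; last exact: Bt.
  have [e /= e0 eU] := (nbhs_ballP _ _).1 (open_nbhs_nbhs (conj oU Uxz)).
  have [q1 xq1] : exists q : rat, x - e / 4 < ratr q < x + e / 4.
    have /rat_in_itvoo[q qI] : x - e / 4 < x + e / 4 by lra.
    by exists q; move: qI; rewrite in_itv.
  have [q2 zq2] : exists q : rat, z - e / 4 < ratr q < z + e / 4.
    have /rat_in_itvoo[q qI] : z - e / 4 < z + e / 4 by lra.
    by exists q; move: qI; rewrite in_itv.
  (* The centre is off by less than [e / 4] in each coordinate and the radius lies between [e / 4]
     and [e / 2], so the square contains the point and stays within distance [3 e / 4] of it. *)
  have [q eq] : exists q : rat, e / 4 < ratr q < e / 2.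
    have /rat_in_itvoo[q qI] : e / 4 < e / 2 by lra.
    by exists q; move: qI; rewrite in_itv.
  exists (q1, q2, q) => /=.
    move=> [x' z'] [] /=; rewrite !in_itv /= => /andP[h1 h2] /andP[h3 h4].
    apply: eU; split => /=; rewrite /ball/= ltr_distl; apply/andP; split; lra.
  by split => /=; rewrite in_itv /=; apply/andP; split; lra.
rewrite bigcup_mkcond; apply: countable_bigcupT_measurable => [|t].
  exact: countableP.
case: ifP => // _.
by apply: measurableX; exact: measurable_itv.
Qed.

Lemma continuous_measurable_plane f : continuous f ->
  measurable_fun [set: plane R] (f : plane R -> R).
Proof.
move=> cf; apply: (measurability _ (RGenOInfty.measurableE R)).
move=> _ [_ [x ->] <-]; rewrite setTI.
apply: open_measurable_plane.
by apply: open_comp => // w _; exact: cf.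
Qed.

Lemma measurable_box a b c d : measurable (box a b c d : set (plane R)).
Proof. by apply: measurableX; exact: measurable_itv. Qed.

Lemma sub_box a b c d a' b' c' d' : a <= a' -> b' <= b -> c <= c' -> d' <= d ->
  box a' b' c' d' `<=` box a b c d.
Proof.
move=> aa bb cc dd [x z] [/=]; rewrite !in_itv/= => /andP[x1 x2] /andP[z1 z2].
by split; rewrite /= in_itv/= ?(le_trans aa x1) ?(le_trans x2 bb)
  ?(le_trans cc z1) ?(le_trans z2 dd).
Qed.

Lemma compact_box a b c d : compact (box a b c d).
Proof. by apply: compact_setX; exact: segment_compact. Qed.

Lemma leb2X (A B : set R) : measurable (A : set (measurableTypeR R)) ->
  measurable (B : set (measurableTypeR R)) ->
  (leb2 (A `*` B) = mu A * mu B)%E.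
Proof. by move=> mA mB; exact: product_measure1E. Qed.

Lemma leb2_box a b c d : a <= b -> c <= d ->
  leb2 (box a b c d) = ((b - a) * (d - c))%:E.
Proof.
move=> ab cd.
rewrite leb2X; [|exact: measurable_itv|exact: measurable_itv].
have itvE (u v : R) : u <= v -> mu `[u, v]%classic = (v - u)%:E.
  move=> uv; rewrite lebesgue_measure_itv/= lte_fin.
  by case: ltgtP uv => // -> _; rewrite subrr.
by rewrite !itvE// EFinM.
Qed.

Lemma continuous_bounded_box f a b c d : continuous f ->
  exists2 M : R, 0 <= M & forall w, box a b c d w -> `|f w| <= M.
Proof.
move=> cf.
have : compact (f @` box a b c d).
  apply: continuous_compact; last exact: compact_box.
  exact: continuous_subspaceT.
move/compact_bounded => [M [Mr MP]].
exists (`|M| + 1) => // w Bw.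
by apply: (MP (`|M| + 1)); [rewrite ltr_pwDr// ler_norm|exists w].
Qed.

Lemma leb2_box_lty a b c d : (leb2 (box a b c d) < +oo)%E.
Proof.
have lab x y : (mu `[x, y]%classic < +oo)%E.
  by rewrite lebesgue_measure_itv/=; case: ifP => _; rewrite -?EFinB ltry.
rewrite leb2X; [|exact: measurable_itv|exact: measurable_itv].
by rewrite lte_mul_pinfty// ge0_fin_numE.
Qed.

Lemma continuous_integrable_box f a b c d : continuous f ->
  leb2.-integrable (box a b c d : set (plane R)) (EFin \o f).
Proof.
move=> cf; have [M _ fM] := continuous_bounded_box a b c d cf.
apply: measurable_bounded_integrable.
- exact: measurable_box.
- exact: leb2_box_lty.
- apply: measurable_funS (continuous_measurable_plane cf) => //.
- exists M; split; first exact: num_real.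
  by move=> M' MM' w /fM /le_trans; apply; exact: ltW.
Qed.

Lemma sigma_finite_leb2 :
  sigma_finite [set: plane R] (@leb2 R : set (plane R) -> \bar R).
Proof.
exists (fun n : nat => box (- n%:R) n%:R (- n%:R) n%:R).
  apply/esym/seteqP; split => // -[x z] _.
  exists (Num.bound (`|x| + `|z|)) => //.
  have h : `|x| + `|z| < (Num.bound (`|x| + `|z|))%:R.
    by apply: archi_boundP; rewrite addr_ge0.
  have x0 := normr_ge0 x; have z0 := normr_ge0 z.
  by split; rewrite /= in_itv/= -ler_norml; lra.
by move=> n; split; [exact: measurable_box|exact: leb2_box_lty].
Qed.

End plane_measure.

(* [leb2] is a bundled measure, to which no further structure can be attached;
   [lam2] is the same function, registered as sigma-finite. *)
Definition lam2 (R : realType) : set (plane R) -> \bar R := @leb2 R.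

HB.instance Definition _ (R : realType) := isMeasure.Build _ _ _ (@lam2 R)
  (measure0 (@leb2 R)) (measure_ge0 (@leb2 R))
  (@measure_semi_sigma_additive _ _ _ (@leb2 R)).

HB.instance Definition _ (R : realType) := Measure_isSigmaFinite.Build _ _ R
  (@lam2 R) (@sigma_finite_leb2 R).

(** * Iterated integrals and the fundamental theorem of calculus on boxes *)

Section fubini_box.
Context {R : realType}.
Local Notation mu := (@lebesgue_measure R).
Implicit Types (f : R * R -> R).

Lemma continuous_slicex f z : continuous f -> continuous (fun x => f (x, z)).
Proof.
move=> cf x; apply: (@continuous_comp _ _ _ (fun x : R => (x, z)) f); last exact: cf.
by apply: (@cvg_pair _ _ _ _ (nbhs x) (nbhs z)); [exact: cvg_id|exact: cvg_cst].
Qed.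

Lemma continuous_slicez f x : continuous f -> continuous (fun z => f (x, z)).
Proof.
move=> cf z; apply: (@continuous_comp _ _ _ (fun z : R => (x, z)) f); last exact: cf.
by apply: (@cvg_pair _ _ _ _ (nbhs x) (nbhs z)); [exact: cvg_cst|exact: cvg_id].
Qed.

Lemma ge0_integral_box_xz (f : plane R -> R) a b c d :
  measurable_fun [set: plane R] f ->
  (forall w, 0 <= f w) ->
  (\int[leb2]_(w in box a b c d) (f w)%:E =
   \int[mu]_(x in `[a, b]) \int[mu]_(z in `[c, d]) (f (x, z))%:E)%E.
Proof.
move=> mf f0.
have mfb : measurable_fun [set: plane R]
    ((EFin \o f) \_ (box a b c d) : plane R -> \bar R).
  apply: (measurable_restrictT _ (measurable_box a b c d)).1.
  by apply/measurable_EFinP; apply: measurable_funS mf.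
rewrite integral_mkcond/=.
rewrite [LHS](fubini_tonelli1 (m1 := mu) (m2 := mu))/=.
- rewrite [RHS]integral_mkcond; apply: eq_integral => x _.
  rewrite /fubini_F/= patchE; case: ifPn => xab.
    rewrite [RHS]integral_mkcond; apply: eq_integral => z _.
    by rewrite !patchE /box in_setX/= xab.
  apply: integral0_eq => z _; by rewrite patchE /box in_setX/= (negbTE xab).
- exact: mfb.
- by move=> w; rewrite patchE; case: ifP => // _; rewrite lee_fin.
Qed.

Lemma ge0_integral_box_zx (f : plane R -> R) a b c d :
  measurable_fun [set: plane R] f ->
  (forall w, 0 <= f w) ->
  (\int[leb2]_(w in box a b c d) (f w)%:E =
   \int[mu]_(z in `[c, d]) \int[mu]_(x in `[a, b]) (f (x, z))%:E)%E.
Proof.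
move=> mf f0.
have mfb : measurable_fun [set: plane R]
    ((EFin \o f) \_ (box a b c d) : plane R -> \bar R).
  apply: (measurable_restrictT _ (measurable_box a b c d)).1.
  by apply/measurable_EFinP; apply: measurable_funS mf.
rewrite integral_mkcond/=.
rewrite [LHS](fubini_tonelli2 (m1 := mu) (m2 := mu))/=.
- rewrite [RHS]integral_mkcond; apply: eq_integral => z _.
  rewrite /fubini_G/= patchE; case: ifPn => zcd.
    rewrite [RHS]integral_mkcond; apply: eq_integral => x _.
    by rewrite !patchE /box in_setX/= zcd andbT.
  apply: integral0_eq => x _; by rewrite patchE /box in_setX/= (negbTE zcd) andbF.
- exact: mfb.
- by move=> w; rewrite patchE; case: ifP => // _; rewrite lee_fin.
Qed.

(* Fundamental theorem of calculus in one variable, integrated in the other. *)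
Lemma Rintegral_box_dx (F f : R * R -> R) (a b c d : R) : a < b -> continuous f ->
  (forall x z : R, is_derive x 1 (fun x : R => F (x, z)) (f (x, z))) ->
  (forall z, F (a, z) = 0) -> (forall z, F (b, z) = 0) ->
  \int[leb2]_(w in box a b c d) f w = 0.
Proof.
move=> ab cf dF Fa Fb.
have intf := continuous_integrable_box a b c d cf.
rewrite /Rintegral integral_mkcond/=.
rewrite -[X in fine X](integral21_prod_meas1 (m1 := mu) (m2 := mu)); last first.
  exact: (integrable_mkcond _ (measurable_box a b c d)).1 intf.
rewrite integral0_eq// => z _.
rewrite /fubini_G.
have [zcd|zcd] := boolP (z \in `[c, d]%classic); last first.
  apply: integral0_eq => x _; by rewrite patchE /box in_setX/= (negbTE zcd) andbF.
transitivity (\int[mu]_(x in `[a, b]) (f (x, z))%:E)%E.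
  rewrite [RHS]integral_mkcond; apply: eq_integral => x _.
  by rewrite !patchE /box in_setX/= zcd andbT.
have cF x : {for x, continuous (fun x => F (x, z))}.
  by apply: differentiable_continuous; apply/derivable1_diffP; exact: (dF x z).(ex_derive).
rewrite (continuous_FTC2 (F := fun x => F (x, z))) ?Fa ?Fb ?subee//.
- exact/continuous_subspaceT/continuous_slicex.
- split.
  + by move=> x _; exact: ex_derive.
  + by apply: cvg_at_right_filter; exact: cF.
  + by apply: cvg_at_left_filter; exact: cF.
- by move=> x _; rewrite derive1E; exact: derive_val.
Qed.

Lemma Rintegral_box_dz (F f : R * R -> R) (a b c d : R) : c < d -> continuous f ->
  (forall x z : R, is_derive z 1 (fun z : R => F (x, z)) (f (x, z))) ->
  (forall x, F (x, c) = 0) -> (forall x, F (x, d) = 0) ->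
  \int[leb2]_(w in box a b c d) f w = 0.
Proof.
move=> cd cf dF Fc Fd.
have intf := continuous_integrable_box a b c d cf.
rewrite /Rintegral integral_mkcond/=.
rewrite -[X in fine X](integral12_prod_meas1 (m1 := mu) (m2 := mu)); last first.
  exact: (integrable_mkcond _ (measurable_box a b c d)).1 intf.
rewrite integral0_eq// => x0 _.
rewrite /fubini_F.
have [xab|xab] := boolP (x0 \in `[a, b]%classic); last first.
  apply: integral0_eq => z _; by rewrite patchE /box in_setX/= (negbTE xab).
transitivity (\int[mu]_(z in `[c, d]) (f (x0, z))%:E)%E.
  rewrite [RHS]integral_mkcond; apply: eq_integral => z _.
  by rewrite !patchE /box in_setX/= xab.
have cF z : {for z, continuous (fun z => F (x0, z))}.
  by apply: differentiable_continuous; apply/derivable1_diffP; exact: (dF x0 z).(ex_derive).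
rewrite (continuous_FTC2 (F := fun z => F (x0, z))) ?Fc ?Fd ?subee//.
- exact/continuous_subspaceT/continuous_slicez.
- split.
  + by move=> z _; exact: ex_derive.
  + by apply: cvg_at_right_filter; exact: cF.
  + by apply: cvg_at_left_filter; exact: cF.
- by move=> z _; rewrite derive1E; exact: derive_val.
Qed.

End fubini_box.

(** The field [pot_xz] is at once the [z]-derivative of [pot_x] and the [x]-derivative of [pot_z];
    this sharing is the curl-free condition. All derivatives are one-variable derivatives along the
    axes, the form in which the fundamental theorem of calculus is applied on slices. *)
Record potential (R : realType) := Potential {
  pot : R * R -> R ;
  pot_x : R * R -> R ;
  pot_z : R * R -> R ;
  pot_xx : R * R -> R ;
  pot_xz : R * R -> R ;
  pot_cont : continuous pot ;
  pot_x_cont : continuous pot_x ;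
  pot_z_cont : continuous pot_z ;
  pot_xx_cont : continuous pot_xx ;
  pot_xz_cont : continuous pot_xz ;
  is_derive_pot_x : forall x z : R,
    is_derive x (1 : R) (fun x : R => pot (x, z)) (pot_x (x, z)) ;
  is_derive_pot_z : forall x z : R,
    is_derive z (1 : R) (fun z : R => pot (x, z)) (pot_z (x, z)) ;
  is_derive_pot_xx : forall x z : R,
    is_derive x (1 : R) (fun x : R => pot_x (x, z)) (pot_xx (x, z)) ;
  is_derive_pot_xz : forall x z : R,
    is_derive z (1 : R) (fun z : R => pot_x (x, z)) (pot_xz (x, z)) ;
  is_derive_pot_zx : forall x z : R,
    is_derive x (1 : R) (fun x : R => pot_z (x, z)) (pot_xz (x, z)) }.

Arguments pot {R}.
Arguments pot_x {R}.
Arguments pot_z {R}.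
Arguments pot_xx {R}.
Arguments pot_xz {R}.

(* A constant to match on in [continuity]: the goal [continuous f] is itself a
   quantified statement. *)
Definition cts (T : topologicalType) (R : realType) (f : T -> R) : Prop :=
  continuous f.

Section cts_ops.
Context {T : topologicalType} {R : realType}.
Implicit Types (f g : T -> R).

Lemma cts_continuous f : cts f -> continuous f.
Proof. by []. Qed.

Lemma ctsD f g : cts f -> cts g -> cts (fun w => f w + g w).
Proof. by move=> cf cg w; apply: cvgD; [exact: cf|exact: cg]. Qed.

Lemma ctsN f : cts f -> cts (fun w => - f w).
Proof. by move=> cf w; apply: cvgN; exact: cf. Qed.

Lemma ctsM f g : cts f -> cts g -> cts (fun w => f w * g w).
Proof. by move=> cf cg w; apply: cvgM; [exact: cf|exact: cg]. Qed.

Lemma ctsX f n : cts f -> cts (fun w => f w ^+ n).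
Proof.
move=> cf; elim: n => [|n IHn]; first by move=> w; exact: cvg_cst.
by under eq_fun do rewrite exprS; exact: ctsM.
Qed.

Lemma cts_cst (c : R) : cts (fun _ : T => c).
Proof. by move=> w; exact: cvg_cst. Qed.

Lemma cts_norm f : cts f -> cts (fun w => `|f w|).
Proof. by move=> cf w; apply: cvg_norm; exact: cf. Qed.

End cts_ops.

Lemma cts_fst (R : realType) : cts (fun w : R * R => w.1).
Proof. by move=> w; exact: cvg_fst. Qed.

Lemma cts_snd (R : realType) : cts (fun w : R * R => w.2).
Proof. by move=> w; exact: cvg_snd. Qed.

Definition residue {R : realType} (v : potential R) (w : R * R) : R :=
  pot_z v w - 2^-1 * pot_x v w ^+ 2.

Lemma residue_cont (R : realType) (v : potential R) : continuous (residue v).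
Proof.
rewrite /residue; apply: ctsD; first exact: pot_z_cont.
apply/ctsN/ctsM; first exact: cts_cst.
exact/ctsX/pot_x_cont.
Qed.

Ltac cts_tac := lazymatch goal with
  | |- cts (fun w => @GRing.add _ (@?f w) (@?g w)) => apply: (@ctsD _ _ f g); cts_tac
  | |- cts (fun w => @GRing.opp _ (@?f w)) => apply: (@ctsN _ _ f); cts_tac
  | |- cts (fun w => @GRing.mul _ (@?f w) (@?g w)) => apply: (@ctsM _ _ f g); cts_tac
  | |- cts (fun w => @GRing.exp _ (@?f w) ?n) => apply: (@ctsX _ _ f n); cts_tac
  | |- cts (fun w => @Num.norm _ _ (@?f w)) => apply: (@cts_norm _ _ f); cts_tac
  | |- cts (fun w => fst w) => exact: cts_fst
  | |- cts (fun w => snd w) => exact: cts_snd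
  | |- cts (fun _ => ?c) => exact: (@cts_cst _ _ c)
  | |- cts (fun w => pot ?v w) => exact: pot_cont
  | |- cts (fun w => pot_x ?v w) => exact: pot_x_cont
  | |- cts (fun w => pot_z ?v w) => exact: pot_z_cont
  | |- cts (fun w => pot_xx ?v w) => exact: pot_xx_cont
  | |- cts (fun w => pot_xz ?v w) => exact: pot_xz_cont
  | |- cts (fun w => residue ?v w) => exact: residue_cont
  | |- _ => try by []
  end.

Ltac continuity := apply: cts_continuous; cts_tac.

Section Rintegral_box.
Context {R : realType}.
Variables (a b c d : R).
Local Notation B := (box a b c d).
Implicit Types (f g : R * R -> R).

Lemma Rintegral_boxD f g : continuous f -> continuous g ->
  \int[leb2]_(w in B) (f w + g w) =
  \int[leb2]_(w in B) f w + \int[leb2]_(w in B) g w.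
Proof.
move=> cf cg; rewrite RintegralD//; first exact: measurable_box.
- exact: continuous_integrable_box.
- exact: continuous_integrable_box.
Qed.

Lemma Rintegral_boxZ f (k : R) : continuous f ->
  \int[leb2]_(w in B) (k * f w) = k * \int[leb2]_(w in B) f w.
Proof.
move=> cf; rewrite RintegralZl//; first exact: measurable_box.
exact: continuous_integrable_box.
Qed.

Lemma le_Rintegral_box f g : continuous f -> continuous g ->
  (forall w, B w -> f w <= g w) ->
  \int[leb2]_(w in B) f w <= \int[leb2]_(w in B) g w.
Proof.
move=> cf cg fg; apply: le_Rintegral => //; first exact: measurable_box.
- exact: continuous_integrable_box.
- exact: continuous_integrable_box.
Qed.

Lemma Rintegral_box_cst (k : R) : a <= b -> c <= d ->
  \int[leb2]_(w in B) k = k * ((b - a) * (d - c)).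
Proof.
move=> ab cd; rewrite Rintegral_cst; last exact: measurable_box.
by rewrite leb2_box.
Qed.

Lemma EFin_Rintegral_box f : continuous f ->
  (\int[leb2]_(w in B) (f w)%:E = (\int[leb2]_(w in B) f w)%:E)%E.
Proof.
move=> cf; rewrite /Rintegral fineK//.
apply: integrable_fin_num; first exact: measurable_box.
exact: continuous_integrable_box.
Qed.

End Rintegral_box.

(** * The div-curl estimate *)

Section even_powers.
Context {R : realType}.
Implicit Types (t x y : R).

Lemma norm_even t n : `|t| ^+ (2 * n) = t ^+ (2 * n).
Proof. by rewrite !exprM real_normK ?num_real. Qed.

Lemma sqr_le1D6 t : t ^+ 2 <= 1 + t ^+ 6.
Proof.
rewrite (exprM t 2 3); have := sqr_ge0 t; move: (t ^+ 2) => s s0.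
have s30 : 0 <= s ^+ 3 by exact: exprn_ge0.
have [s1|s1] := leP s 1; first by lra.
have : s * 1 <= s * s ^+ 2.
  by rewrite ler_pM2l ?(lt_trans ltr01)// exprn_ege1// ltW.
by rewrite mulr1 -exprS => h; lra.
Qed.

Lemma pow4_le1D6 t : t ^+ 4 <= 1 + t ^+ 6.
Proof.
rewrite (exprM t 2 2) (exprM t 2 3); have := sqr_ge0 t; move: (t ^+ 2) => s s0.
have [s1|s1] := leP s 1.
  have : s ^+ 2 <= 1 by rewrite exprn_ile1.
  by have := exprn_ge0 3 s0; lra.
have : s ^+ 2 * 1 <= s ^+ 2 * s by rewrite ler_wpM2l ?exprn_ge0// ltW.
by rewrite mulr1 -exprSr; lra.
Qed.

Lemma pow4_add x y : (x + y) ^+ 4 <= 8 * (2 + x ^+ 6 + y ^+ 6).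
Proof.
have sq (s t : R) : (s + t) ^+ 2 <= 2 * (s ^+ 2 + t ^+ 2).
  by rewrite -subr_ge0 (_ : _ - _ = (s - t) ^+ 2) ?sqr_ge0//; ring.
have ex (t : R) : t ^+ 4 = (t ^+ 2) ^+ 2 by rewrite -(exprM t 2 2).
have hx := pow4_le1D6 x; have hy := pow4_le1D6 y; rewrite ex in hx; rewrite ex in hy.
have hs := sq (x ^+ 2) (y ^+ 2).
have hq : ((x + y) ^+ 2) ^+ 2 <= (2 * (x ^+ 2 + y ^+ 2)) ^+ 2.
  by apply: lerXn2r; rewrite ?nnegrE ?sqr_ge0// mulr_ge0// addr_ge0 ?sqr_ge0.
rewrite ex; apply: (le_trans hq).
rewrite (exprMn _ 2 (x ^+ 2 + y ^+ 2)) (_ : 2 ^+ 2 = 4); last by ring.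
move: hx hy hs; move: ((x ^+ 2 + y ^+ 2) ^+ 2) ((x ^+ 2) ^+ 2) ((y ^+ 2) ^+ 2) (x ^+ 6) (y ^+ 6).
by move=> S a b c e; lra.
Qed.

End even_powers.

Section div_curl.
Context {R : realType}.
Implicit Types (v : potential R) (w : R * R).

Variables (a b c d : R).
Hypotheses (ab : a < b) (cd : c < d).
Local Notation B := (box a b c d).

(** A polynomial that is positive inside the box and zero on its sides: integration by parts on
    slices leaves no boundary terms. *)
Definition cutoff (w : R * R) : R := (w.1 - a) * (b - w.1) * ((w.2 - c) * (d - w.2)).
Definition cutoff_x w : R := (a + b - 2 * w.1) * ((w.2 - c) * (d - w.2)).
Definition cutoff_z w : R := (w.1 - a) * (b - w.1) * (c + d - 2 * w.2).

Definition dif (f : potential R -> R * R -> R) v1 v2 w := f v1 w - f v2 w.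

Definition flux_z v w := 2^-1 * pot_x v w ^+ 2.
(** The [x]-derivative of [- pot_x * residue] cancels both that of the cubic term and the
    [z]-derivative [pot_x * pot_xz] of the entropy [flux_z]. The divergence that remains is
    [- pot_xx * residue]. *)
Definition flux_x v w := - (3^-1 * pot_x v w ^+ 3) - pot_x v w * residue v w.

(** The divergence of [cutoff * (u_1 - u_2 - k)] times the difference of the two entropy fields,
    after its main part [- cutoff * (m_1 - m_2)^4 / 12] has been taken out. *)
Definition div_curl_rest v1 v2 (k : R) w :=
  cutoff_x w * (dif pot v1 v2 w - k) * dif flux_x v1 v2 w
  + cutoff_z w * (dif pot v1 v2 w - k) * dif flux_z v1 v2 w
  - cutoff w * (dif pot v1 v2 w - k) *
    (pot_xx v1 w * residue v1 w - pot_xx v2 w * residue v2 w)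
  + cutoff w * (dif residue v1 v2 w * dif flux_z v1 v2 w
     - dif pot_x v1 v2 w * (pot_x v1 w * residue v1 w - pot_x v2 w * residue v2 w)).

(** The components [F] and [G] vanish on the vertical and on the horizontal sides respectively, so
    the integrals of [f] and of [g] are zero. The factor 12 is that of the algebraic identity for
    fourth powers. *)
Lemma div_curl v1 v2 k :
  \int[leb2]_(w in B) (cutoff w * dif pot_x v1 v2 w ^+ 4) =
  12 * \int[leb2]_(w in B) (div_curl_rest v1 v2 k w).
Proof.
pose F w := cutoff w * (dif pot v1 v2 w - k) * dif flux_x v1 v2 w.
pose G w := cutoff w * (dif pot v1 v2 w - k) * dif flux_z v1 v2 w.
(* [fxx] and [fzz] are the [x]-derivative of [flux_x] and the [z]-derivative of [flux_z]; in the
   first, [pot_xz - pot_x * pot_xx] is the [x]-derivative of the residue. *)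
pose fxx v w := - (pot_x v w ^+ 2 * pot_xx v w) - (pot_xx v w * residue v w +
   pot_x v w * (pot_xz v w - pot_x v w * pot_xx v w)).
pose fzz v w := pot_x v w * pot_xz v w.
pose f w := cutoff_x w * (dif pot v1 v2 w - k) * dif flux_x v1 v2 w +
  cutoff w * dif pot_x v1 v2 w * dif flux_x v1 v2 w +
  cutoff w * (dif pot v1 v2 w - k) * dif fxx v1 v2 w.
pose g w := cutoff_z w * (dif pot v1 v2 w - k) * dif flux_z v1 v2 w +
  cutoff w * dif pot_z v1 v2 w * dif flux_z v1 v2 w +
  cutoff w * (dif pot v1 v2 w - k) * dif fzz v1 v2 w.
have dF (x z : R) : is_derive x (1 : R) (fun x : R => F (x, z)) (f (x, z)).
  have := is_derive_pot_x v1 x z; have := is_derive_pot_x v2 x z.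
  have := is_derive_pot_xx v1 x z; have := is_derive_pot_xx v2 x z.
  have := is_derive_pot_zx v1 x z; have := is_derive_pot_zx v2 x z.
  move=> h1 h2 h3 h4 h5 h6.
  rewrite /F /f /cutoff /dif /flux_x /residue /cutoff_x /=.
  apply: is_derive_eq.
  by rewrite /GRing.scale/= /fxx /residue; field.
have dG (x z : R) : is_derive z (1 : R) (fun z : R => G (x, z)) (g (x, z)).
  have := is_derive_pot_z v1 x z; have := is_derive_pot_z v2 x z.
  have := is_derive_pot_xz v1 x z; have := is_derive_pot_xz v2 x z.
  move=> h1 h2 h3 h4.
  rewrite /G /g /cutoff /dif /flux_z /cutoff_z /=.
  apply: is_derive_eq.
  by rewrite /GRing.scale/= /fzz; field.
have cf : continuous f.
  by rewrite /f /cutoff /cutoff_x /dif /flux_x /fxx /residue; continuity.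
have cg : continuous g.
  by rewrite /g /cutoff /cutoff_z /dif /flux_z /fzz; continuity.
have If : \int[leb2]_(w in B) f w = 0.
  have := @Rintegral_box_dx _ F f a b c d ab cf dF; apply => z;
  by rewrite /F /cutoff/= subrr ?(mulr0, mul0r).
have Ig : \int[leb2]_(w in B) g w = 0.
  have := @Rintegral_box_dz _ G g a b c d cd cg dG; apply => z;
  by rewrite /G /cutoff/= subrr ?(mulr0, mul0r).
have crest : continuous (div_curl_rest v1 v2 k).
  rewrite /div_curl_rest /cutoff /cutoff_x /cutoff_z /dif /flux_x /flux_z /residue.
  by continuity.
have E w : cutoff w * dif pot_x v1 v2 w ^+ 4 =
    12 * (div_curl_rest v1 v2 k w - (f w + g w)).
  rewrite /div_curl_rest /f /g /dif /flux_x /flux_z /fxx /fzz /residue.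
  by field.
under eq_Rintegral do rewrite E.
have cfg : continuous (fun w => - 1 * (f w + g w)) by continuity.
rewrite Rintegral_boxZ; last by continuity.
under eq_Rintegral do rewrite -mulN1r.
rewrite Rintegral_boxD// Rintegral_boxZ; last by continuity.
by rewrite (Rintegral_boxD a b c d cf cg) If Ig addr0 mulr0 addr0.
Qed.

(** The derivatives of the cutoff and the entropy productions come with the factor [u_1 - u_2 - k],
    hence with [s]. The last group has no such factor and is small only through the residues; [lam]
    is the free weight with which they are separated from the powers of [m]. *)
Lemma div_curl_rest_le (L s lam : R) v1 v2 k w : 0 < lam -> 0 <= s ->
  `|cutoff w| <= L -> `|cutoff_x w| <= L -> `|cutoff_z w| <= L ->
  `|pot v1 w - pot v2 w - k| <= s ->
  div_curl_rest v1 v2 k w <= L * (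
    s * (8 + 4 * pot_x v1 w ^+ 6 + 4 * pot_x v2 w ^+ 6
      + 4 * residue v1 w ^+ 2 + 4 * residue v2 w ^+ 2
      + `|pot_xx v1 w * residue v1 w| + `|pot_xx v2 w * residue v2 w|)
    + 8 * lam * (2 + pot_x v1 w ^+ 6 + pot_x v2 w ^+ 6)
    + 2 * lam^-1 * (residue v1 w ^+ 2 + residue v2 w ^+ 2)).
Proof.
rewrite /div_curl_rest /dif /flux_x /flux_z.
set A := cutoff w; set Ax := cutoff_x w; set Az := cutoff_z w.
set D := pot v1 w - pot v2 w - k.
set m1 := pot_x v1 w; set m2 := pot_x v2 w.
set r1 := residue v1 w; set r2 := residue v2 w.
set x1 := pot_xx v1 w * r1; set x2 := pot_xx v2 w * r2.
move=> lam0 s0 hA hAx hAz hD.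
have L0 : 0 <= L by apply: le_trans hA.
have fz (m : R) : `|2^-1 * m ^+ 2| <= 1 + m ^+ 6.
  have h1 := sqr_le1D6 m; have h2 := sqr_ge0 m; clear -ab cd h1 h2.
  by rewrite ger0_norm; [lra|exact: mulr_ge0].
have fx (m r : R) : `|- (3^-1 * m ^+ 3) - m * r| <= 1 + m ^+ 6 + r ^+ 2.
  have h1 := sqr_ge0 (m ^+ 3 - 1); have h2 := sqr_ge0 (m ^+ 3 + 1).
  have h3 := sqr_ge0 (m - r); have h4 := sqr_ge0 (m + r).
  have h5 := sqr_le1D6 m; have h6 := sqr_ge0 r.
  have e6 : m ^+ 6 = (m ^+ 3) ^+ 2 by rewrite -exprM.
  move: h1 h2 h3 h4; rewrite !sqrrB !sqrrD -e6 => h1 h2 h3 h4.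
  clear -ab cd h1 h2 h3 h4 h5 h6; rewrite ler_norml; apply/andP; split; lra.
have prod3 (u e E : R) : `|u| <= L -> `|e| <= E -> u * D * e <= L * s * E.
  move=> hu he; apply: (le_trans (ler_norm _)); rewrite !normrM.
  by apply: ler_pM => //; exact: ler_pM.
have dist (e f E F : R) : `|e| <= E -> `|f| <= F -> `|e - f| <= E + F.
  by move=> he hf; apply: (le_trans (ler_normB _ _)); exact: lerD.
have h1 := prod3 _ _ _ hAx (dist _ _ _ _ (fx m1 r1) (fx m2 r2)).
have h2 := prod3 _ _ _ hAz (dist _ _ _ _ (fz m1) (fz m2)).
have hA' : `|- A| <= L by rewrite normrN.
have h3 := prod3 _ _ _ hA' (dist _ _ _ _ (lexx `|x1|) (lexx `|x2|)).
pose S : R := `|r1| + `|r2|; pose Q : R := `|m1| + `|m2|.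
have S0 : 0 <= S by rewrite addr_ge0.
have Q0 : 0 <= Q by rewrite addr_ge0.
have r1S : `|r1| <= S by rewrite lerDl. have r2S : `|r2| <= S by rewrite lerDr.
have m1Q : `|m1| <= Q by rewrite lerDl. have m2Q : `|m2| <= Q by rewrite lerDr.
have h4 : `|(r1 - r2) * (2^-1 * m1 ^+ 2 - 2^-1 * m2 ^+ 2) -
    (m1 - m2) * (m1 * r1 - m2 * r2)| <= 2 * (S * Q ^+ 2).
  have e1 : `|(r1 - r2) * (2^-1 * m1 ^+ 2 - 2^-1 * m2 ^+ 2)| <= S * Q ^+ 2.
    rewrite normrM; apply: ler_pM => //; first exact: ler_normB.
    have -> : 2^-1 * m1 ^+ 2 - 2^-1 * m2 ^+ 2 = 2^-1 * ((m1 - m2) * (m1 + m2)).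
      by rewrite -subr_sqr mulrBr.
    rewrite normrM normrM ger0_norm// expr2.
    apply: (@le_trans _ _ (1 * (Q * Q))); last by rewrite mul1r.
    apply: ler_pM => //; first by rewrite invf_le1 ?ler1n.
    by apply: ler_pM => //; [exact: ler_normB|exact: ler_normD].
  have e2 : `|(m1 - m2) * (m1 * r1 - m2 * r2)| <= S * Q ^+ 2.
    rewrite expr2 mulrCA normrM; apply: ler_pM => //; first exact: ler_normB.
    apply: (le_trans (ler_normB _ _)); rewrite !normrM [S * Q]mulrC mulrDl.
    by apply: lerD; apply: ler_wpM2l.
  by apply: (le_trans (ler_normB _ _)); lra.
(* Young's inequality: [Q ^+ 4] stays bounded in mean by the sixth powers and receives the small
   factor [lam], while the square of the residues absorbs [lam^-1]. *)
have h5 : 2 * (S * Q ^+ 2) <= lam * Q ^+ 4 + lam^-1 * S ^+ 2.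
  have := mulr_ge0 (ltW lam0) (sqr_ge0 (Q ^+ 2 - lam^-1 * S)).
  have -> : lam * (Q ^+ 2 - lam^-1 * S) ^+ 2 =
    lam * Q ^+ 4 + lam^-1 * S ^+ 2 - 2 * (S * Q ^+ 2).
    by field; rewrite gt_eqF.
  by rewrite subr_ge0.
have h6 : S ^+ 2 <= 2 * (r1 ^+ 2 + r2 ^+ 2).
  have := sqr_ge0 (`|r1| - `|r2|).
  rewrite -(real_normK (num_real r1)) -(real_normK (num_real r2)) /S sqrrB sqrrD.
  by move=> h; lra.
have h7 : Q ^+ 4 <= 8 * (2 + m1 ^+ 6 + m2 ^+ 6).
  by rewrite -(norm_even m1 3) -(norm_even m2 3); exact: pow4_add.
have h8 : A * ((r1 - r2) * (2^-1 * m1 ^+ 2 - 2^-1 * m2 ^+ 2) -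
    (m1 - m2) * (m1 * r1 - m2 * r2)) <=
    L * (lam * Q ^+ 4 + lam^-1 * S ^+ 2).
  apply: (le_trans (ler_norm _)); rewrite normrM; apply: ler_pM => //.
  exact: (le_trans h4 h5).
have h9 : lam * Q ^+ 4 + lam^-1 * S ^+ 2 <= 8 * lam * (2 + m1 ^+ 6 + m2 ^+ 6)
    + 2 * lam^-1 * (r1 ^+ 2 + r2 ^+ 2).
  rewrite [8 * _]mulrC [2 * _]mulrC -!mulrA; apply: lerD; apply: ler_wpM2l => //.
    exact: ltW.
  by rewrite invr_ge0 ltW.
have h10 := ler_wpM2l L0 h9.
have Ls0 : 0 <= L * s by exact: mulr_ge0.
have m60 (m : R) : 0 <= m ^+ 6 by rewrite (exprM m 3 2) sqr_ge0.
have h11 : L * s * (1 + m1 ^+ 6 + r1 ^+ 2 + (1 + m2 ^+ 6 + r2 ^+ 2)) +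
  L * s * (1 + m1 ^+ 6 + (1 + m2 ^+ 6)) + L * s * (`|x1| + `|x2|) <=
  L * s * (8 + 4 * m1 ^+ 6 + 4 * m2 ^+ 6 + 4 * r1 ^+ 2 + 4 * r2 ^+ 2 + `|x1| + `|x2|).
  rewrite -!mulrDr; apply: ler_wpM2l => //.
  have := m60 m1; have := m60 m2; have := sqr_ge0 r1; have := sqr_ge0 r2.
  by clear -ab cd; move=> a1 a2 a3 a4; lra.
rewrite -[X in _ <= L * X]addrA [leRHS]mulrDr [L * (s * _)]mulrA.
apply: (le_trans _ (lerD h11 h10)); apply: lerD; last exact: h8.
apply: lerD; first exact: lerD.
by rewrite -mulrA -mulNr mulrA.
Qed.

Lemma cutoff_bounded : exists2 L : R, 0 <= L & forall w, B w ->
  [/\ `|cutoff w| <= L, `|cutoff_x w| <= L & `|cutoff_z w| <= L].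
Proof.
have c1 : continuous cutoff by rewrite /cutoff; continuity.
have c2 : continuous cutoff_x by rewrite /cutoff_x; continuity.
have c3 : continuous cutoff_z by rewrite /cutoff_z; continuity.
have [L1 L10 h1] := continuous_bounded_box a b c d c1.
have [L2 L20 h2] := continuous_bounded_box a b c d c2.
have [L3 L30 h3] := continuous_bounded_box a b c d c3.
exists (L1 + L2 + L3); first by rewrite !addr_ge0.
by move=> w Bw; have := h1 w Bw; have := h2 w Bw; have := h3 w Bw;
  move=> k1 k2 k3; split; lra.
Qed.

End div_curl.

Section div_curl_bound.
Context {R : realType}.
Variables (a b c d : R).
Hypotheses (ab : a < b) (cd : c < d).
Local Notation B := (box a b c d).
Local Notation cutoff := (cutoff a b c d).

(** [L] depends on the box and on [M] only, so [s], [lam] and [rho] may be adjusted after it is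
    known. *)
Lemma div_curl_le (M : R) : exists2 L : R, 0 <= L &
  forall (v1 v2 : potential R) (k s lam rho : R), 0 < lam -> 0 <= s ->
  (forall w, B w -> `|pot v1 w - pot v2 w - k| <= s) ->
  (forall v, v = v1 \/ v = v2 ->
    [/\ \int[leb2]_(w in B) (pot_x v w ^+ 6) <= M,
        \int[leb2]_(w in B) (residue v w ^+ 2) <= rho, rho <= M
      & \int[leb2]_(w in B) `|pot_xx v w * residue v w| <= M]) ->
  \int[leb2]_(w in B) (cutoff w * (pot_x v1 w - pot_x v2 w) ^+ 4) <=
    L * (s + lam + rho / lam).
Proof.
have [L0 L00 HL] := cutoff_bounded a b c d.
pose A := (b - a) * (d - c).
have A0 : 0 <= A by rewrite mulr_ge0// subr_ge0 ltW.
(* After integration, [P] bounds the bracket that multiplies [s] (four terms with coefficient 4 and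
   two with coefficient 1 give 18), [Q] the one that multiplies [lam], and 4 the one that multiplies
   [rho / lam]. *)
pose P := 8 * A + 18 * `|M|; pose Q := 16 * A + 16 * `|M|.
have N0 : 0 <= `|M| by [].
have P0 : 0 <= P by rewrite /P; lra.
have Q0 : 0 <= Q by rewrite /Q; lra.
exists (12 * L0 * (P + Q + 4)).
  by rewrite mulr_ge0// ?mulr_ge0//; lra.
move=> v1 v2 k s lam rho lam0 s0 hs hv.
have [m1 r1 rM x1] := hv v1 (or_introl erefl).
have [m2 r2 _ x2] := hv v2 (or_intror erefl).
have MM : M <= `|M| by exact: ler_norm.
rewrite [leLHS](div_curl ab cd v1 v2 k).
pose G w := L0 * (
    s * (8 + 4 * pot_x v1 w ^+ 6 + 4 * pot_x v2 w ^+ 6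
      + 4 * residue v1 w ^+ 2 + 4 * residue v2 w ^+ 2
      + `|pot_xx v1 w * residue v1 w| + `|pot_xx v2 w * residue v2 w|)
    + 8 * lam * (2 + pot_x v1 w ^+ 6 + pot_x v2 w ^+ 6)
    + 2 * lam^-1 * (residue v1 w ^+ 2 + residue v2 w ^+ 2)).
have : \int[leb2]_(w in B) div_curl_rest a b c d v1 v2 k w <= \int[leb2]_(w in B) G w.
  apply: le_Rintegral_box.
  - rewrite /div_curl_rest /cutoff /cutoff_x /cutoff_z /dif /flux_x /flux_z.
    by continuity.
  - by rewrite /G; continuity.
  - move=> w Bw; have [? ? ?] := HL w Bw.
    by apply: div_curl_rest_le => //; exact: hs.
have cst1 : \int[leb2]_(w in B) 1 = A by rewrite Rintegral_box_cst ?mul1r ?ltW.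
have -> : \int[leb2]_(w in B) G w = L0 * (
    s * (8 * A + 4 * \int[leb2]_(w in B) (pot_x v1 w ^+ 6)
               + 4 * \int[leb2]_(w in B) (pot_x v2 w ^+ 6)
      + 4 * \int[leb2]_(w in B) (residue v1 w ^+ 2)
      + 4 * \int[leb2]_(w in B) (residue v2 w ^+ 2)
      + \int[leb2]_(w in B) `|pot_xx v1 w * residue v1 w|
      + \int[leb2]_(w in B) `|pot_xx v2 w * residue v2 w|)
    + 8 * lam * (2 * A + \int[leb2]_(w in B) (pot_x v1 w ^+ 6)
                + \int[leb2]_(w in B) (pot_x v2 w ^+ 6))
    + 2 * lam^-1 * (\int[leb2]_(w in B) (residue v1 w ^+ 2)
                + \int[leb2]_(w in B) (residue v2 w ^+ 2))).
  rewrite /G.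
  repeat first [rewrite Rintegral_boxZ; last by continuity
    | rewrite Rintegral_boxD; [|by continuity|by continuity]].
  by rewrite cst1; ring.
have m0 f : 0 <= \int[leb2]_(w in B) (f w ^+ 2).
  by apply: Rintegral_ge0 => w _; exact: sqr_ge0.
have rho0 : 0 <= rho by apply: le_trans r1.
have rl0 : 0 <= rho / lam by rewrite divr_ge0// ltW.
move=> h; rewrite -!mulrA ler_pM2l//; apply: (le_trans h); apply: ler_wpM2l => //.
have sP := mulr_ge0 s0 P0; have lP := mulr_ge0 (ltW lam0) P0.
have rP := mulr_ge0 rl0 P0; have sQ := mulr_ge0 s0 Q0.
have lQ := mulr_ge0 (ltW lam0) Q0; have rQ := mulr_ge0 rl0 Q0.
have li0 : 0 <= lam^-1 by rewrite invr_ge0 ltW.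
apply: (@le_trans _ _ (s * P + lam * Q + rho / lam * 4)).
  apply: lerD; first apply: lerD.
  - by apply: ler_wpM2l => //; rewrite /P; clear -ab cd m1 m2 x1 x2 r1 r2 rM MM N0 A0; lra.
  - rewrite [8 * lam]mulrC -mulrA; apply: ler_wpM2l; first exact: ltW.
    by rewrite /Q; clear -ab cd m1 m2 MM N0 A0; lra.
  - by rewrite [2 / lam]mulrC [rho / lam]mulrC -!mulrA; apply: ler_wpM2l => //; clear -ab cd r1 r2; lra.
by clear -ab cd sP lP rP sQ lQ rQ s0 lam0 rl0; nra.
Qed.

End div_curl_bound.

(** * Equicontinuity of potentials *)

Section good_lines.
Context {R : realType}.
Local Notation mu := (@lebesgue_measure R).

Lemma measurable_integral_row (f : plane R -> R) (a b : R) :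
  measurable_fun [set: plane R] f -> (forall w, 0 <= f w) ->
  measurable_fun [set: measurableTypeR R]
    (fun z => \int[mu]_(x in `[a, b]) (f (x, z))%:E)%E.
Proof.
move=> mf f0.
have mX : measurable (`[a, b]%classic `*` [set: R] : set (plane R)).
  exact: measurableX.
pose g : plane R -> \bar R := (EFin \o f) \_ (`[a, b]%classic `*` [set: R]).
have mg : measurable_fun [set: plane R] g.
  apply: (measurable_restrictT _ mX).1.
  by apply/measurable_EFinP; apply: measurable_funS mf.
have g0 w : (0 <= g w)%E by rewrite /g patchE; case: ifP => // _; rewrite lee_fin.
have := measurable_fun_fubini_tonelli_G (m1 := mu) g mg g0.
congr (measurable_fun _ _); apply/funext => z; rewrite /fubini_G.
rewrite [RHS]integral_mkcond; apply: eq_integral => x _.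
by rewrite /g !patchE in_setX/= in_setT andbT.
Qed.

Lemma measurable_integral_col (f : plane R -> R) (c d : R) :
  measurable_fun [set: plane R] f -> (forall w, 0 <= f w) ->
  measurable_fun [set: measurableTypeR R]
    (fun x => \int[mu]_(z in `[c, d]) (f (x, z))%:E)%E.
Proof.
move=> mf f0.
have mX : measurable ([set: R] `*` `[c, d]%classic : set (plane R)).
  exact: measurableX.
pose g : plane R -> \bar R := (EFin \o f) \_ ([set: R] `*` `[c, d]%classic).
have mg : measurable_fun [set: plane R] g.
  apply: (measurable_restrictT _ mX).1.
  by apply/measurable_EFinP; apply: measurable_funS mf.
have g0 w : (0 <= g w)%E by rewrite /g patchE; case: ifP => // _; rewrite lee_fin.
have := measurable_fun_fubini_tonelli_F (m2 := mu) g mg g0.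
congr (measurable_fun _ _); apply/funext => x; rewrite /fubini_F.
rewrite [RHS]integral_mkcond; apply: eq_integral => z _.
by rewrite /g !patchE in_setX/= in_setT.
Qed.

(** Otherwise [G] exceeds [K / (b - a)] everywhere and its integral is at least [K]. Because the
    hypothesis is strict, weak monotonicity of the integral is already contradictory. *)
Lemma le_mean (G : measurableTypeR R -> \bar R) (a b K : R) : a < b ->
  measurable_fun [set: measurableTypeR R] G -> (forall x, 0 <= G x)%E ->
  (\int[mu]_(x in `[a, b]) G x < K%:E)%E ->
  exists2 x, a <= x <= b & ((b - a)%:E * G x <= K%:E)%E.
Proof.
move=> ab mG G0 IK; apply: contrapT => noex.
have ba0 : 0 < b - a by rewrite subr_gt0.
have GK x : a <= x <= b -> (((b - a)^-1 * K)%:E <= G x)%E.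
  move=> xab; rewrite leNgt; apply/negP => h; apply: noex; exists x => //.
  have -> : K%:E = ((b - a)%:E * ((b - a)^-1 * K)%:E)%E.
    by rewrite -EFinM mulrA divff ?gt_eqF// mul1r.
  by apply: lee_wpmul2l; [rewrite lee_fin ltW|exact: ltW].
have K0 : 0 <= (b - a)^-1 * K.
  rewrite mulr_ge0 ?invr_ge0 ?(ltW ba0)// -lee_fin (le_trans _ (ltW IK))//.
  exact: integral_ge0.
have : (\int[mu]_(x in `[a, b]) ((b - a)^-1 * K)%:E <= \int[mu]_(x in `[a, b]) G x)%E.
  apply: ge0_le_integral => //.
  - by apply: measurable_funS mG.
have muab : mu `[a, b]%classic = (b - a)%:E.
  by rewrite lebesgue_measure_itv/= lte_fin ab -EFinB.
rewrite integral_cst// [X in (_ * X)%E]muab -EFinM.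
by rewrite mulrAC mulVf ?gt_eqF// mul1r leNgt IK.
Qed.

Lemma EFin_Rintegral_itv (g : R -> R) (a b : R) : continuous g ->
  (\int[mu]_(x in `[a, b]) (g x)%:E = (\int[mu]_(x in `[a, b]) g x)%:E)%E.
Proof.
move=> cg; rewrite /Rintegral fineK//; apply: integrable_fin_num => //.
apply: continuous_compact_integrable; first exact: segment_compact.
exact: continuous_subspaceT.
Qed.

Lemma good_row (g : R * R -> R) (a b c d K : R) : c < d -> continuous g ->
  \int[leb2]_(w in box a b c d) `|g w| < K ->
  exists2 z, c <= z <= d &
    (d - c) * \int[mu]_(x in `[a, b]) `|g (x, z)| <= K.
Proof.
move=> cd cg IK.
have cng : continuous (fun w => `|g w|) by exact: cts_norm.
have mg : measurable_fun [set: plane R] (fun w : plane R => `|g w|).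
  exact: continuous_measurable_plane cng.
have g0 (w : plane R) : 0 <= `|g w| by [].
move: IK; rewrite -lte_fin -EFin_Rintegral_box// (ge0_integral_box_zx _ _ _ _ mg g0) => IK.
have [|z zcd h] := le_mean cd (measurable_integral_row a b mg g0) _ IK.
  by move=> z; exact: integral_ge0.
exists z => //; have /= E := EFin_Rintegral_itv a b (continuous_slicex (z := z) cng).
by rewrite -lee_fin EFinM -E.
Qed.

(** The abscissa is sought in the narrower interval [[a', b']] while the column runs over the full
    height: such a column joins a row of a box to a row of a smaller box inside it. *)
Lemma good_col (g : R * R -> R) (a b c d a' b' K : R) : a' < b' ->
  a <= a' -> b' <= b -> continuous g ->
  \int[leb2]_(w in box a b c d) `|g w| < K ->
  exists2 x, a' <= x <= b' &
    (b' - a') * \int[mu]_(z in `[c, d]) `|g (x, z)| <= K.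
Proof.
move=> ab' aa' bb' cg IK.
have cng : continuous (fun w => `|g w|) by exact: cts_norm.
have mg : measurable_fun [set: plane R] (fun w : plane R => `|g w|).
  exact: continuous_measurable_plane cng.
have g0 (w : plane R) : 0 <= `|g w| by [].
move: IK; rewrite -lte_fin -EFin_Rintegral_box// (ge0_integral_box_xz _ _ _ _ mg g0) => IK.
have {}IK : (\int[mu]_(x in `[a', b']) \int[mu]_(z in `[c, d]) (`|g (x, z)|)%:E < K%:E)%E.
  apply: le_lt_trans IK; apply: ge0_subset_integral => //.
  - by apply: measurable_funS (measurable_integral_col c d mg g0).
  - by move=> x _; exact: integral_ge0.
  - by move=> x /=; rewrite !in_itv/= => /andP[? ?]; apply/andP; split; lra.
have [|x xab h] := le_mean ab' (measurable_integral_col c d mg g0) _ IK.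
  by move=> z; exact: integral_ge0.
exists x => //; have /= E := EFin_Rintegral_itv c d (continuous_slicez (x := x) cng).
by rewrite -lee_fin EFinM -E.
Qed.

Lemma variation_le (F f : R -> R) (a b x y : R) : continuous f ->
  (forall x : R, is_derive x (1 : R) F (f x)) ->
  a <= x <= b -> a <= y <= b ->
  `|F x - F y| <= \int[mu]_(t in `[a, b]) `|f t|.
Proof.
move=> cf dF.
wlog xy : x y / x <= y => [hwlog|] xab yab.
  by have [/hwlog|/ltW /hwlog] := leP x y; [exact|rewrite distrC; exact].
have cF t : {for t, continuous F}.
  by apply: differentiable_continuous; apply/derivable1_diffP; exact: (dF t).(ex_derive).
have intf u v : mu.-integrable `[u, v] (EFin \o f).
  by apply: continuous_compact_integrable; [exact: segment_compact|exact: continuous_subspaceT].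
have cnf : continuous (fun t => `|f t|) by exact: (@cts_norm _ R f).
have intnf u v : mu.-integrable `[u, v] (EFin \o (fun t => `|f t|)).
  by apply: continuous_compact_integrable; [exact: segment_compact|exact: continuous_subspaceT].
move: xy; rewrite le_eqVlt => /predU1P[->|xy].
  by rewrite subrr normr0; apply: Rintegral_ge0.
have : \int[mu]_(t in `[x, y]) f t = F y - F x.
  rewrite /Rintegral (continuous_FTC2 (F := F))//.
  - exact: continuous_subspaceT.
  - split.
    + by move=> t _; exact: ex_derive.
    + by apply: cvg_at_right_filter; exact: cF.
    + by apply: cvg_at_left_filter; exact: cF.
  - by move=> t _; rewrite derive1E; exact: derive_val.
rewrite distrC => <-.
apply: (le_trans (le_normr_Rintegral _ (intf _ _))) => //.
rewrite -lee_fin -!EFin_Rintegral_itv//.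
apply: ge0_subset_integral => //.
- by apply: measurable_int (intnf a b).
- move=> t /=; rewrite !in_itv/= => /andP[? ?].
  by move: xab yab => /andP[? ?] /andP[? ?]; apply/andP; split; lra.
Qed.

End good_lines.

Section morrey.
Context {R : realType}.
Implicit Types (v : potential R).

(** The contraction of ratio 1/4 centred at [p]. The small interval stays inside the large one even
    when [p] is an end point, which an interval symmetric about [p] would not. *)
Lemma shrink_itv (p a b : R) : a <= p <= b ->
  [/\ a <= p - (p - a) / 4, p - (p - a) / 4 <= p <= p + (b - p) / 4
    & p + (b - p) / 4 <= b].
Proof. by move=> /andP[? ?]; split; [lra|apply/andP; split; lra|lra]. Qed.

Lemma sub_Rintegral_box (f : R * R -> R) (a b c d a' b' c' d' : R) :
  continuous f -> (forall w, 0 <= f w) ->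
  a <= a' -> b' <= b -> c <= c' -> d' <= d ->
  \int[leb2]_(w in box a' b' c' d') f w <= \int[leb2]_(w in box a b c d) f w.
Proof.
move=> cf f0 aa bb cc dd; rewrite -lee_fin -!EFin_Rintegral_box//.
apply: ge0_subset_integral => //.
- exact: measurable_box.
- exact: measurable_box.
- apply/measurable_EFinP; apply: measurable_funS (continuous_measurable_plane cf) => //.
- by move=> w _; rewrite lee_fin.
- move=> [x z] []; rewrite /= !in_itv/= => /andP[? ?] /andP[? ?].
  by split; rewrite /= in_itv/=; apply/andP; split; lra.
Qed.

Lemma le1DX (y : R) (n : nat) : 0 <= y -> y <= 1 + y ^+ n.+1.
Proof.
move=> y0; have [y1|y1] := leP y 1; first by have := exprn_ge0 n.+1 y0; lra.
by have := ler_eXnr (ltn0Sn n) (ltW y1); lra.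
Qed.

(* Young's inequality with the weight adapted to the area [delta ^+ 6]. *)
Lemma box_mean_le v (a b c d delta M : R) : 0 < delta -> 0 <= M ->
  b - a = delta ^+ 2 -> d - c = delta ^+ 4 ->
  \int[leb2]_(w in box a b c d) (pot_x v w ^+ 6) <= M ->
  \int[leb2]_(w in box a b c d) (pot_z v w ^+ 2) <= M ->
  \int[leb2]_(w in box a b c d) `|pot_x v w| < (2 + M) * delta ^+ 5 /\
  \int[leb2]_(w in box a b c d) `|pot_z v w| < (2 + M) * delta ^+ 3.
Proof.
move=> d0 M0 ba dc Mx Mz.
have dn n : 0 < delta ^+ n by exact: exprn_gt0.
have ab : a <= b by have := dn 2; lra.
have cd : c <= d by have := dn 4; lra.
have area : (b - a) * (d - c) = delta ^+ 6 by rewrite ba dc -exprD.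
split.
- apply: (@le_lt_trans _ _ (\int[leb2]_(w in box a b c d)
    (delta^-1 + delta ^+ 5 * pot_x v w ^+ 6))).
    apply: le_Rintegral_box; [continuity|continuity|move=> w _].
    have := le1DX 5 (mulr_ge0 (ltW d0) (normr_ge0 (pot_x v w))).
    have e6 : `|pot_x v w| ^+ 6 = pot_x v w ^+ 6.
      by rewrite (exprM `|_| 2 3) real_normK ?num_real// -exprM.
    rewrite exprMn e6.
    move=> h; rewrite -(ler_pM2l d0); apply: (le_trans h).
    by rewrite le_eqVlt; apply/orP; left; apply/eqP; field; rewrite gt_eqF.
  rewrite Rintegral_boxD; [|continuity|continuity].
  rewrite Rintegral_boxZ; last by continuity.
  rewrite Rintegral_box_cst// area exprS mulrA mulVf ?gt_eqF// mul1r.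
  have := ler_wpM2l (ltW (dn 5)) Mx; have := dn 5.
  by move: (\int[leb2]_(w in _) _) => I; move: (delta ^+ 5) => D; nra.
- apply: (@le_lt_trans _ _ (\int[leb2]_(w in box a b c d)
    (delta ^- 3 + delta ^+ 3 * pot_z v w ^+ 2))).
    apply: le_Rintegral_box; [continuity|continuity|move=> w _].
    have := le1DX 1 (mulr_ge0 (ltW (dn 3)) (normr_ge0 (pot_z v w))).
    rewrite exprMn real_normK ?num_real// => h.
    rewrite -(ler_pM2l (dn 3)); apply: (le_trans h).
    by rewrite le_eqVlt; apply/orP; left; apply/eqP; field; rewrite gt_eqF.
  rewrite Rintegral_boxD; [|continuity|continuity].
  rewrite Rintegral_boxZ; last by continuity.
  rewrite Rintegral_box_cst// area (exprD _ 3 3) mulrA mulVf ?gt_eqF// mul1r.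
  have := ler_wpM2l (ltW (dn 3)) Mz; have := dn 3.
  by move: (\int[leb2]_(w in _) _) => I; move: (delta ^+ 3) => D; nra.
Qed.

(** A path through boxes of parameters [delta], [delta / 2], ... contracting to [(p, q)]: along a
    good row, then along a good column that meets a good row of the next box. One stage costs
    [5 (2 + M) delta] (1 for the row, 4 for the column), and the constant 10 solves
    [t = 5 + t / 2]. *)
Lemma morrey_chain (N : nat) v (a b c d delta M p q x z : R) : 0 < delta -> 0 <= M ->
  b - a = delta ^+ 2 -> d - c = delta ^+ 4 ->
  \int[leb2]_(w in box a b c d) (pot_x v w ^+ 6) <= M ->
  \int[leb2]_(w in box a b c d) (pot_z v w ^+ 2) <= M ->
  a <= p <= b -> c <= q <= d ->
  a <= x <= b -> c <= z <= d ->
  \int[@lebesgue_measure R]_(x in `[a, b]) `|pot_x v (x, z)| <= (2 + M) * delta ->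
  exists x' z', [/\ `|x' - p| <= delta ^+ 2 / 2 ^+ N, `|z' - q| <= delta ^+ 4 / 2 ^+ N &
    `|pot v (x, z) - pot v (x', z')| <= 10 * (2 + M) * delta].
Proof.
elim: N a b c d delta x z => [|N IHN] a b c d delta x z d0 M0 ba dc Mx Mz pab qcd xab zcd row.
  exists x, z; rewrite expr0 !divr1 -ba -dc; split.
  - by rewrite ler_distl; apply/andP; split; lra.
  - by rewrite ler_distl; apply/andP; split; lra.
  - by rewrite subrr normr0 !mulr_ge0// ?ltW//; lra.
have dn n : 0 < delta ^+ n by exact: exprn_gt0.
have [aa a'b' bb] := shrink_itv pab.
(* Halving [delta] divides the width [delta ^+ 2] by 4 and the height [delta ^+ 4] by 16. *)
pose c' := q - (q - c) / 16; pose d' := q + (d - q) / 16.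
have [cc c'd' dd] : [/\ c <= c', c' <= q <= d' & d' <= d].
  have /andP[cq qd] := qcd; rewrite /c' /d'; clear -cq qd.
  by split; [lra|apply/andP; split; lra|lra].
move: aa a'b' bb; set a' := p - _; set b' := p + _ => aa a'b' bb.
pose delta' := delta / 2.
have d'0 : 0 < delta' by rewrite divr_gt0.
have ba' : b' - a' = delta' ^+ 2.
  by rewrite /b' /a' /delta' expr_div_n -ba; field.
have dc' : d' - c' = delta' ^+ 4.
  by rewrite /d' /c' /delta' expr_div_n -dc; field.
have a'ltb' : a' < b' by rewrite -subr_gt0 ba' exprn_gt0.
have c'ltd' : c' < d' by rewrite -subr_gt0 dc' exprn_gt0.
have Mx' : \int[leb2]_(w in box a' b' c' d') (pot_x v w ^+ 6) <= M.
  apply: le_trans Mx; apply: sub_Rintegral_box => //; first by continuity.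
  by move=> w; rewrite (exprM (pot_x v w) 3 2) sqr_ge0.
have Mz' : \int[leb2]_(w in box a' b' c' d') (pot_z v w ^+ 2) <= M.
  apply: le_trans Mz; apply: sub_Rintegral_box => //; first by continuity.
  by move=> w; rewrite sqr_ge0.
have [_ Iz] := box_mean_le d0 M0 ba dc Mx Mz.
have [Ix' _] := box_mean_le d'0 M0 ba' dc' Mx' Mz'.
have [x1 x1ab col] := good_col a'ltb' aa bb (@pot_z_cont _ v) Iz.
have [z1 z1cd row1] := good_row c'ltd' (@pot_x_cont _ v) Ix'.
have {}row1 : \int[@lebesgue_measure R]_(x in `[a', b']) `|pot_x v (x, z1)| <= (2 + M) * delta'.
  rewrite dc' in row1; rewrite -(@ler_pM2l _ (delta' ^+ 4)) ?exprn_gt0//.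
  by apply: (le_trans row1); rewrite le_eqVlt; apply/orP; left; apply/eqP; ring.
(* The mean is taken over a strip of width [delta' ^+ 2], a quarter of [delta ^+ 2]; hence the
   factor 4. *)
have {}col : \int[@lebesgue_measure R]_(z in `[c, d]) `|pot_z v (x1, z)| <= 4 * ((2 + M) * delta).
  rewrite ba' in col; rewrite -(@ler_pM2l _ (delta' ^+ 2)) ?exprn_gt0//.
  apply: (le_trans col); rewrite le_eqVlt; apply/orP; left; apply/eqP.
  by rewrite /delta'; field.
have x1ab' : a <= x1 <= b.
  by case/andP: x1ab => h1 h2; rewrite (le_trans aa h1) (le_trans h2 bb).
have z1cd' : c <= z1 <= d.
  by case/andP: z1cd => h1 h2; rewrite (le_trans cc h1) (le_trans h2 dd).
have [x' [z' [hx hz h]]] := IHN a' b' c' d' delta' x1 z1 d'0 M0 ba' dc' Mx' Mz'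
  a'b' c'd' x1ab z1cd row1.
exists x', z'; split.
- apply: (le_trans hx).
  have X0 : 0 < delta ^+ 2 / 2 ^+ N by rewrite divr_gt0 ?exprn_gt0.
  have -> : delta' ^+ 2 / 2 ^+ N = (delta ^+ 2 / 2 ^+ N) / 4.
    by rewrite /delta' expr_div_n mulrAC -!natrX.
  have -> : delta ^+ 2 / 2 ^+ N.+1 = (delta ^+ 2 / 2 ^+ N) / 2.
    by rewrite [2 ^+ _]exprS invfM mulrA mulrAC.
  by clear -X0; lra.
- apply: (le_trans hz).
  have X0 : 0 < delta ^+ 4 / 2 ^+ N by rewrite divr_gt0 ?exprn_gt0.
  have -> : delta' ^+ 4 / 2 ^+ N = (delta ^+ 4 / 2 ^+ N) / 16.
    by rewrite /delta' expr_div_n mulrAC -!natrX.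
  have -> : delta ^+ 4 / 2 ^+ N.+1 = (delta ^+ 4 / 2 ^+ N) / 2.
    by rewrite [2 ^+ _]exprS invfM mulrA mulrAC.
  by clear -X0; lra.
- have v1 := variation_le (continuous_slicex (z := z) (@pot_x_cont _ v))
    (fun x => is_derive_pot_x v x z) xab x1ab'.
  have v2 := variation_le (continuous_slicez (x := x1) (@pot_z_cont _ v))
    (fun z => is_derive_pot_z v x1 z) zcd z1cd'.
  apply: (le_trans (ler_distD (pot v (x1, z)) _ _)).
  have := ler_distD (pot v (x1, z1)) (pot v (x1, z)) (pot v (x', z')).
  move: v1 v2 h; rewrite /delta' => v1 v2 h h'.
  have v1' := le_trans v1 row; have v2' := le_trans v2 col.
  by clear -v1' v2' h h'; lra.
Qed.

End morrey.

Section coloring.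
Context {R : realType}.

Lemma grid_cell (a h x : R) (n : nat) : a <= x <= a + n.+1%:R * h ->
  exists i : 'I_n.+1, a + i%:R * h <= x <= a + i.+1%:R * h.
Proof.
elim: n => [|n IHn] /andP[ax xn].
  by exists ord0; rewrite mul0r addr0 ax.
have [xn'|xn'] := leP x (a + n.+1%:R * h).
  have [|i hi] := IHn; first by rewrite ax.
  by exists (widen_ord (leqnSn _) i).
by exists ord_max; rewrite ltW.
Qed.

Lemma rounding (K eta : R) : 0 <= K -> 0 < eta ->
  exists L (c : R -> 'I_L.+1), forall s t, `|s| <= K -> `|t| <= K ->
    c s = c t -> `|s - t| <= eta.
Proof.
move=> K0 eta0.
exists (Num.truncn (2 * K / eta)), (fun s => inord (Num.truncn ((s + K) / eta))).
move=> s t; rewrite !ler_norml => /andP[s1 s2] /andP[t1 t2].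
have bnd u : - K <= u -> u <= K ->
    (Num.truncn ((u + K) / eta) < (Num.truncn (2 * K / eta)).+1)%N /\
    (Num.truncn ((u + K) / eta))%:R <= (u + K) / eta <
    (Num.truncn ((u + K) / eta)).+1%:R.
  move=> u1 u2; split.
    by rewrite ltnS le_truncn// ler_pM2r ?invr_gt0//; lra.
  by apply: truncn_itv; rewrite divr_ge0//; lra.
have [sb /andP[s3 s4]] := bnd s s1 s2; have [tb /andP[t3 t4]] := bnd t t1 t2.
move/(congr1 val); rewrite /= !inordK// => E.
rewrite E in s3 s4.
move: s3 s4 t3 t4; rewrite !(ler_pdivlMr _ _ eta0) !(ltr_pdivrMr _ _ eta0).
set k := Num.truncn _ => s3 s4 t3 t4.
have ek : k.+1%:R * eta = k%:R * eta + eta by rewrite -natr1 mulrDl mul1r.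
by rewrite ek in s4 t4; apply/andP; split; lra.
Qed.

(** Total boundedness as a colouring of the indices. It requires neither centres nor a triangle
    inequality for [D], and several conditions are combined by taking the tuple of their colours. *)
Definition finitely_coverable (I : Type) (D : I -> I -> R) : Prop :=
  forall delta : R, 0 < delta -> exists (F : finType) (c : I -> F),
    forall i j, c i = c j -> D i j <= delta.

End coloring.

Section equicontinuity.
Context {R : realType}.
Implicit Types (v : potential R).

(** Both points are joined to the left end of one good row, at cost [10 (2 + M) delta] each. *)
Lemma morrey v (a b c d delta M : R) w w' : 0 < delta -> 0 <= M ->
  b - a = delta ^+ 2 -> d - c = delta ^+ 4 ->
  \int[leb2]_(w in box a b c d) (pot_x v w ^+ 6) <= M ->
  \int[leb2]_(w in box a b c d) (pot_z v w ^+ 2) <= M ->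
  box a b c d w -> box a b c d w' ->
  `|pot v w - pot v w'| <= 20 * (2 + M) * delta.
Proof.
move=> d0 M0 ba dc Mx Mz Bw Bw'.
have dn n : 0 < delta ^+ n by exact: exprn_gt0.
have cd : c < d by have := dn 4; lra.
have ab : a <= b by have := dn 2; lra.
have [Ix _] := box_mean_le d0 M0 ba dc Mx Mz.
have [z zcd row] := good_row cd (@pot_x_cont _ v) Ix.
have {}row : \int[@lebesgue_measure R]_(x in `[a, b]) `|pot_x v (x, z)| <= (2 + M) * delta.
  rewrite dc in row; rewrite -(@ler_pM2l _ (delta ^+ 4)) ?exprn_gt0//.
  by apply: (le_trans row); rewrite le_eqVlt; apply/orP; left; apply/eqP; ring.
have aab : a <= a <= b by rewrite lexx.
suff H w0 : box a b c d w0 -> `|pot v (a, z) - pot v w0| <= 10 * (2 + M) * delta.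
  have := H _ Bw; have := H _ Bw'; rewrite [in X in X -> _]distrC => h1 h2.
  have := ler_distD (pot v (a, z)) (pot v w) (pot v w').
  by rewrite distrC in h2; rewrite distrC in h1; move: h1 h2; rewrite ![`|_ - pot v w'|]distrC; lra.
(* A finite chain only comes close to [w0]; continuity of the potential bridges the rest at the
   price of an arbitrary [e]. *)
move=> [Bp Bq]; apply/ler_addgt0Pr => e e0.
have /cvgrPdist_lt/(_ e e0) := @pot_cont _ v w0.
move=> /nbhs_ballP[r /= r0 hr].
have [N hN] : exists N, (delta ^+ 2 + delta ^+ 4) / 2 ^+ N < r.
  have X0 : 0 <= (delta ^+ 2 + delta ^+ 4) / r by rewrite divr_ge0 ?addr_ge0 ?ltW.
  exists (Num.Def.archi_bound ((delta ^+ 2 + delta ^+ 4) / r)).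
  rewrite ltr_pdivrMr ?exprn_gt0// mulrC -ltr_pdivrMr//.
  apply: (lt_le_trans (archi_boundP X0)).
  by rewrite -natrX ler_nat ltnW// ltn_expl.
move: Bp Bq; rewrite /= !in_itv/= => pab qcd.
have [x' [z' [hx hz h]]] := morrey_chain N d0 M0 ba dc Mx Mz pab qcd aab zcd row.
have sm k : 0 < delta ^+ k / 2 ^+ N by rewrite divr_gt0 ?exprn_gt0.
have := hr (x', z'); rewrite mulrDl in hN; have := sm 2%N; have := sm 4%N => s4 s2.
have Bb : ball w0 r (x', z').
  by split; rewrite /ball/= distrC; lra.
move=> /(_ Bb) /= h'; have := ler_distD (pot v (x', z')) (pot v (a, z)) (pot v w0).
by rewrite [`|pot v (x', z') - _|]distrC; lra.
Qed.

(** Arzela-Ascoli modulo constants: an index is coloured by the rounded values of its potential at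
    finitely many reference points. The error is [eta / 2] from the rounding and [eta / 4] from the
    oscillation of each of the two potentials in a cell. *)
Lemma sup_coverable (I : Type) (v : I -> potential R) (a b c d delta M : R) :
  0 < delta -> 0 <= M -> b - a = delta ^+ 2 -> d - c = delta ^+ 4 ->
  (forall i, \int[leb2]_(w in box a b c d) (pot_x (v i) w ^+ 6) <= M) ->
  (forall i, \int[leb2]_(w in box a b c d) (pot_z (v i) w ^+ 2) <= M) ->
  forall eta : R, 0 < eta -> exists (F : finType) (col : I -> F),
    forall i j, col i = col j -> exists k, forall w, box a b c d w ->
      `|pot (v i) w - pot (v j) w - k| <= eta.
Proof.
move=> d0 M0 ba dc Mx Mz eta eta0.
have dn n : 0 < delta ^+ n by exact: exprn_gt0.
have ab : a <= b by have := dn 2; lra.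
have cd : c <= d by have := dn 4; lra.
pose K := 20 * (2 + M) * delta.
have K0 : 0 < K by rewrite !mulr_gt0//; lra.
have [n hn] : exists n, K / 2 ^+ n <= eta / 4.
  have X0 : 0 <= K / (eta / 4) by rewrite divr_ge0 ?divr_ge0 ?ltW.
  exists (Num.Def.archi_bound (K / (eta / 4))).
  rewrite ler_pdivrMr ?exprn_gt0// mulrC -ler_pdivrMr ?divr_gt0//.
  apply: (le_trans (ltW (archi_boundP X0))).
  by rewrite -natrX ler_nat ltnW// ltn_expl.
(* The cells [h x l] are boxes of parameter [delta / 2 ^+ n], so [morrey] bounds the oscillation in
   each of them by [K / 2 ^+ n]. *)
pose h := delta ^+ 2 / 4 ^+ n; pose l := delta ^+ 4 / 16 ^+ n.
(* Predecessors, because the index types have the form ['I_n.+1], which contains [ord0]. *)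
pose n1 := (4 ^ n).-1; pose n2 := (16 ^ n).-1.
have n1E : n1.+1%:R = 4 ^+ n :> R by rewrite /n1 prednK ?expn_gt0// natrX.
have n2E : n2.+1%:R = 16 ^+ n :> R by rewrite /n2 prednK ?expn_gt0// natrX.
have h0 : 0 < h by rewrite divr_gt0 ?exprn_gt0.
have l0 : 0 < l by rewrite divr_gt0 ?exprn_gt0.
have n1h : n1.+1%:R * h = b - a by rewrite n1E /h mulrC divfK ?expf_neq0// ba.
have n2l : n2.+1%:R * l = d - c by rewrite n2E /l mulrC divfK ?expf_neq0// dc.
pose ref (ij : 'I_n1.+1 * 'I_n2.+1) : R * R := (a + ij.1%:R * h, c + ij.2%:R * l).
have itvi (i : 'I_n1.+1) : i.+1%:R * h <= b - a.
  by rewrite -n1h ler_pM2r// ler_nat.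
have itvj (j : 'I_n2.+1) : j.+1%:R * l <= d - c.
  by rewrite -n2l ler_pM2r// ler_nat.
have refB ij : box a b c d (ref ij).
  have := itvi ij.1; have := itvj ij.2.
  rewrite -!natr1 !mulrDl !mul1r => h1 h2.
  have := mulr_ge0 (ler0n R ij.1) (ltW h0); have := mulr_ge0 (ler0n R ij.2) (ltW l0).
  by move=> h3 h4; split; rewrite /= in_itv/=; apply/andP; split; lra.
have near_ref w : box a b c d w -> exists ij, forall i,
    `|pot (v i) w - pot (v i) (ref ij)| <= eta / 4.
  case: w => x z [] /=; rewrite !in_itv/= => /andP[x1 x2] /andP[z1 z2].
  have [|i1 hi1] := @grid_cell _ a h x n1; first by rewrite n1h x1; lra.
  have [|i2 hi2] := @grid_cell _ c l z n2; first by rewrite n2l z1; lra.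
  exists (i1, i2) => i; apply: le_trans hn.
  have e1 : (a + i1.+1%:R * h) - (a + i1%:R * h) = (delta / 2 ^+ n) ^+ 2.
    rewrite -natr1 mulrDl mul1r expr_div_n -exprM mulnC exprM -natrX /h; ring.
  have e2 : (c + i2.+1%:R * l) - (c + i2%:R * l) = (delta / 2 ^+ n) ^+ 4.
    rewrite -natr1 mulrDl mul1r expr_div_n -exprM mulnC exprM -natrX /l; ring.
  have p1 := mulr_ge0 (ler0n R i1) (ltW h0); have p2 := mulr_ge0 (ler0n R i2) (ltW l0).
  have l1 : a <= a + i1%:R * h by rewrite lerDl.
  have l2 : a + i1.+1%:R * h <= b by rewrite addrC -lerBrDr; exact: itvi.
  have l3 : c <= c + i2%:R * l by rewrite lerDl.
  have l4 : c + i2.+1%:R * l <= d by rewrite addrC -lerBrDr; exact: itvj.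
  rewrite /K -mulrA; apply: (@morrey _ (a + i1%:R * h) (a + i1.+1%:R * h)
    (c + i2%:R * l) (c + i2.+1%:R * l)) => //.
  - by rewrite divr_gt0 ?exprn_gt0.
  - apply: le_trans (Mx i); apply: sub_Rintegral_box l1 l2 l3 l4; first by continuity.
    by move=> w; rewrite (exprM (pot_x (v i) w) 3 2) sqr_ge0.
  - apply: le_trans (Mz i); apply: sub_Rintegral_box l1 l2 l3 l4; first by continuity.
    by move=> w; rewrite sqr_ge0.
  - split; rewrite /= in_itv/=; first by move: hi1 => /andP[? ?]; apply/andP; split; lra.
    by move: hi2 => /andP[? ?]; apply/andP; split; lra.
have [L [rnd hrnd]] := rounding (ltW K0) (divr_gt0 eta0 (ltr0n R 2)).
(* The values of the potentials need not be bounded; their differences to the value at the first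
   reference point are, by [K]. The constant [k] below restores what this normalization drops. *)
pose val i ij := pot (v i) (ref ij) - pot (v i) (ref (ord0, ord0)).
exists {ffun 'I_n1.+1 * 'I_n2.+1 -> 'I_L.+1}, (fun i => [ffun ij => rnd (val i ij)]).
move=> i j hij.
exists (pot (v i) (ref (ord0, ord0)) - pot (v j) (ref (ord0, ord0))) => w Bw.
have [ij hw] := near_ref w Bw.
have hv i' : `|val i' ij| <= K by apply: (morrey (M := M) d0 M0 ba dc).
have := hrnd _ _ (hv i) (hv j).
have -> : rnd (val i ij) = rnd (val j ij) by move/ffunP: hij => /(_ ij); rewrite !ffunE.
move=> /(_ erefl); rewrite /val => h1.
have := hw i; have := hw j; move: h1; rewrite !ler_norml.
move=> /andP[? ?] /andP[? ?] /andP[? ?]; apply/andP; split; lra.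
Qed.

End equicontinuity.

(** * Total boundedness for smooth potentials *)

Section smooth_compactness.
Context {R : realType}.

Lemma smooth_coverable (v : nat -> potential R) (eps : nat -> R)
    (a b c d delta M : R) :
  0 < delta -> b - a = delta ^+ 2 -> d - c = delta ^+ 4 ->
  0 <= M -> eps @ \oo --> (0 : R) -> (forall n, eps n <= eps 0%N) ->
  (forall n, \int[leb2]_(w in box a b c d) (pot_x (v n) w ^+ 6) <= M) ->
  (forall n, \int[leb2]_(w in box a b c d) (residue (v n) w ^+ 2) <= eps n) ->
  (forall n, \int[leb2]_(w in box a b c d)
    `|pot_xx (v n) w * residue (v n) w| <= M) ->
  finitely_coverable (fun i j => \int[leb2]_(w in box a b c d)
    (cutoff a b c d w * (pot_x (v i) w - pot_x (v j) w) ^+ 4)).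
Proof.
move=> d0 ba dc M0 eps0 epsle Mx Mr Mxr tau tau0.
have dn n : 0 < delta ^+ n by exact: exprn_gt0.
have ab : a < b by have := dn 2; lra.
have cd : c < d by have := dn 4; lra.
have M10 : 0 < M + 1 by lra.
have [L0 L00 HL0] := div_curl_le ab cd (M + 1).
pose L := L0 + 1; have Lpos : 0 < L by rewrite /L; lra.
(* [div_curl_le] will be used with [lam = s] and with [rho] at most [s * s], so that its three terms
   are each at most [s] and add up to [tau / L]. *)
pose s := tau / (3 * L); have s0 : 0 < s by rewrite divr_gt0 ?mulr_gt0.
pose rho : R := Num.min (M + 1) (s * s).
have rho0 : 0 < rho by rewrite lt_min M10 mulr_gt0.
have rhoM : rho <= M + 1 by rewrite ge_min lexx.
have rhos : rho / s <= s by rewrite ler_pdivrMr// ge_min lexx orbT.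
have [N _ hN] : \forall n \near \oo, eps n <= rho.
  have /cvgrPdist_lt/(_ _ rho0) := eps0; apply: filterS => n.
  by rewrite sub0r normrN => /ltW; apply: le_trans; exact: ler_norm.
pose A := (b - a) * (d - c).
have A0 : 0 <= A by rewrite mulr_ge0 ?subr_ge0 ?ltW.
have e00 : 0 <= eps 0%N.
  by apply: le_trans (Mr 0%N); apply: Rintegral_ge0 => w _; exact: sqr_ge0.
(* From [pot_z ^+ 2 <= 2 * residue ^+ 2 + 1 + pot_x ^+ 6], where [eps 0%N] dominates every [eps n].
   This supplies the square integral of [pot_z] that the equicontinuity estimate asks for. *)
pose Mz := 2 * eps 0%N + A + M.
have hMz n : \int[leb2]_(w in box a b c d) (pot_z (v n) w ^+ 2) <= M + Mz.
  apply: (@le_trans _ _ (\int[leb2]_(w in box a b c d)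
    (2 * residue (v n) w ^+ 2 + (1 + pot_x (v n) w ^+ 6)))).
    apply: le_Rintegral_box; [continuity|continuity|move=> w _].
    have -> : pot_z (v n) w = residue (v n) w + 2^-1 * pot_x (v n) w ^+ 2.
      by rewrite /residue subrK.
    have := sqr_ge0 (residue (v n) w - 2^-1 * pot_x (v n) w ^+ 2).
    have := pow4_le1D6 (pot_x (v n) w); rewrite (exprM (pot_x (v n) w) 2 2).
    move: (residue _ _) (pot_x (v n) w ^+ 2) (pot_x (v n) w ^+ 6); clear=> r t t3 h1 h2; nra.
  rewrite Rintegral_boxD; [|continuity|continuity].
  rewrite Rintegral_boxZ; last by continuity.
  rewrite Rintegral_boxD; [|continuity|continuity].
  rewrite Rintegral_box_cst ?(ltW ab) ?(ltW cd)// mul1r -/A.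
  have h := lerD (ler_wpM2l (ler0n R 2) (Mr n)) (lerD (lexx A) (Mx n)).
  by apply: (le_trans h); have := epsle n; rewrite /Mz; lra.
have Mx' n : \int[leb2]_(w in box a b c d) (pot_x (v n) w ^+ 6) <= M + Mz.
  by apply: (le_trans (Mx n)); rewrite /Mz; lra.
have MMz0 : 0 <= M + Mz by rewrite /Mz; lra.
have [F [col hcol]] := sup_coverable d0 MMz0 ba dc Mx' hMz s0.
(* The first component gives each index below [N] its own colour and merges the indices from [N] on,
   for which the residue is already small. *)
exists ('I_N.+1 * F)%type, (fun n => (inord (minn n N), col n)).
move=> i j [/(congr1 val)]; rewrite /= !inordK ?ltnS ?geq_minr// => hmin hc.
have [->|ij] := eqVneq i j.
  under eq_Rintegral do rewrite subrr expr0n/= mulr0.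
  by rewrite Rintegral_box_cst ?(ltW ab) ?(ltW cd)// mul0r ltW.
have [iN jN] : (N <= i)%N /\ (N <= j)%N.
  move: hmin ij; rewrite /minn; case: (ltnP i N); case: (ltnP j N) => //.
  - by move=> _ _ ->; rewrite eqxx.
  - by move=> h1 h2 e; rewrite e ltnn in h2.
  - by move=> h1 h2 e; rewrite -e ltnn in h1.
have [k hk] := hcol _ _ hc.
have := HL0 _ _ k s s rho s0 (ltW s0) hk.
have hv : forall v0, v0 = v i \/ v0 = v j -> [/\
    \int[leb2]_(w in box a b c d) (pot_x v0 w ^+ 6) <= M + 1,
    \int[leb2]_(w in box a b c d) (residue v0 w ^+ 2) <= rho, rho <= M + 1
    & \int[leb2]_(w in box a b c d) `|pot_xx v0 w * residue v0 w| <= M + 1].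
  move=> v0 [->|->]; split => //.
  - by have := Mx i; lra.
  - exact: le_trans (Mr i) (hN _ iN).
  - by have := Mxr i; lra.
  - by have := Mx j; lra.
  - exact: le_trans (Mr j) (hN _ jN).
  - by have := Mxr j; lra.
move=> /(_ hv) h; apply: (le_trans h).
apply: (@le_trans _ _ (L * (s + s + s))).
  apply: ler_pM; first exact: L00.
  - apply: addr_ge0; first by apply: addr_ge0; exact: ltW.
    by apply: divr_ge0; exact: ltW.
  - by rewrite /L lerDl.
  - by rewrite lerD2l.
rewrite le_eqVlt; apply/orP; left; apply/eqP.
by rewrite /s; field; rewrite gt_eqF.
Qed.

End smooth_compactness.

(** * A compactly supported smooth kernel *)

Section bump.
Context {R : realType}.
Local Notation mu := (@lebesgue_measure R).
Implicit Types (Q : {poly R}) (m : nat) (x : R).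

(** The standard bump [exp (- 1 / (1 - x^2))] with a rational prefactor. This family is closed under
    differentiation, so smoothness reduces to a single first-order computation. *)
Definition flat Q m x : R := if `|x| < 1 then
  Q.[x] * (1 - x ^+ 2) ^- m * expR (- (1 - x ^+ 2)^-1) else 0.

Lemma sqr_lt1 x : (`|x| < 1) = (0 < 1 - x ^+ 2).
Proof. by rewrite subr_gt0 -(real_normK (num_real x)) expr_lt1. Qed.

(** The Taylor term of degree [m.+2] bounds [expR t^-1] from below. The surplus power [t ^+ 2] makes
    the bump vanish quadratically at the ends of its support. *)
Lemma inv_exp_le (t : R) m : 0 < t ->
  t ^- m * expR (- t^-1) <= (m.+2)`!%:R * t ^+ 2.
Proof.
move=> t0; have s0 : 0 <= t^-1 by rewrite invr_ge0 ltW.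
have := expR_ge1Dxn m.+1 s0; rewrite expRN exprVn.
have e0 : 0 < expR t^-1 by exact: expR_gt0.
have f0 : 0 < (m.+2)`!%:R :> R by rewrite ltr0n fact_gt0.
move=> h; have {}h : t ^- m.+2 / m.+2`!%:R <= expR t^-1 by lra.
rewrite ler_pdivrMr//.
have -> : t ^- m = (t ^- m.+2 / m.+2`!%:R) * (m.+2`!%:R * t ^+ 2).
  rewrite mulrA divfK ?gt_eqF// -addn2 exprD invfM -mulrA mulVf ?mulr1//.
  by rewrite expf_neq0// gt_eqF.
by rewrite mulrC ler_wpM2l// mulr_ge0 ?sqr_ge0// ltW.
Qed.

Lemma flat_le Q m : exists2 K : R, 0 <= K & forall x, `|x| < 1 ->
  `|flat Q m x| <= K * (1 - x ^+ 2) ^+ 2.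
Proof.
have : compact (horner Q @` `[(-1 : R), 1]%classic).
  apply: continuous_compact; last exact: segment_compact.
  by apply: continuous_subspaceT; exact: continuous_horner.
move/compact_bounded => [M [Mr MP]].
have HQ x : `|x| < 1 -> `|Q.[x]| <= `|M| + 1.
  move=> x1; apply: (MP (`|M| + 1)); first by rewrite ltr_pwDr// ler_norm.
  by exists x => //=; rewrite in_itv/= -ler_norml ltW.
exists ((`|M| + 1) * (m.+2)`!%:R); first by rewrite mulr_ge0// addr_ge0.
move=> x x1; rewrite /flat x1 -mulrA normrM -mulrA; apply: ler_pM => //; first exact: HQ.
move: x1; rewrite sqr_lt1; set t := 1 - x ^+ 2 => t0.
rewrite ger0_norm; first exact: inv_exp_le.
by rewrite mulr_ge0 ?expR_ge0// invr_ge0 exprn_ge0// ltW.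
Qed.

(** Intended for the points with [1 <= |x|]: it treats the ends of the support and the exterior
    together, without one-sided derivatives. *)
Lemma is_derive_quadratic (f : R -> R) (x0 K : R) : f x0 = 0 ->
  (forall x, `|f x| <= K * (x - x0) ^+ 2) -> is_derive x0 (1 : R) f 0.
Proof.
move=> f0 fK.
have K0 : 0 <= K.
  have := fK (x0 + 1); rewrite addrAC subrr add0r expr1n mulr1; exact: le_trans.
suff H : h^-1 *: ((f \o shift x0) (h *: (1 : R)) - f x0) @[h --> 0^'] --> (0 : R).
  by apply: DeriveDef; [apply/cvg_ex; exists 0|exact: cvg_lim].
apply/cvgrPdist_le => e e0.
have K1 : 0 < e / (K + 1) by rewrite divr_gt0// ltr_wpDl.
near=> h.
have h0 : h != 0 by near: h; exact: nbhs_dnbhs_neq.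
rewrite sub0r normrN f0 subr0 /= normrM normfV /GRing.scale/= mulr1.
rewrite ler_pdivrMl ?normr_gt0//; apply: (le_trans (fK _)).
rewrite addrK -(real_normK (num_real h)) expr2 mulrA [leRHS]mulrC ler_wpM2r//.
have : `|h| <= e / (K + 1).
  near: h; apply: nbhs_dnbhs; apply/nbhs_ballP; exists (e / (K + 1)) => //= h.
  by rewrite /ball/= sub0r normrN => /ltW.
rewrite ler_pdivlMr ?ltr_wpDl// => h1; apply: le_trans h1.
by rewrite mulrC ler_wpM2l// lerDl.
Unshelve. all: by end_near. Qed.

(** The numerator of the derivative of [flat Q m] over the common denominator
    [(1 - x ^+ 2) ^+ m.+2]: the three terms come from [Q], from the power and from the
    exponential. *)
Definition dflat Q m : {poly R} :=
  Q^`() * (1%:P - 'X ^+ 2) ^+ 2 +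
  (2 * m)%:R *: ('X * Q * (1%:P - 'X ^+ 2)) - 2%:R *: ('X * Q).

Lemma is_derive_flat Q m x : is_derive x (1 : R) (flat Q m) (flat (dflat Q m) m.+2 x).
Proof.
have [x1|x1] := ltP `|x| 1; last first.
  rewrite {2}/flat ltNge x1/=.
  have [K K0 hK] := flat_le Q m.
  (* For [|y| < 1 <= |x|] one has [1 - y^2 <= |x|^2 - |y|^2 <= (|x| + 1) |y - x|], so the quadratic
     bound in [1 - y^2] is one in [y - x]. *)
  apply: (@is_derive_quadratic _ _ (K * (`|x| + 1) ^+ 2)).
    by rewrite /flat ltNge x1.
  move=> y; have [y1|y1] := ltP `|y| 1; last first.
    rewrite /flat ltNge y1/= normr0 mulr_ge0 ?sqr_ge0// mulr_ge0 ?sqr_ge0//.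
  apply: (le_trans (hK y y1)); rewrite -mulrA ler_wpM2l// -exprMn.
  have t0 : 0 <= 1 - y ^+ 2 by rewrite ltW// -sqr_lt1.
  rewrite -[leRHS]real_normK ?num_real// ler_sqr ?nnegrE//.
  rewrite normrM (@ger0_norm _ (`|x| + 1)) ?addr_ge0//.
  apply: (@le_trans _ _ (`|x| ^+ 2 - `|y| ^+ 2)).
    rewrite (real_normK (num_real y)) lerD2r -[1](expr1n _ 2).
    by rewrite ler_sqr ?nnegrE.
  rewrite subr_sqr [leRHS]mulrC; apply: ler_pM.
  - by rewrite subr_ge0 ltW// (lt_le_trans y1).
  - exact: addr_ge0.
  - by rewrite distrC; exact: lerB_dist.
  - by rewrite lerD2l ltW.
have t0 : 0 < 1 - x ^+ 2 by rewrite -sqr_lt1.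
have tn0 : 1 - x ^+ 2 != 0 by rewrite gt_eqF.
apply: (@near_eq_is_derive _ _ _
  (fun x => Q.[x] * (1 - x ^+ 2) ^- m * expR (- (1 - x ^+ 2)^-1))).
  have : \forall y \near x, `|y| < 1.
    apply/nbhs_ballP; exists (1 - `|x|); rewrite /= ?subr_gt0// => y.
    rewrite /ball/= => h; have := lerB_dist y x; rewrite distrC; lra.
  by apply: filterS => y y1; rewrite /flat y1.
have dQ : is_derive x (1 : R) (horner Q) (Q^`()).[x].
  by apply: DeriveDef; [exact: derivable_horner|rewrite derivE derive1E].
have dV : is_derive x (1 : R) (fun y : R => (1 - y ^+ 2)^-1) (2 * x * (1 - x ^+ 2) ^- 2).
  have d1 : is_derive x (1 : R) (fun y : R => 1 - y ^+ 2) (- (2 * x)).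
    by apply: is_derive_eq; rewrite /GRing.scale/=; ring.
  have := @is_deriveV _ (fun y : R => 1 - y ^+ 2) _ _ _ tn0 d1; rewrite /GRing.scale/= mulrNN mulrC; exact.
have dVm k : is_derive x (1 : R) (fun y : R => (1 - y ^+ 2) ^- k)
    (2 * k%:R * x * (1 - x ^+ 2) ^- k.+1).
  elim: k => [|k IHk].
    under eq_fun do rewrite expr0 invr1.
    by apply: is_derive_eq; rewrite mulr0 !mul0r.
  under eq_fun do rewrite exprSr invfM.
  apply: is_derive_eq; rewrite /GRing.scale/= -!exprVn !exprS expr0 -natr1; ring.
have dE : is_derive x (1 : R) (fun y : R => expR (- (1 - y ^+ 2)^-1))
    (- (2 * x * (1 - x ^+ 2) ^- 2) * expR (- (1 - x ^+ 2)^-1)).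
  by apply: is_derive_eq; rewrite /GRing.scale/= mulrC.
have dm := dVm m.
apply: (@is_derive_eq _ _ _ _ _ _ _ _ (is_deriveM (is_deriveM dQ dm) dE)).
rewrite /flat x1 /dflat /GRing.scale/=.
rewrite !(hornerD, hornerN, hornerM, hornerZ, hornerX, hornerC, horner_exp).
rewrite -[(_ * _) x]/(Q.[x] * (1 - x ^+ 2) ^- m) -!exprVn !exprS expr0 !mulr1.
have tV : (1 - x ^+ 2)^-1 * (1 - x ^+ 2) = 1 by rewrite mulVf.
move: tV; rewrite natrM expr2; set t := 1 - x * x; set V := t^-1 => tV.
set E := expR _; set W := V ^+ m; set q := Q^`().[x]; set p := Q.[x].
have -> : (q * (t * t) + 2%:R * m%:R * (x * p * t) - 2%:R * (x * p)) * (V * (V * W)) * E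
  = (q * (V * t) * (V * t) + 2%:R * m%:R * (x * p * (V * t) * V) - 2%:R * (x * p) * V * V) * W * E.
  by ring.
rewrite !tV; ring.
Qed.

Fixpoint flat_iter n : {poly R} * nat :=
  if n is n'.+1 then (dflat (flat_iter n').1 (flat_iter n').2, (flat_iter n').2.+2)
  else (1%:P, 0%N).

Definition flatn n x := flat (flat_iter n).1 (flat_iter n).2 x.

Lemma is_derive_flatn n x : is_derive x (1 : R) (flatn n) (flatn n.+1 x).
Proof. exact: is_derive_flat. Qed.

Lemma is_derive_continuous (f f' : R -> R) :
  (forall x, is_derive x (1 : R) f (f' x)) -> continuous f.
Proof.
move=> df x; apply: differentiable_continuous; apply/derivable1_diffP.
exact: (df x).(ex_derive).
Qed.

Lemma flatn_eq0 n x : 1 <= `|x| -> flatn n x = 0.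
Proof. by move=> x1; rewrite /flatn /flat ltNge x1. Qed.

Lemma flat0E x : flatn 0 x = if `|x| < 1 then expR (- (1 - x ^+ 2)^-1) else 0.
Proof. by rewrite /flatn /flat/= hornerC expr0 invr1 !mul1r. Qed.

Lemma flat0_ge0 x : 0 <= flatn 0 x.
Proof. by rewrite flat0E; case: ifP => // _; exact: expR_ge0. Qed.

Lemma flat0N x : flatn 0 (- x) = flatn 0 x.
Proof. by rewrite !flat0E normrN sqrrN. Qed.

Lemma flatn_continuous n : continuous (flatn n).
Proof. exact: is_derive_continuous (is_derive_flatn n). Qed.

Lemma integral_flat0 : exists2 c : R, 0 < c & (\int[mu]_x (flatn 0 x)%:E = c%:E)%E.
Proof.
have E : (\int[mu]_x (flatn 0 x)%:E = \int[mu]_(x in `[(-1)%R, 1%R]) (flatn 0 x)%:E)%E.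
  rewrite [RHS]integral_mkcond; apply: eq_integral => x _.
  rewrite patchE; case: ifPn => // /negP xn; rewrite flatn_eq0// leNgt.
  by apply/negP => h; apply: xn; rewrite inE/= in_itv/= -ler_norml ltW.
exists (\int[mu]_(x in `[(-1)%R, 1%R]) flatn 0 x); last first.
  by rewrite E EFin_Rintegral_itv//; exact: flatn_continuous.
rewrite -lte_fin -EFin_Rintegral_itv; last exact: flatn_continuous.
(* The value of the bump at [1/2], where [1 - x^2 = 3/4]; it bounds the bump from below on an
   interval of length 1. *)
pose e := expR (- (4 / 3) : R).
have e0 : 0 < e by exact: expR_gt0.
apply: (@lt_le_trans _ _ (\int[mu]_(x in `[(- 2^-1)%R, 2^-1%R]) e%:E)%E).
  rewrite integral_cst//=.
  have -> : mu `[(- 2^-1)%R, 2^-1%R]%classic = 1%E.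
    rewrite lebesgue_measure_itv/= lte_fin ifT; last by lra.
    by rewrite -EFinB; congr (_%:E); lra.
  by rewrite mule1 lte_fin.
apply: (@le_trans _ _ (\int[mu]_(x in `[(- 2^-1)%R, 2^-1%R]) (flatn 0 x)%:E)%E).
  apply: ge0_le_integral => //.
  - by move=> x _; rewrite lee_fin ltW.
  - apply/measurable_EFinP; apply: measurable_funS (continuous_measurable_fun (@flatn_continuous 0)) => //.
  - move=> x; rewrite /= in_itv/= => x2; rewrite lee_fin flat0E.
    have x1 : `|x| < 1 by rewrite ltr_norml; move: x2 => /andP[? ?]; apply/andP; split; lra.
    rewrite x1 ler_expR lerN2.
    have x4 : x ^+ 2 <= 4^-1.
      have -> : 4^-1 = 2^-1 ^+ 2 :> R by lra.
      by rewrite -(real_normK (num_real x)) ler_sqr ?nnegrE// ler_norml.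
    have -> : 4 / 3 = (3 / 4)^-1 :> R by lra.
    by rewrite lef_pV2 ?posrE; lra.
apply: ge0_subset_integral => //.
- by apply/measurable_EFinP; apply: measurable_funS (continuous_measurable_fun (@flatn_continuous 0)).
- by move=> x _; rewrite lee_fin flat0_ge0.
- by move=> x; rewrite /= !in_itv/= => /andP[? ?]; apply/andP; split; lra.
Qed.

(** [k n] is the [n]-th derivative of the kernel [k 0]. Producing the whole tower at once lets later
    arguments differentiate by raising an index. *)
Lemma kernel_exists (h : R) : 0 < h -> exists k : nat -> R -> R,
  [/\ forall n x, is_derive x (1 : R) (k n) (k n.+1 x),
      forall n x, h <= `|x| -> k n x = 0,
      forall x, 0 <= k 0%N x,
      forall x, k 0%N (- x) = k 0%N x
    & forall x, (\int[mu]_y (k 0%N (x - y))%:E = 1)%E].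
Proof.
move=> h0; have [c c0 Ic] := integral_flat0.
exists (fun n x => (c * h)^-1 * (h^-1 ^+ n * flatn n (h^-1 * x))).
have hi0 : 0 < h^-1 by rewrite invr_gt0.
have ch0 : 0 < c * h by exact: mulr_gt0.
split.
- move=> n x.
  have d1 : is_derive x (1 : R) (fun x : R => h^-1 * x) h^-1.
    by apply: is_derive_eq; rewrite /GRing.scale/= mulr1.
  have := is_derive1_comp (is_derive_flatn n (h^-1 * x)) d1.
  rewrite /comp => d2.
  by apply: is_derive_eq; rewrite /GRing.scale/= exprS; ring.
- move=> n x hx; rewrite flatn_eq0 ?mulr0// normrM gtr0_norm//.
  by rewrite mulrC ler_pdivlMr// mul1r.
- by move=> x; rewrite !mulr_ge0 ?exprn_ge0 ?flat0_ge0 ?invr_ge0 ?ltW.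
- by move=> x; rewrite mulrN flat0N.
- move=> x.
  (* The integral in [y] of [k 0 (x - y)] is reduced to the mass [c] of the bump by an increasing
     substitution, after evenness has reversed the sign of the argument. *)
  pose F y : R := h^-1 * (y - x).
  have dF y : is_derive y (1 : R) F h^-1.
    by apply: is_derive_eq; rewrite /GRing.scale/= subr0 mulr1.
  have F'E : F^`()%classic = cst h^-1.
    by apply/funext => y; rewrite derive1E; exact: derive_val.
  have := @increasing_ge0_integration_by_substitutionT R F (flatn 0).
  rewrite F'E Ic => H.
  have -> : (\int[mu]_y ((c * h)^-1 * (h^-1 ^+ 0 * flatn 0 (h^-1 * (x - y))))%:E =
     c^-1%:E * \int[mu]_y (((flatn 0 \o F) * cst h^-1) y)%:E)%E.
    rewrite -ge0_integralZl//.
    + apply: eq_integral => y _; rewrite -EFinM; congr EFin.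
      by rewrite expr0 mul1r invfM /F -opprB mulrN flat0N /=; rewrite mulrA mulrAC.
    + apply/measurable_EFinP; apply: continuous_measurable_fun.
      apply: (@cts_continuous _ R); apply: (@ctsM _ R _ (cst h^-1)); last exact: cts_cst.
      apply: is_derive_continuous => y.
      exact: is_derive1_comp (is_derive_flatn 0 _) (dF y).
    + by move=> y _; rewrite lee_fin mulr_ge0 ?flat0_ge0// ltW.
    + by rewrite lee_fin invr_ge0 ltW.
  rewrite -H.
  + by rewrite -EFinM mulVf ?gt_eqF.
  + by move=> y z yz; rewrite /F ltr_pM2l// ltrD2r.
  + by move=> y; exact: cvg_cst.
  + exact: is_cvg_cst.
  + exact: is_cvg_cst.
  + by move=> y; exact: ex_derive.
  + by apply: gt0_cvgMrNy => //; exact: cvg_addrr_Ny.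
  + by apply: gt0_cvgMry => //; exact: cvg_addrr.
  + exact: flatn_continuous.
  + exact: flat0_ge0.
Qed.

End bump.

(** * Mollification *)

Section tensor_smooth.
Context {R : realType}.
Implicit Types (F G : nat -> R -> R).

Lemma is_derive_tensor_x (f g : R -> R) (df : R) (w : R * R) :
  is_derive w.1 (1 : R) f df ->
  is_derive w e_x (fun w : R * R => f w.1 * g w.2) (df * g w.2).
Proof.
move=> [dvf dfE].
suff H : t^-1 *: (((fun w : R * R => f w.1 * g w.2) \o shift w) (t *: e_x) -
    f w.1 * g w.2) @[t --> 0^'] --> df * g w.2.
  by apply: DeriveDef; [apply/cvg_ex; eexists; exact: H|exact: cvg_lim].
have -> : (fun t : R => t^-1 *: (((fun w : R * R => f w.1 * g w.2) \o shift w) (t *: e_x) -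
    f w.1 * g w.2)) =
  (fun t : R => (t^-1 *: ((f \o shift w.1) (t *: 1) - f w.1)) * g w.2).
  apply/funext => t; rewrite /= /GRing.scale/= /GRing.scale/=.
  by rewrite mulr0 add0r -mulrA mulrBl.
apply: cvgM; last exact: cvg_cst.
by rewrite -dfE; exact: dvf.
Qed.

Lemma is_derive_tensor_z (f g : R -> R) (dg : R) (w : R * R) :
  is_derive w.2 (1 : R) g dg ->
  is_derive w e_z (fun w : R * R => f w.1 * g w.2) (f w.1 * dg).
Proof.
move=> [dvg dgE].
suff H : t^-1 *: (((fun w : R * R => f w.1 * g w.2) \o shift w) (t *: e_z) -
    f w.1 * g w.2) @[t --> 0^'] --> f w.1 * dg.
  by apply: DeriveDef; [apply/cvg_ex; eexists; exact: H|exact: cvg_lim].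
have -> : (fun t : R => t^-1 *: (((fun w : R * R => f w.1 * g w.2) \o shift w) (t *: e_z) -
    f w.1 * g w.2)) =
  (fun t : R => f w.1 * (t^-1 *: ((g \o shift w.2) (t *: 1) - g w.2))).
  apply/funext => t; rewrite /= /GRing.scale/= /GRing.scale/=.
  by rewrite mulr0 add0r -mulrBr mulrCA.
apply: cvgM; first exact: cvg_cst.
by rewrite -dgE; exact: dvg.
Qed.

Lemma continuous_tensor (f g : R -> R) : continuous f -> continuous g ->
  continuous (fun w : R * R => f w.1 * g w.2).
Proof.
move=> cf cg w; apply: cvgM.
- by apply: (@continuous_comp _ _ _ fst f); [exact: cvg_fst|exact: cf].
- by apply: (@continuous_comp _ _ _ snd g); [exact: cvg_snd|exact: cg].
Qed.

(** Every iterated partial derivative of the product is again a product of one function of each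
    tower, whatever the order of the directions. *)
Lemma smooth_tensor F G :
  (forall n x, is_derive x (1 : R) (F n) (F n.+1 x)) ->
  (forall n x, is_derive x (1 : R) (G n) (G n.+1 x)) ->
  smooth (fun w => F 0%N w.1 * G 0%N w.2).
Proof.
move=> dF dG s sxz.
have [i [j ->]] : exists i j, foldr (fun v f => 'D_v f)
    (fun w => F 0%N w.1 * G 0%N w.2) s = (fun w => F i w.1 * G j w.2).
  elim: s sxz => [_|v s IHs vsxz]; first by exists 0%N, 0%N.
  have [|i [j /= ->]] := IHs; first by move=> t ts; apply: vsxz; rewrite inE ts orbT.
  have := vsxz v (mem_head _ _); rewrite !inE => /orP[/eqP ->|/eqP ->].
    exists i.+1, j; apply/funext => w.
    by have := is_derive_tensor_x (G j) (dF i w.1) => /@derive_val.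
  exists i, j.+1; apply/funext => w.
  by have := is_derive_tensor_z (F i) (dG j w.2) => /@derive_val.
split.
  by apply: continuous_tensor; [exact: is_derive_continuous (dF i)|exact: is_derive_continuous (dG j)].
move=> v w; rewrite !inE => /orP[/eqP ->|/eqP ->].
  by have := is_derive_tensor_x (G j) (dF i w.1) => /@ex_derive.
by have := is_derive_tensor_z (F i) (dG j w.2) => /@ex_derive.
Qed.

Lemma closed_box (a b c d : R) : closed (box a b c d).
Proof. by apply: compact_closed; [exact: norm_hausdorff|exact: compact_box]. Qed.

End tensor_smooth.

Section convolution.
Context {R : realType}.
Variables (h : R) (k : nat -> R -> R).
Hypothesis dk : forall n x, is_derive x (1 : R) (k n) (k n.+1 x).
Hypothesis k_out : forall n x, h <= `|x| -> k n x = 0.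

(** The indices count derivatives in [w], the point of evaluation. Differentiating in the
    integration variable [y] raises the same index and changes the sign. *)
Definition ker2 i j (w y : R * R) : R := k i (w.1 - y.1) * k j (w.2 - y.2).

Lemma kernel_continuous n : continuous (k n).
Proof. exact: is_derive_continuous (dk n). Qed.

Lemma ker2_test (Omega : set (R * R)) i j (w : R * R) :
  box (w.1 - h) (w.1 + h) (w.2 - h) (w.2 + h) `<=` Omega ->
  test_function Omega (ker2 i j w).
Proof.
move=> wO.
have supp : closure [set y | ker2 i j w y != 0] `<=`
    box (w.1 - h) (w.1 + h) (w.2 - h) (w.2 + h).
  have cb : closed (box (w.1 - h) (w.1 + h) (w.2 - h) (w.2 + h)) by exact: closed_box.
  rewrite ((closure_id _).1 cb).
  apply: closure_subset => y /= yn0.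
  have y1 : `|w.1 - y.1| < h.
    by rewrite ltNge; apply: contra yn0 => /k_out e; rewrite /ker2 e mul0r.
  have y2 : `|w.2 - y.2| < h.
    by rewrite ltNge; apply: contra yn0 => /k_out e; rewrite /ker2 e mulr0.
  move: y1 y2; rewrite !ltr_norml => /andP[? ?] /andP[? ?].
  by split; rewrite /= in_itv/=; apply/andP; split; lra.
split; last exact: subset_trans supp wO.
  (* As functions of [y] the derivatives alternate in sign, so the tower for [y] carries the factor
     [(-1) ^+ n]. *)
  have dtower (a n : nat) (x0 x : R) : is_derive x (1 : R)
      (fun x => (-1) ^+ n * k (a + n)%N (x0 - x)) ((-1) ^+ n.+1 * k (a + n.+1)%N (x0 - x)).
    have d1 : is_derive x (1 : R) (fun x : R => x0 - x) (-1).
      by apply: is_derive_eq; rewrite ?sub0r ?add0r /GRing.scale/= ?mulN1r ?mulrN1.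
    have := @is_derive1_comp _ (k (a + n)%N) (fun x : R => x0 - x) _ _ _ (dk _ _) d1; rewrite /comp => d2.
    by apply: is_derive_eq; rewrite /GRing.scale/= exprS addnS; ring.
  have := smooth_tensor (fun n x => dtower i n w.1 x) (fun n x => dtower j n w.2 x).
  congr smooth; apply/funext => y.
  by rewrite !expr0 !mul1r !addn0.
by apply: subclosed_compact supp; [exact: closed_closure|exact: compact_box].
Qed.

Lemma derive_ker2_x i j w y : 'D_e_x (ker2 i j w) y = - ker2 i.+1 j w y.
Proof.
have d1 : is_derive y.1 (1 : R) (fun x => k i (w.1 - x)) (- k i.+1 (w.1 - y.1)).
  have d0 : is_derive y.1 (1 : R) (fun x : R => w.1 - x) (-1).
    by apply: is_derive_eq; rewrite ?sub0r ?add0r /GRing.scale/= ?mulN1r ?mulrN1.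
  have := @is_derive1_comp _ (k i) (fun x : R => w.1 - x) _ _ _ (dk _ _) d0; rewrite mulrN1; exact.
have /@derive_val -> := is_derive_tensor_x (fun z => k j (w.2 - z)) d1.
by rewrite /ker2 mulNr.
Qed.

Lemma derive_ker2_z i j w y : 'D_e_z (ker2 i j w) y = - ker2 i j.+1 w y.
Proof.
have d1 : is_derive y.2 (1 : R) (fun x => k j (w.2 - x)) (- k j.+1 (w.2 - y.2)).
  have d0 : is_derive y.2 (1 : R) (fun x : R => w.2 - x) (-1).
    by apply: is_derive_eq; rewrite ?sub0r ?add0r /GRing.scale/= ?mulN1r ?mulrN1.
  have := @is_derive1_comp _ (k j) (fun x : R => w.2 - x) _ _ _ (dk _ _) d0; rewrite mulrN1; exact.
have /@derive_val -> := is_derive_tensor_z (fun z => k i (w.1 - z)) d1.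
by rewrite /ker2 mulrN.
Qed.

Lemma kernel_bounded n : exists2 C : R, 0 <= C & forall x, `|k n x| <= C.
Proof.
have : compact (k n @` `[(- h), h]%classic).
  apply: continuous_compact; last exact: segment_compact.
  by apply: continuous_subspaceT; exact: kernel_continuous.
move/compact_bounded => [M [Mr MP]].
exists (`|M| + 1) => // x.
have [xh|xh] := ltP `|x| h; last by rewrite k_out// normr0 addr_ge0.
apply: (MP (`|M| + 1)); first by rewrite ltr_pwDr// ler_norm.
by exists x => //=; rewrite in_itv/= -ler_norml ltW.
Qed.

Lemma kernel_lipschitz n : exists2 C : R, 0 <= C &
  forall x y, `|k n x - k n y| <= C * `|x - y|.
Proof.
have [C C0 hC] := kernel_bounded n.+1; exists C => // x y.
wlog xy : x y / x <= y => [hwlog|].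
  by have [/hwlog//|/ltW/hwlog] := leP x y; rewrite distrC [`|y - x|]distrC.
have ck := @kernel_continuous n.+1.
have xx : x <= x <= y by rewrite lexx.
have yy : x <= y <= y by rewrite lexx xy.
apply: (le_trans (variation_le ck (dk n) xx yy)).
have cnk : continuous (fun t => `|k n.+1 t|) by exact: (@cts_norm _ R (k n.+1)).
rewrite -lee_fin -EFin_Rintegral_itv//.
apply: (@le_trans _ _ (\int[@lebesgue_measure R]_(t in `[x, y]) C%:E)%E).
  apply: ge0_le_integral => //.
  - apply/measurable_EFinP; apply: measurable_funS (continuous_measurable_fun cnk) => //.
  - by move=> t _; rewrite lee_fin.
rewrite integral_cst//= lebesgue_measure_itv/= lte_fin.
move: xy; rewrite le_eqVlt => /predU1P[->|xy].
  by rewrite ltxx mule0 subrr normr0 mulr0.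
by rewrite xy -EFinB -EFinM lee_fin distrC gtr0_norm// subr_gt0.
Qed.

End convolution.

Section convolution2.
Context {R : realType}.
Variables (h : R) (k : nat -> R -> R).
Hypothesis dk : forall n x, is_derive x (1 : R) (k n) (k n.+1 x).
Hypothesis k_out : forall n x, h <= `|x| -> k n x = 0.
Implicit Types (f : plane R -> R).
Local Notation ker2 := (ker2 k).

Definition conv i j f (w : R * R) : R := \int[leb2]_y (f y * ker2 i j w y).

Lemma ker2_continuous i j w : continuous (ker2 i j w).
Proof.
apply: (continuous_tensor (f := fun x => k i (w.1 - x)) (g := fun x => k j (w.2 - x))).
- move=> x; apply: (@continuous_comp _ _ _ (fun x : R => w.1 - x) (k i)).
    by apply: cvgB; [exact: cvg_cst|exact: cvg_id].
  exact: (kernel_continuous dk).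
- move=> x; apply: (@continuous_comp _ _ _ (fun x : R => w.2 - x) (k j)).
    by apply: cvgB; [exact: cvg_cst|exact: cvg_id].
  exact: (kernel_continuous dk).
Qed.

Lemma ker2_bounded i j : exists2 C : R, 0 <= C & forall w y, `|ker2 i j w y| <= C.
Proof.
have [C1 C10 h1] := kernel_bounded dk k_out i.
have [C2 C20 h2] := kernel_bounded dk k_out j.
exists (C1 * C2); first exact: mulr_ge0.
by move=> w y; rewrite normrM; apply: ler_pM.
Qed.

Lemma ker2_lipschitz i j : exists2 C : R, 0 <= C & forall w w' y,
  `|ker2 i j w y - ker2 i j w' y| <= C * (`|w.1 - w'.1| + `|w.2 - w'.2|).
Proof.
have [C1 C10 h1] := kernel_bounded dk k_out i.
have [C2 C20 h2] := kernel_bounded dk k_out j.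
have [L1 L10 l1] := kernel_lipschitz dk k_out i.
have [L2 L20 l2] := kernel_lipschitz dk k_out j.
exists (L1 * C2 + C1 * L2); first by rewrite addr_ge0// mulr_ge0.
move=> w w' y; rewrite /ker2.
have -> : k i (w.1 - y.1) * k j (w.2 - y.2) - k i (w'.1 - y.1) * k j (w'.2 - y.2) =
  (k i (w.1 - y.1) - k i (w'.1 - y.1)) * k j (w.2 - y.2) +
  k i (w'.1 - y.1) * (k j (w.2 - y.2) - k j (w'.2 - y.2)) by ring.
apply: (le_trans (ler_normD _ _)); rewrite !normrM.
have e1 := l1 (w.1 - y.1) (w'.1 - y.1); have e2 := l2 (w.2 - y.2) (w'.2 - y.2).
rewrite (_ : w.1 - y.1 - (w'.1 - y.1) = w.1 - w'.1) in e1; last by ring.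
rewrite (_ : w.2 - y.2 - (w'.2 - y.2) = w.2 - w'.2) in e2; last by ring.
have f1 := ler_pM (normr_ge0 _) (normr_ge0 _) e1 (h2 (w.2 - y.2)).
have f2 := ler_pM (normr_ge0 _) (normr_ge0 _) (h1 (w'.1 - y.1)) e2.
apply: (le_trans (lerD f1 f2)).
have := normr_ge0 (w.1 - w'.1); have := normr_ge0 (w.2 - w'.2).
move: `|w.1 - w'.1| `|w.2 - w'.2| => s t t0 s0.
have := mulr_ge0 (mulr_ge0 L10 C20) t0; have := mulr_ge0 (mulr_ge0 C10 L20) s0; nra.
Qed.

Lemma integrable_mul_bounded f (g : plane R -> R) (C : R) :
  leb2.-integrable [set: plane R] (EFin \o f) ->
  measurable_fun [set: plane R] g -> (forall y, `|g y| <= C) ->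
  leb2.-integrable [set: plane R] (EFin \o (fun y => f y * g y)).
Proof.
move=> intf mg gC.
have mf : measurable_fun [set: plane R] f by apply/measurable_EFinP; exact: measurable_int intf.
apply: (@le_integrable _ _ _ _ _ _ _ (EFin \o (fun y => C * f y))).
- exact: measurableT.
- by apply/measurable_EFinP; exact: measurable_funM.
- move=> y _; rewrite /= lee_fin !normrM mulrC ler_wpM2r//.
  exact: le_trans (gC y) (ler_norm _).
- by apply: (integrableZl measurableT C intf).
Qed.

Lemma conv_integrable i j f w : leb2.-integrable [set: plane R] (EFin \o f) ->
  leb2.-integrable [set: plane R] (EFin \o (fun y => f y * ker2 i j w y)).
Proof.
move=> intf; have [C C0 hC] := ker2_bounded i j.
apply: (integrable_mul_bounded intf _ (hC w)).
exact: continuous_measurable_plane (@ker2_continuous i j w).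
Qed.

Lemma conv_continuous i j f : leb2.-integrable [set: plane R] (EFin \o f) ->
  continuous (conv i j f).
Proof.
move=> intf w; have [C C0 hC] := ker2_lipschitz i j.
have intnf : leb2.-integrable [set: plane R] (EFin \o (fun y => `|f y|)).
  exact: (integrable_abse intf).
pose N := \int[leb2]_y `|f y|.
have N0 : 0 <= N by apply: Rintegral_ge0.
have intd w' := integrableB measurableT (conv_integrable i j w intf) (conv_integrable i j w' intf).
have lip w' : `|conv i j f w - conv i j f w'| <= C * N * (`|w.1 - w'.1| + `|w.2 - w'.2|).
  rewrite -RintegralB//; [|exact: conv_integrable|exact: conv_integrable].
  apply: (le_trans (le_normr_Rintegral _ _)) => //.
    exact: intd.
  rewrite mulrAC -RintegralZl//.
  apply: le_Rintegral => //.
  - exact: (integrable_abse (intd w')).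
  - exact: (integrableZl measurableT (C * (`|w.1 - w'.1| + `|w.2 - w'.2|)) intnf).
  - by move=> y _; rewrite -mulrBr normrM mulrC ler_wpM2r.
apply/cvgrPdist_le => e e0.
pose r : R := e / (2 * (C * N + 1)).
have CN0 : 0 <= C * N by exact: mulr_ge0.
have r0 : 0 < r by rewrite divr_gt0// mulr_gt0//; lra.
suff : \forall w' \near w, `|conv i j f w - conv i j f w'| <= e by [].
apply/nbhs_ballP; exists r => //= w' [w1 w2].
apply: (le_trans (lip w')).
move: w1 w2; rewrite /ball/= => w1 w2.
apply: (@le_trans _ _ ((C * N + 1) * (r + r))).
  by apply: ler_pM; rewrite ?addr_ge0//; [lra|rewrite lerD// ltW].
rewrite le_eqVlt; apply/orP; left; apply/eqP; rewrite /r; field; lra.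
Qed.

Lemma is_derive_conv_x i j f (x z : R) : leb2.-integrable [set: plane R] (EFin \o f) ->
  is_derive x (1 : R) (fun x => conv i j f (x, z)) (conv i.+1 j f (x, z)).
Proof.
move=> intf; have [C C0 hC] := ker2_bounded i.+1 j.
pose F (x : R) (y : plane R) : R := f y * ker2 i j (x, z) y.
have dF (x' : R) y : is_derive x' (1 : R) (F ^~ y) (f y * ker2 i.+1 j (x', z) y).
  have d0 : is_derive x' (1 : R) (fun x : R => x - y.1) 1.
    by apply: is_derive_eq; rewrite subr0.
  have d1 := @is_derive1_comp _ (k i) (fun x : R => x - y.1) _ _ _ (dk _ _) d0.
  rewrite /comp in d1; rewrite /F /ker2 /=.
  by apply: is_derive_eq; rewrite /GRing.scale/=; ring.
have F'E x' y : partial1of2 F x' y = f y * ker2 i.+1 j (x', z) y.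
  by rewrite partial1of2E; exact: derive_val.
have intG : leb2.-integrable [set: plane R] (EFin \o (fun y => C * `|f y|)).
  by apply: (integrableZl measurableT C (integrable_abse intf)).
have xI : (`]x - 1, x + 1[%classic : set R) x by rewrite /= in_itv/=; apply/andP; split; lra.
have H1 x' : (`]x - 1, x + 1[%classic : set R) x' -> leb2.-integrable [set: plane R] (EFin \o F x').
  by move=> _; exact: conv_integrable.
have H2 x' y : (`]x - 1, x + 1[%classic : set R) x' -> [set: plane R] y -> derivable (F ^~ y) x' 1.
  by move=> _ _; exact: ex_derive.
have H3 y : 0 <= C * `|f y| by exact: mulr_ge0.
have H4 x' y : (`]x - 1, x + 1[%classic : set R) x' -> [set: plane R] y ->
    `|partial1of2 F x' y| <= C * `|f y|.
  by move=> _ _; rewrite F'E normrM mulrC ler_wpM2r.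
apply: DeriveDef.
  exact: (derivable_under_integral measurableT xI H1 H2 H3 intG H4).
rewrite -derive1E (differentiation_under_integral measurableT xI H1 H2 H3 intG H4).
by apply: eq_Rintegral => y _; rewrite F'E.
Qed.

Lemma is_derive_conv_z i j f (x z : R) : leb2.-integrable [set: plane R] (EFin \o f) ->
  is_derive z (1 : R) (fun z => conv i j f (x, z)) (conv i j.+1 f (x, z)).
Proof.
move=> intf; have [C C0 hC] := ker2_bounded i j.+1.
pose F (z : R) (y : plane R) : R := f y * ker2 i j (x, z) y.
have dF (z' : R) y : is_derive z' (1 : R) (F ^~ y) (f y * ker2 i j.+1 (x, z') y).
  have d0 : is_derive z' (1 : R) (fun x : R => x - y.2) 1.
    by apply: is_derive_eq; rewrite subr0.
  have d1 := @is_derive1_comp _ (k j) (fun x : R => x - y.2) _ _ _ (dk _ _) d0.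
  rewrite /comp in d1; rewrite /F /ker2 /=.
  by apply: is_derive_eq; rewrite /GRing.scale/=; ring.
have F'E z' y : partial1of2 F z' y = f y * ker2 i j.+1 (x, z') y.
  by rewrite partial1of2E; exact: derive_val.
have intG : leb2.-integrable [set: plane R] (EFin \o (fun y => C * `|f y|)).
  by apply: (integrableZl measurableT C (integrable_abse intf)).
have zI : (`]z - 1, z + 1[%classic : set R) z by rewrite /= in_itv/=; apply/andP; split; lra.
have H1 z' : (`]z - 1, z + 1[%classic : set R) z' -> leb2.-integrable [set: plane R] (EFin \o F z').
  by move=> _; exact: conv_integrable.
have H2 z' y : (`]z - 1, z + 1[%classic : set R) z' -> [set: plane R] y -> derivable (F ^~ y) z' 1.
  by move=> _ _; exact: ex_derive.
have H3 y : 0 <= C * `|f y| by exact: mulr_ge0.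
have H4 z' y : (`]z - 1, z + 1[%classic : set R) z' -> [set: plane R] y ->
    `|partial1of2 F z' y| <= C * `|f y|.
  by move=> _ _; rewrite F'E normrM mulrC ler_wpM2r.
apply: DeriveDef.
  exact: (derivable_under_integral measurableT zI H1 H2 H3 intG H4).
rewrite -derive1E (differentiation_under_integral measurableT zI H1 H2 H3 intG H4).
by apply: eq_Rintegral => y _; rewrite F'E.
Qed.

(** All derivatives fall on the kernel, so any integrable [f] gives a potential. Its fields are
    mollified weak derivatives only at points whose [h]-neighbourhood lies in the domain. *)
Definition conv_potential f (intf : leb2.-integrable [set: plane R] (EFin \o f)) :
    potential R :=
  {| pot := conv 0 0 f; pot_x := conv 1 0 f; pot_z := conv 0 1 f;
     pot_xx := conv 2 0 f; pot_xz := conv 1 1 f;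
     pot_cont := conv_continuous intf; pot_x_cont := conv_continuous intf;
     pot_z_cont := conv_continuous intf; pot_xx_cont := conv_continuous intf;
     pot_xz_cont := conv_continuous intf;
     is_derive_pot_x := fun x z => is_derive_conv_x 0 0 x z intf;
     is_derive_pot_z := fun x z => is_derive_conv_z 0 0 x z intf;
     is_derive_pot_xx := fun x z => is_derive_conv_x 1 0 x z intf;
     is_derive_pot_xz := fun x z => is_derive_conv_z 1 0 x z intf;
     is_derive_pot_zx := fun x z => is_derive_conv_x 0 1 x z intf |}.

End convolution2.

Lemma cvge0_exists_le (R : realType) (u : nat -> \bar R) (e : R) :
  u @ \oo --> 0%E -> 0 < e -> exists n, (u n <= e%:E)%E.
Proof.
move=> /fine_cvgP[[N1 _ h1] /cvgr_le/(_ _)]; move=> /[swap] e0 /(_ _ e0) [N2 _ h2].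
exists (maxn N1 N2); have := h2 _ (leq_maxr N1 N2); rewrite /= => h.
by rewrite -[u _]fineK ?lee_fin//; apply: h1; rewrite /= leq_maxl.
Qed.

(** * Density of continuous functions in L^1 of a box *)

Section density.
Context {R : realType}.
Local Notation mu := (@lebesgue_measure R).
Variables (a b c d : R).
Local Notation B := (box a b c d).
Implicit Types (f g : plane R -> R).

Definition L1dist f g : \bar R := (\int[leb2]_(w in B) (`|f w - g w|)%:E)%E.

Lemma measurable_dist f g : measurable_fun [set: plane R] f ->
  measurable_fun [set: plane R] g ->
  measurable_fun B (fun w => (`|f w - g w|)%:E).
Proof.
move=> mf mg; apply/measurable_EFinP; apply: (@measurable_funS _ _ _ _ setT) => //.
by apply: measurableT_comp => //; exact: measurable_funB.
Qed.

Lemma L1dist_triangle f g h : measurable_fun [set: plane R] f ->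
  measurable_fun [set: plane R] g -> measurable_fun [set: plane R] h ->
  (L1dist f h <= L1dist f g + L1dist g h)%E.
Proof.
move=> mf mg mh; rewrite /L1dist -ge0_integralD//.
- apply: ge0_le_integral => //.
  + exact: measurable_box.
  + exact: measurable_dist.
  + by apply: emeasurable_funD; exact: measurable_dist.
  + by move=> w _; rewrite -EFinD lee_fin; exact: ler_distD.
- exact: measurable_box.
- exact: measurable_dist.
- exact: measurable_dist.
Qed.

Definition approximable f := forall delta : R, 0 < delta ->
  exists2 g : R * R -> R, continuous g & (L1dist f g <= delta%:E)%E.

Lemma approximable_lim f : measurable_fun [set: plane R] f ->
  (forall delta : R, 0 < delta -> exists f', [/\ measurable_fun [set: plane R] f',
    approximable f' & (L1dist f f' <= delta%:E)%E]) -> approximable f.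
Proof.
move=> mf H delta d0; have d2 : 0 < delta / 2 by rewrite divr_gt0.
have [f' [mf' af' ff']] := H _ d2; have [g cg fg] := af' _ d2.
exists g => //; apply: (le_trans (L1dist_triangle mf mf' (continuous_measurable_plane cg))).
by rewrite [delta]splitr EFinD; exact: leeD.
Qed.

Lemma approximableD f g : measurable_fun [set: plane R] f ->
  measurable_fun [set: plane R] g ->
  approximable f -> approximable g -> approximable (fun w => f w + g w).
Proof.
move=> mf mg af ag delta d0; have d2 : 0 < delta / 2 by rewrite divr_gt0.
have [f' cf' ff'] := af _ d2; have [g' cg' gg'] := ag _ d2.
exists (fun w => f' w + g' w); first exact: (@ctsD _ R).
have mf' := continuous_measurable_plane cf'; have mg' := continuous_measurable_plane cg'.
apply: (@le_trans _ _ (L1dist f f' + L1dist g g')%E); last first.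
  by rewrite [delta]splitr EFinD; exact: leeD.
rewrite /L1dist -ge0_integralD//.
- apply: ge0_le_integral => //.
  + exact: measurable_box.
  + by apply: measurable_dist; exact: measurable_funD.
  + by apply: emeasurable_funD; exact: measurable_dist.
  + move=> w _; rewrite -EFinD lee_fin opprD addrACA; exact: ler_normD.
- exact: measurable_box.
- exact: measurable_dist.
- exact: measurable_dist.
Qed.

Lemma approximableZ f (r : R) : measurable_fun [set: plane R] f ->
  approximable f -> approximable (fun w => r * f w).
Proof.
move=> mf af delta d0.
have r0 : 0 < `|r| + 1 by rewrite ltr_wpDl.
have [g cg fg] := af _ (divr_gt0 d0 r0).
exists (fun w => r * g w); first exact: (@ctsM _ R _ _ (@cts_cst _ _ r)).
have mg := continuous_measurable_plane cg.
apply: (@le_trans _ _ ((`|r| + 1)%:E * L1dist f g)%E); last first.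
  apply: (le_trans (lee_wpmul2l _ fg)); first by rewrite lee_fin ltW.
  by rewrite -EFinM mulrCA divff ?mulr1// gt_eqF.
rewrite /L1dist -ge0_integralZl//.
- apply: ge0_le_integral => //.
  + exact: measurable_box.
  + by apply: measurable_dist => //; exact: measurable_funM.
  + by apply: measurable_funeM; exact: measurable_dist.
  + by move=> w _; rewrite -EFinM lee_fin -mulrBr normrM ler_wpM2r// lerDl.
- exact: measurable_box.
- exact: measurable_dist.
Qed.

Lemma approximable_cst (r : R) : approximable (fun=> r).
Proof.
move=> delta d0; exists (fun=> r); first exact: cts_cst.
rewrite /L1dist; under eq_integral do rewrite subrr normr0.
by rewrite integral0 lee_fin ltW.
Qed.

Lemma approx_indic_itv (A : set R) (u v : R) (delta : R) : 0 < delta ->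
  measurable (A : set (measurableTypeR R)) ->
  exists2 g : R -> R, continuous g &
    (\int[mu]_(x in `[u, v]) (`|\1_A x - g x|)%:E <= delta%:E)%E.
Proof.
move=> d0 mA.
have fin : (mu `[u, v]%classic < +oo)%E.
  by rewrite lebesgue_measure_itv/=; case: ifP => _; rewrite -?EFinB ltry.
have int1 : mu.-integrable `[u, v] (EFin \o (\1_A : R -> R)).
  apply: measurable_bounded_integrable => //.
  - exists 1; split; first exact: num_real.
    move=> M M1 x _ /=; rewrite indicE; apply: le_trans (ltW M1).
    by case: (_ \in _); rewrite ?normr1 ?normr0.
have [g_ [cg _ g0]] := approximation_continuous_integrable (measurable_itv _) fin int1.
have [n hn] := cvge0_exists_le g0 d0.
by exists (g_ n).
Qed.

(** The error splits as [(1_A1 - g1) 1_A2 + g1 (1_A2 - g2)], and each part is integrated one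
    variable at a time. The second factor is chosen after the first because its tolerance depends on
    the size of [g1]. *)
Lemma approximable_rect (A1 A2 : set R) :
  measurable (A1 : set (measurableTypeR R)) ->
  measurable (A2 : set (measurableTypeR R)) ->
  approximable (\1_(A1 `*` A2)).
Proof.
move=> mA1 mA2 delta d0; have d2 : 0 < delta / 2 by rewrite divr_gt0.
have mu_fin u v : exists2 l : R, 0 <= l & mu `[u, v]%classic = l%:E.
  rewrite lebesgue_measure_itv/=; case: ifPn => [|_]; last by exists 0.
  by rewrite lte_fin => uv; exists (v - u); rewrite // subr_ge0 ltW.
have [l1 l10 hl1] := mu_fin a b; have [l2 l20 hl2] := mu_fin c d.
have e1 : 0 < delta / 2 / (l2 + 1) by rewrite divr_gt0// ltr_wpDl.
have [g1 cg1 hg1] := approx_indic_itv a b e1 mA1.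
have Mg : (\int[mu]_(x in `[a, b]) (`|g1 x|)%:E <= (l1 + delta / 2 / (l2 + 1))%:E)%E.
  apply: (@le_trans _ _ (\int[mu]_(x in `[a, b]) (1%:E + (`|\1_A1 x - g1 x|)%:E))%E).
    apply: ge0_le_integral => //.
    - apply/measurable_EFinP; apply: (@measurable_funS _ _ _ _ setT) => //.
      by apply: measurableT_comp => //; exact: continuous_measurable_fun.
    - apply: emeasurable_funD => //; apply/measurable_EFinP.
      apply: (@measurable_funS _ _ _ _ setT) => //.
      apply: measurableT_comp => //; apply: measurable_funB; first exact: measurable_indic.
      exact: continuous_measurable_fun.
    - move=> x _; rewrite -EFinD lee_fin.
      have := ler_normB (\1_A1 x : R) (\1_A1 x - g1 x); rewrite opprB addrCA subrr addr0.
      move=> /le_trans; apply; rewrite lerD2r indicE.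
      by case: (_ \in _); rewrite ?normr1 ?normr0.
  rewrite ge0_integralD//.
  - rewrite integral_cst//= hl1 mul1e EFinD; exact: leeD.
  - apply/measurable_EFinP; apply: (@measurable_funS _ _ _ _ setT) => //.
    apply: measurableT_comp => //; apply: measurable_funB; first exact: measurable_indic.
    exact: continuous_measurable_fun.
(* [M] bounds the [L^1] norm of [g1], by which the error of [g2] will be multiplied. *)
set M := l1 + _ in Mg.
have M0 : 0 <= M by rewrite addr_ge0// ltW.
have e2 : 0 < delta / 2 / (M + 1) by rewrite divr_gt0// ltr_wpDl.
have [g2 cg2 hg2] := approx_indic_itv c d e2 mA2.
have mg1 := continuous_measurable_fun cg1; have mg2 := continuous_measurable_fun cg2.
exists (fun w : R * R => g1 w.1 * g2 w.2).
  by apply: (@ctsM _ R) => w; [apply: (@continuous_comp _ _ _ fst g1); [exact: cvg_fst|exact: cg1]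
   |apply: (@continuous_comp _ _ _ snd g2); [exact: cvg_snd|exact: cg2]].
have m11 : measurable_fun [set: plane R] (fun w : plane R => (\1_A1 w.1 : R)).
  by apply: (measurableT_comp (measurable_indic mA1)); exact: measurable_fst.
have m12 : measurable_fun [set: plane R] (fun w : plane R => (\1_A2 w.2 : R)).
  by apply: (measurableT_comp (measurable_indic mA2)); exact: measurable_snd.
have m21 : measurable_fun [set: plane R] (fun w : plane R => g1 w.1).
  by apply: (measurableT_comp mg1); exact: measurable_fst.
have m22 : measurable_fun [set: plane R] (fun w : plane R => g2 w.2).
  by apply: (measurableT_comp mg2); exact: measurable_snd.
have n1 : measurable_fun [set: measurableTypeR R] (fun x => `|g1 x|) by exact: measurableT_comp.
have n2 : measurable_fun [set: measurableTypeR R] (fun z => `|\1_A2 z - g2 z|).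
  by apply: measurableT_comp => //; apply: measurable_funB => //; exact: measurable_indic.
pose F1 (w : plane R) : R := `|\1_A1 w.1 - g1 w.1|.
pose F2 (w : plane R) : R := `|g1 w.1| * `|\1_A2 w.2 - g2 w.2|.
have mF1 : measurable_fun [set: plane R] F1.
  by apply: measurableT_comp => //; exact: measurable_funB.
have mF2 : measurable_fun [set: plane R] F2.
  apply: measurable_funM; first exact: measurableT_comp.
  by apply: measurableT_comp => //; exact: measurable_funB.
have F10 w : 0 <= F1 w by rewrite /F1.
have F20 w : 0 <= F2 w by rewrite /F2 mulr_ge0.
apply: (@le_trans _ _ (\int[leb2]_(w in B) ((F1 w)%:E + (F2 w)%:E))%E).
  apply: ge0_le_integral => //.
  - exact: measurable_box.
  - apply: measurable_dist; last exact: measurable_funM.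
    by apply: measurable_indic; exact: measurableX.
  - by apply: emeasurable_funD; apply/measurable_EFinP;
      [exact: measurable_funS mF1|exact: measurable_funS mF2].
  - move=> w _; rewrite -EFinD lee_fin /F1 /F2.
    have -> : \1_(A1 `*` A2) w = \1_A1 w.1 * \1_A2 w.2 :> R.
      by rewrite !indicE in_setX -mulnb natrM.
    have -> : \1_A1 w.1 * \1_A2 w.2 - g1 w.1 * g2 w.2 =
      (\1_A1 w.1 - g1 w.1) * \1_A2 w.2 + g1 w.1 * (\1_A2 w.2 - g2 w.2) :> R by ring.
    apply: (le_trans (ler_normD _ _)); rewrite !normrM lerD2r ler_piMr//.
    by rewrite indicE; case: (_ \in _); rewrite ?normr1 ?normr0.
rewrite ge0_integralD; [|exact: measurable_box|by move=> w _; rewrite lee_fin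
  |by apply/measurable_EFinP; exact: measurable_funS mF1
  |by move=> w _; rewrite lee_fin
  |by apply/measurable_EFinP; exact: measurable_funS mF2].
rewrite (ge0_integral_box_zx _ _ _ _ mF1 F10) (ge0_integral_box_zx _ _ _ _ mF2 F20).
rewrite [delta]splitr EFinD; apply: leeD.
- apply: (@le_trans _ _ (\int[mu]_(z in `[c, d]) (delta / 2 / (l2 + 1))%:E)%E).
    apply: ge0_le_integral => //.
    + by move=> z _; apply: integral_ge0 => x _; rewrite lee_fin.
    + exact: measurable_funS (measurable_integral_row a b mF1 F10).
  rewrite integral_cst// [X in (_ * X)%E]hl2 -EFinM lee_fin mulrAC ler_pdivrMr ?ltr_wpDl//.
  by rewrite ler_wpM2l ?(ltW d2)// lerDl.
- apply: (@le_trans _ _ (\int[mu]_(z in `[c, d]) (M%:E * (`|\1_A2 z - g2 z|)%:E))%E).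
    apply: ge0_le_integral => //.
    + by move=> z _; apply: integral_ge0 => x _; rewrite lee_fin.
    + exact: measurable_funS (measurable_integral_row a b mF2 F20).
    + apply: measurable_funeM; apply/measurable_EFinP; exact: measurable_funS n2.
    + move=> z _; rewrite /F2/=.
      under eq_integral do rewrite EFinM.
      rewrite ge0_integralZr//; last first.
      * apply/measurable_EFinP; exact: measurable_funS n1.
      exact: lee_wpmul2r.
  rewrite ge0_integralZl//; last first.
    by apply/measurable_EFinP; exact: measurable_funS n2.
  apply: (le_trans (lee_wpmul2l _ hg2)); first by rewrite lee_fin.
  rewrite -EFinM lee_fin mulrA ler_pdivrMr ?ltr_wpDl// mulrC.
  by rewrite ler_wpM2l ?(ltW d2)// lerDl.
Qed.

Lemma approximable_setC (A : set (plane R)) : measurable A ->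
  approximable (\1_A) -> approximable (\1_(~` A)).
Proof.
move=> mA aA.
have -> : (\1_(~` A) : plane R -> R) = (fun w => 1 + (-1) * \1_A w).
  apply/funext => w; rewrite !indicE in_setC.
  by case: (w \in A) => /=; rewrite ?mulr1 ?subrr ?mulr0 ?addr0.
have mi : measurable_fun [set: plane R] (\1_A : plane R -> R) by exact: measurable_indic.
apply: approximableD => //; first exact: measurable_funM.
- exact: approximable_cst.
- exact: approximableZ.
Qed.

(** A finite partial sum of the indicators misses exactly the tail of the union, and the tails
    inside the box decrease to the empty set within a set of finite measure. *)
Lemma approximable_bigcup (F : (set (plane R))^nat) :
  (forall n, measurable (F n)) -> trivIset [set: nat] F ->
  (forall n, approximable (\1_(F n))) -> approximable (\1_(\bigcup_n F n)).
Proof.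
move=> mF tF aF; apply: approximable_lim.
  by apply: measurable_indic; exact: bigcupT_measurable.
move=> delta d0.
pose T n := \bigcup_(k in [set k | (n <= k)%N]) F k.
have mT n : measurable (T n) by apply: bigcup_measurable.
have : leb2 (T n `&` B) @[n --> \oo] --> leb2 (\bigcap_n (T n `&` B)).
  apply: nonincreasing_cvg_mu.
  - apply: (le_lt_trans _ (leb2_box_lty a b c d)).
    by apply: le_measure; rewrite ?inE//; [apply: measurableI => //; exact: measurable_box|exact: measurable_box].
  - by move=> n; apply: measurableI => //; exact: measurable_box.
  - by apply: bigcap_measurable => [|n _]; [exists 0%N|apply: measurableI => //; exact: measurable_box].
  - move=> m n mn; apply/subsetPset => w [[k /= nk Fk] Bw]; split => //.
    by exists k => //=; exact: leq_trans nk.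
have -> : \bigcap_n (T n `&` B) = set0.
  apply/seteqP; split => // w h.
  have [[k0 _ F0] _] := h 0%N I.
  have [[k1 /= k01 F1] _] := h k0.+1 I.
  have := tF k0 k1 I I; rewrite /= => /(_ (ex_intro _ w (conj F0 F1))) e.
  by rewrite e ltnn in k01.
rewrite measure0 => /cvge0_exists_le/(_ d0)[n hn].
exists (fun w => \sum_(k < n) \1_(F k) w).
have ms m : measurable_fun [set: plane R] (fun w : plane R => \sum_(k < m) (\1_(F k) w : R)).
  by apply: measurable_sum => k; exact: measurable_indic.
split => //.
- elim: n {hn} => [|n IHn].
    by under eq_fun do rewrite big_ord0; exact: approximable_cst.
  under eq_fun do rewrite big_ord_recr.
  by apply: approximableD => //; exact: measurable_indic.
- apply: le_trans hn; rewrite -integral_indic//; last exact: measurable_box.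
  rewrite le_eqVlt; apply/orP; left; apply/eqP; apply: eq_integral => w _.
  congr (_%:E).
  have [[k _ Fk]|nU] := pselect ((\bigcup_n F n) w); last first.
    have nF k : w \in F k = false.
      by apply/negbTE/negP => /set_mem Fk; apply: nU; exists k.
    rewrite !indicE (negbTE (_ : w \notin \bigcup_n F n)); last by apply/negP => /set_mem.
    rewrite big1 ?subrr ?normr0; last by move=> k _; rewrite indicE nF.
    by rewrite (negbTE (_ : w \notin T n))//; apply/negP => /set_mem [k _ Fk]; apply: nU; exists k.
  have inF k' : (w \in F k') = (k' == k).
    apply/idP/eqP => [/set_mem Fk'|->]; last exact: mem_set.
    by apply: (tF k' k I I); exists w.
  rewrite !indicE (_ : w \in \bigcup_n F n = true); last by apply: mem_set; exists k.
  under eq_bigr do rewrite indicE inF.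
  have -> : (w \in T n) = (n <= k)%N.
    apply/idP/idP => [/set_mem [k' /= nk' /mem_set]|nk]; first by rewrite inF => /eqP <-.
    by apply: mem_set; exists k.
  have [nk|kn] := leqP n k.
    rewrite big1 ?subr0 ?normr1// => i _.
    by rewrite ltn_eqF// (leq_trans (ltn_ord i)).
  rewrite (bigD1 (Ordinal kn))//= eqxx big1 ?addr0 ?subrr ?normr0// => i ik.
  by case: eqP => // e; case/eqP: ik; exact: val_inj.
Qed.

(** Dynkin's argument: measurable rectangles are stable under intersection and generate the product
    sigma-algebra, and the approximable sets are closed under complements and disjoint unions. *)
Lemma approximable_indic (A : set (plane R)) : measurable A -> approximable (\1_A).
Proof.
move=> mA; move: (mA); rewrite measurable_prod_measurableType.
have := @dynkin_induction _ (plane R)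
  [set A1 `*` A2 | A1 in @measurable _ (measurableTypeR R) &
                   A2 in @measurable _ (measurableTypeR R)]
  (fun A => approximable (\1_A))
  (measurable_prod_measurableType (measurableTypeR R) (measurableTypeR R)).
apply.
- move=> _ _ [A1 mA1 [A2 mA2 <-]] [C1 mC1 [C2 mC2 <-]].
  by rewrite -setXI; exists (A1 `&` C1); [exact: measurableI|exists (A2 `&` C2) => //; exact: measurableI].
- by rewrite indicT; exact: approximable_cst.
- by move=> _ [A1 mA1 [A2 mA2 <-]]; exact: approximable_rect.
- exact: approximable_setC.
- exact: approximable_bigcup.
Qed.

Import HBSimple.

Lemma approximable_sfun (g : {sfun plane R >-> R}) : approximable g.
Proof.
have mi (z : R) : measurable_fun [set: plane R] (fun w : plane R => z * \1_(g @^-1` [set z]) w).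
  by apply: measurable_funM => //; exact: measurable_indic.
have H (y : nat -> R) n : approximable (fun w => \sum_(i < n) y i * \1_(g @^-1` [set y i]) w).
  elim: n => [|n IHn].
    by under eq_fun do rewrite big_ord0; exact: approximable_cst.
  under eq_fun do rewrite big_ord_recr.
  apply: approximableD => //; first exact: measurable_sum.
  by apply: approximableZ; [exact: measurable_indic|exact: approximable_indic].
have -> := funext (fimfunEord g).
exact: (H (fun i => nth 0 _ i)).
Qed.

Lemma approximable_integrable f : measurable_fun [set: plane R] f ->
  leb2.-integrable B (EFin \o f) -> approximable f.
Proof.
move=> mf intf; apply: approximable_lim => // delta d0.
have [g_ [_ _ g0]] := approximation_sfun_integrable (measurable_box a b c d) intf.
have [n hn] := cvge0_exists_le g0 d0.
by exists (g_ n); split => //; exact: approximable_sfun.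
Qed.

End density.

Definition mollifier (R : realType) (h : R) (k : nat -> R -> R) : Prop :=
  [/\ forall n x, is_derive x (1 : R) (k n) (k n.+1 x),
      forall n x, h <= `|x| -> k n x = 0,
      forall x, 0 <= k 0%N x,
      forall x, k 0%N (- x) = k 0%N x
    & forall x, (\int[@lebesgue_measure R]_y (k 0%N (x - y))%:E = 1)%E].

(** * Jensen's inequality and convergence of mollifications *)

Section mollify.
Context {R : realType}.
Local Notation mu := (@lebesgue_measure R).
Variables (h : R) (k : nat -> R -> R).
Hypothesis mk : mollifier h k.
Implicit Types (f : plane R -> R) (w y : plane R).
Local Notation rho := (ker2 k 0 0).

Let dk : forall n x, is_derive x (1 : R) (k n) (k n.+1 x). Proof. by case: mk. Qed.
Let k_out : forall n x, h <= `|x| -> k n x = 0. Proof. by case: mk. Qed.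

Lemma rho_ge0 w y : 0 <= rho w y.
Proof. by case: mk => _ _ kp _ _; rewrite mulr_ge0. Qed.

Lemma rho_sym w y : rho w y = rho y w.
Proof.
case: mk => _ _ _ ke _.
by rewrite /ker2 -(ke (w.1 - y.1)) -(ke (w.2 - y.2)) !opprB.
Qed.

Lemma measurable_rho w : measurable_fun [set: plane R] (rho w : plane R -> R).
Proof. exact: (continuous_measurable_plane (ker2_continuous dk (w := w))). Qed.

Lemma integral_rho w : (\int[leb2]_y (rho w y)%:E = 1)%E.
Proof.
case: mk => _ _ kp _ k1.
have mr : measurable_fun [set: plane R] (fun y => (rho w y)%:E).
  by apply/measurable_EFinP; exact: measurable_rho.
rewrite [LHS](fubini_tonelli1 (m1 := mu) (m2 := mu) _ mr); last first.
  by move=> y; rewrite lee_fin rho_ge0.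
rewrite /fubini_F /ker2 /=.
have ck : continuous (fun x => k 0%N (w.2 - x)).
  move=> x; apply: (@continuous_comp _ _ _ (fun x : R => w.2 - x) (k 0%N)).
    by apply: cvgB; [exact: cvg_cst|exact: cvg_id].
  exact: (kernel_continuous dk).
have mck : measurable_fun [set: measurableTypeR R] (fun t => (k 0%N (w.2 - t))%:E).
  by apply/measurable_EFinP; exact: continuous_measurable_fun ck.
have E x : (\int[mu]_t (k 0%N (w.1 - x) * k 0%N (w.2 - t))%:E = (k 0%N (w.1 - x))%:E)%E.
  under eq_integral do rewrite EFinM.
  rewrite ge0_integralZl//; first by rewrite k1 mule1.
  - by move=> t _; rewrite lee_fin.
  - by rewrite lee_fin.
under eq_integral do rewrite E.
exact: k1.
Qed.

Lemma measurable_rho2 :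
  measurable_fun [set: plane R * plane R] (fun p : plane R * plane R => rho p.1 p.2).
Proof.
have mk0 : measurable_fun [set: R] (k 0%N).
  exact: (continuous_measurable_fun (kernel_continuous dk (n := 0%N))).
apply: measurable_funM.
- apply: (measurableT_comp mk0); apply: measurable_funB.
  + by apply: (measurableT_comp measurable_fst); exact: measurable_fst.
  + by apply: (measurableT_comp measurable_fst); exact: measurable_snd.
- apply: (measurableT_comp mk0); apply: measurable_funB.
  + by apply: (measurableT_comp measurable_snd); exact: measurable_fst.
  + by apply: (measurableT_comp measurable_snd); exact: measurable_snd.
Qed.

Lemma integrable_rho w : leb2.-integrable [set: plane R] (EFin \o rho w).
Proof.
apply/integrableP; split; first by apply/measurable_EFinP; exact: measurable_rho.
under eq_integral do rewrite /= ger0_norm ?rho_ge0//.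
by rewrite integral_rho ltry.
Qed.

Local Notation moll := (conv k 0 0).

(** Convexity enters as a supporting line at each point, with slope given by [slope]. The line at
    the mollified value, integrated against the probability density [rho w], gives the
    inequality. *)
Lemma conv_jensen f (phi slope : R -> R) w :
  leb2.-integrable [set: plane R] (EFin \o f) ->
  measurable_fun [set: R] phi -> (forall t, 0 <= phi t) ->
  (forall a t, phi a + slope a * (t - a) <= phi t) ->
  ((phi (moll f w))%:E <= \int[leb2]_y (phi (f y) * rho w y)%:E)%E.
Proof.
move=> intf mphi phi0 tangent.
have mf : measurable_fun [set: plane R] f by apply/measurable_EFinP; exact: measurable_int intf.
have mpf : measurable_fun [set: plane R] (fun y => phi (f y) * rho w y).
  by apply: measurable_funM; [exact: measurableT_comp|exact: measurable_rho].
have p0 y : 0 <= phi (f y) * rho w y by rewrite mulr_ge0 ?rho_ge0.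
(* When the right side is infinite there is nothing to prove; otherwise [phi (f y) * rho w y] is
   integrable and the comparison of integrals applies. *)
have [->|fin] := eqVneq (\int[leb2]_y (phi (f y) * rho w y)%:E)%E +oo%E; first exact: leey.
have intp : leb2.-integrable [set: plane R] (EFin \o (fun y => phi (f y) * rho w y)).
  apply/integrableP; split; first exact/measurable_EFinP.
  under eq_integral do rewrite /= ger0_norm//.
  by rewrite ltey.
set a := moll f w; set s := slope a.
have i1 := conv_integrable dk k_out 0 0 w intf.
have i2 := integrable_rho w.
have iZ1 := integrableZl measurableT s i1.
have iZ2 := integrableZl measurableT (phi a - s * a) i2.
have -> : (phi a)%:E = (\int[leb2]_y (s%:E * (f y * rho w y)%:E +
    (phi a - s * a)%:E * (rho w y)%:E))%E.
  rewrite integralD// (integralZl _ i1)// (integralZl _ i2)//.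
  rewrite integral_rho mule1.
  have -> : (\int[leb2]_y (f y * rho w y)%:E = a%:E)%E.
    by rewrite /a /conv /Rintegral fineK//; exact: integrable_fin_num.
  by rewrite -EFinM -EFinD addrCA subrr addr0.
apply: le_integral => //.
  by apply: integrableD.
move=> y _; rewrite -!EFinM -EFinD lee_fin mulrA -mulrDl ler_wpM2r ?rho_ge0//.
by apply: le_trans (tangent a (f y)); rewrite -/s mulrBr; lra.
Qed.

(** Jensen pointwise, then Tonelli: by symmetry of the kernel the inner integral over [w] has mass
    1. The integral on the right extends over the plane because the kernel reaches outside [D]. *)
Lemma conv_integral_le f (phi slope : R -> R) (D : set (plane R)) :
  measurable D -> leb2.-integrable [set: plane R] (EFin \o f) ->
  measurable_fun [set: R] phi -> (forall t, 0 <= phi t) ->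
  (forall a t, phi a + slope a * (t - a) <= phi t) ->
  (\int[leb2]_(w in D) (phi (moll f w))%:E <= \int[leb2]_y (phi (f y))%:E)%E.
Proof.
move=> mD intf mphi phi0 tangent.
have mf : measurable_fun [set: plane R] f by apply/measurable_EFinP; exact: measurable_int intf.
pose F (p : plane R * plane R) : \bar R := (phi (f p.2) * rho p.1 p.2)%:E.
have mF : measurable_fun [set: plane R * plane R] F.
  apply/measurable_EFinP; apply: measurable_funM; last exact: measurable_rho2.
  by apply: (measurableT_comp mphi); apply: (measurableT_comp mf); exact: measurable_snd.
have F0 p : (0 <= F p)%E by rewrite lee_fin mulr_ge0 ?rho_ge0.
have mG := measurable_fun_fubini_tonelli_F (m2 := @lam2 R) F mF F0.
have mm : measurable_fun [set: plane R] (fun w => (phi (moll f w))%:E).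
  apply/measurable_EFinP; apply: (measurableT_comp mphi).
  exact: (continuous_measurable_plane (conv_continuous dk k_out intf)).
apply: (@le_trans _ _ (\int[leb2]_w fubini_F (@lam2 R) F w)%E).
  apply: (@le_trans _ _ (\int[leb2]_(w in D) fubini_F (@lam2 R) F w)%E).
    apply: ge0_le_integral => //.
    - by move=> w _; rewrite lee_fin.
    - exact: measurable_funS mm.
    - exact: measurable_funS mG.
    - move=> w _; exact: (conv_jensen w intf mphi phi0 tangent).
  apply: ge0_subset_integral => //.
  by move=> w _; apply: integral_ge0.
have := fubini_tonelli (m1 := @lam2 R) (m2 := @lam2 R) F mF F0 => /= FT.
rewrite [leLHS]FT.
rewrite le_eqVlt; apply/orP; left; apply/eqP; apply: eq_integral => y _.
rewrite /F /=; under eq_integral do rewrite rho_sym EFinM.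
rewrite ge0_integralZl; first by rewrite [X in (_ * X)%E]integral_rho mule1.
- exact: measurableT.
- by apply/measurable_EFinP; exact: measurable_rho.
- by move=> w _; rewrite lee_fin rho_ge0.
- by rewrite lee_fin phi0.
Qed.

End mollify.

Section heine.
Context {R : realType}.

(** Only [w] is confined to the box. The second point may lie outside, as do the points that a
    kernel centred near the edge reaches. *)
Lemma uniformly_continuous_box (g : R * R -> R) (a b c d omega : R) :
  continuous g -> 0 < omega -> exists2 r : R, 0 < r & forall w y : R * R,
    box a b c d w -> `|w.1 - y.1| < r -> `|w.2 - y.2| < r -> `|g w - g y| <= omega.
Proof.
move=> cg o0.
have cK : compact (box a b c d) by exact: compact_box.
have /compact_near_coveringP := cK => nK.
pose P (r : R) (w : R * R) := forall y : R * R,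
  `|w.1 - y.1| < r -> `|w.2 - y.2| < r -> `|g w - g y| <= omega.
have H : \forall r \near (0 : R)^'+, box a b c d `<=` P r.
  apply: nK => w Bw.
  have o2 : 0 < omega / 2 by rewrite divr_gt0.
  have /cvgrPdist_lt/(_ _ o2) /nbhs_ballP[r /= r0 hr] := @cg w.
  exists (ball w (r / 2), [set t : R | t < r / 2]) => /=.
    split; first by apply: nbhsx_ballx; rewrite divr_gt0.
    by apply: nbhs_right_lt; rewrite divr_gt0.
  move=> [w' t] /= [[w1 w2] tr] y y1 y2.
  have h1 : `|g w - g w'| < omega / 2.
    apply: hr; split; apply: (@le_ball _ _ _ (r / 2)); rewrite //; lra.
  have h2 : `|g w - g y| < omega / 2.
    move: w1 w2; rewrite /ball/= => w1 w2.
    apply: hr; split; rewrite /ball/=.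
    - by have := ler_distD w'.1 w.1 y.1; lra.
    - by have := ler_distD w'.2 w.2 y.2; lra.
  have := ler_distD (g w) (g w') (g y); rewrite distrC in h1; lra.
have [r [r0 hr]] : exists r : R, 0 < r /\ box a b c d `<=` P r.
  near (0 : R)^'+ => r; exists r; split; first by near: r; exact: nbhs_right_gt.
  by near: r.
by exists r => // w y Bw; exact: hr.
Unshelve. all: by end_near. Qed.

End heine.

Section mollification_limit.
Context {R : realType}.
Implicit Types (f g : plane R -> R).

Lemma restrict_integrable f (D : set (plane R)) : measurable D ->
  leb2.-integrable D (EFin \o f) -> leb2.-integrable [set: plane R] (EFin \o (f \_ D)).
Proof.
move=> mD intf; have := (integrable_mkcond (EFin \o f) mD).1 intf.
by rewrite restrict_EFin.
Qed.

Lemma mollifier_near_zero (h : R) (k : nat -> R -> R) (w y : R * R) i j :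
  mollifier h k -> ker2 k i j w y != 0 ->
  `|w.1 - y.1| < h /\ `|w.2 - y.2| < h.
Proof.
move=> [_ k_out _ _ _] r0; split; rewrite ltNge; apply: contra r0 => /k_out e;
  by rewrite /ker2 e ?mul0r ?mulr0.
Qed.

Lemma norm_tangent (a t : R) : `|a| + Num.sg a * (t - a) <= `|t|.
Proof.
have [->|a0] := eqVneq a 0; first by rewrite normr0 sgr0 mul0r addr0.
rewrite mulrBr -normrEsg addrC subrK.
apply: (le_trans (ler_norm _)).
by rewrite normrM normr_sg a0 mul1r.
Qed.

(** With [g] continuous and close to [f] in [L^1], the error is the mollification of [f - g], which
    is no larger than [f - g], plus that of [g], uniformly small, plus [f - g] itself; each gets a
    third. The threshold [h1] is the same for all mollifiers. *)
Lemma conv_cvg_L1 f (a b c d delta : R) :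
  leb2.-integrable [set: plane R] (EFin \o f) -> 0 < delta ->
  exists2 h1 : R, 0 < h1 & forall (h : R) (k : nat -> R -> R), 0 < h -> h <= h1 ->
    mollifier h k -> (L1dist a b c d (conv k 0 0 f) f <= delta%:E)%E.
Proof.
move=> intf delta0.
have mf : measurable_fun [set: plane R] f by apply/measurable_EFinP; exact: measurable_int intf.
pose B : set (plane R) := box a b c d.
(* The enlargement by 1 goes with the condition [h <= 1]: on [B] the mollification sees only the
   values in [B']. *)
pose B' : set (plane R) := box (a - 1) (b + 1) (c - 1) (d + 1).
have mB' : measurable B' by exact: measurable_box.
have mB : measurable B by exact: measurable_box.
have BB' : B `<=` B' by apply: sub_box; rewrite ?gerBl ?lerDl.
have d3 : 0 < delta / 3 by rewrite divr_gt0.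
have intfB' : leb2.-integrable B' (EFin \o f) by apply: integrableS intf.
have [g cg fg] := approximable_integrable mf intfB' d3.
have [A A0 hA] : exists2 A : R, 0 <= A & leb2 B = A%:E.
  have := leb2_box_lty a b c d; rewrite -ge0_fin_numE ?measure_ge0// => fA.
  by exists (fine (leb2 B)); rewrite ?fineK// fine_ge0// measure_ge0.
have o0 : 0 < delta / 3 / (A + 1) by rewrite divr_gt0// ltr_wpDl.
have [r r0 hr] := uniformly_continuous_box a b c d cg o0.
set omega := delta / 3 / (A + 1) in o0 hr.
exists (Num.min 1 r); first by rewrite lt_min r0 ltr01.
move=> h k h0; rewrite le_min => /andP[h1 hr1] mk.
have dk : forall n x, is_derive x (1 : R) (k n) (k n.+1 x) by case: mk.
have k_out : forall n x, h <= `|x| -> k n x = 0 by case: mk.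
have mg : measurable_fun [set: plane R] g by exact: continuous_measurable_plane.
have intg : leb2.-integrable B' (EFin \o g) by exact: continuous_integrable_box.
pose f1 := (fun w => f w - g w) \_ B'; pose f2 := (g : plane R -> R) \_ B'.
have intd : leb2.-integrable B' (EFin \o (fun w => f w - g w)).
  exact: (integrableB mB' intfB' intg).
have i1 : leb2.-integrable [set: plane R] (EFin \o f1) by exact: restrict_integrable.
have i2 : leb2.-integrable [set: plane R] (EFin \o f2) by exact: restrict_integrable.
have kernel_in w y : B w -> y \notin B' -> ker2 k 0 0 w y = 0.
  move=> [+ +] yB'; rewrite /= !in_itv/= => /andP[w1 w2] /andP[w3 w4].
  apply/eqP; apply: contraNT yB' => /(mollifier_near_zero mk)[].
  rewrite !ltr_norml => /andP[u1 u2] /andP[u3 u4]; apply: mem_set.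
  clear -h1 w1 w2 w3 w4 u1 u2 u3 u4.
  by split; rewrite /= in_itv/=; apply/andP; split; lra.
have split w : B w -> conv k 0 0 f w = conv k 0 0 f1 w + conv k 0 0 f2 w.
  move=> Bw; rewrite /conv -RintegralD//; [|exact: (conv_integrable dk k_out)..].
  apply: eq_Rintegral => y _; rewrite /f1 /f2 !patchE.
  case: ifPn => yB'; first by rewrite -mulrDl subrK.
  by rewrite (kernel_in w y Bw yB') !mulr0 addr0.
have c1 := conv_continuous dk k_out (i := 0) (j := 0) i1.
have c2 := conv_continuous dk k_out (i := 0) (j := 0) i2.
have m1 := continuous_measurable_plane c1; have m2 := continuous_measurable_plane c2.
have second w : B w -> `|conv k 0 0 f2 w - g w| <= omega.
  move=> Bw.
  have ir := integrable_rho mk w.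
  have ic := conv_integrable dk k_out 0 0 w i2.
  have ig := integrableZl measurableT (g w) ir.
  have -> : g w = \int[leb2]_y (g w * ker2 k 0 0 w y).
    by rewrite RintegralZl// /Rintegral (integral_rho mk)/= mulr1.
  rewrite -RintegralB//.
  have id := integrableB measurableT ic ig.
  apply: (le_trans (le_normr_Rintegral measurableT id)).
  have -> : omega = \int[leb2]_y (omega * ker2 k 0 0 w y).
    by rewrite RintegralZl// /Rintegral (integral_rho mk)/= mulr1.
  apply: le_Rintegral => //.
  - exact: (integrable_abse id).
  - exact: (integrableZl measurableT omega ir).
  - move=> y _; rewrite -mulrBl normrM (ger0_norm (rho_ge0 mk _ _)).
    have [->|rn0] := eqVneq (ker2 k 0 0 w y) 0; first by rewrite !mulr0.
    rewrite ler_wpM2r ?(rho_ge0 mk)//.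
    have [y1 y2] := mollifier_near_zero mk rn0.
    rewrite /f2 patchE (_ : y \in B' = true); last first.
      by apply/negPn/negP => /(kernel_in w y Bw)/eqP; rewrite (negbTE rn0).
    by rewrite distrC; apply: hr => //; exact: lt_le_trans hr1.
have mc : measurable_fun [set: plane R] (conv k 0 0 f).
  exact: continuous_measurable_plane (conv_continuous dk k_out (i := 0) (j := 0) intf).
have mdist (u v : plane R -> R) : measurable_fun [set: plane R] u ->
    measurable_fun [set: plane R] v -> measurable_fun B (fun w => (`|u w - v w|)%:E).
  by move=> mu mv; exact: measurable_dist.
have mn1 : measurable_fun B (fun w => (`|conv k 0 0 f1 w|)%:E).
  apply/measurable_EFinP; apply: (@measurable_funS _ _ _ _ setT) => //.
  exact: measurableT_comp.
have T1 : (\int[leb2]_(w in B) (`|conv k 0 0 f1 w|)%:E <= (delta / 3)%:E)%E.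
  have mnorm : measurable_fun [set: R] (fun t : R => `|t|) by exact: normr_measurable.
  have := conv_integral_le mk (phi := fun t => `|t|) mB i1 mnorm (fun t => normr_ge0 t) norm_tangent.
  move=> /le_trans; apply.
  apply: le_trans fg; rewrite /L1dist [leRHS]integral_mkcond.
  rewrite le_eqVlt; apply/orP; left; apply/eqP; apply: eq_integral => y _.
  by rewrite /f1 !patchE; case: ifP => //; rewrite normr0.
have T2 : (\int[leb2]_(w in B) (omega%:E) <= (delta / 3)%:E)%E.
  rewrite integral_cst// [X in (_ * X)%E]hA -EFinM lee_fin /omega.
  by rewrite mulrAC ler_pdivrMr ?ltr_wpDl// ler_wpM2l ?(ltW d3)// lerDl.
have T3 : (\int[leb2]_(w in B) (`|f w - g w|)%:E <= (delta / 3)%:E)%E.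
  by apply: le_trans fg; apply: ge0_subset_integral => //; apply: measurable_dist.
have -> : delta%:E = ((delta / 3)%:E + (delta / 3)%:E + (delta / 3)%:E)%E.
  by rewrite -!EFinD; congr EFin; lra.
apply: (@le_trans _ _ (\int[leb2]_(w in B) ((`|conv k 0 0 f1 w|)%:E + omega%:E + (`|f w - g w|)%:E))%E).
  apply: ge0_le_integral => //.
  - exact: mdist.
  - apply: emeasurable_funD; last exact: mdist.
    exact: emeasurable_funD.
  - move=> w Bw; rewrite -!EFinD lee_fin (split w Bw).
    have := second w Bw.
    have := ler_normD (conv k 0 0 f1 w) (conv k 0 0 f2 w - f w).
    have := ler_distD (g w) (conv k 0 0 f2 w) (f w).
    by rewrite addrA [`|g w - f w|]distrC; lra.
have o0' : (0 <= omega%:E)%E by rewrite lee_fin ltW.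
rewrite ge0_integralD//; last 3 first.
- by move=> w _; rewrite -EFinD lee_fin addr_ge0// ltW.
- exact: emeasurable_funD.
- exact: mdist.
rewrite ge0_integralD//.
by apply: leeD => //; exact: leeD.
Qed.

End mollification_limit.

Section weak_derivative.
Context {R : realType}.
Variables (Omega : set (plane R)) (h : R) (k : nat -> R -> R).
Hypothesis mk : mollifier h k.
Implicit Types (u g : plane R -> R).

(** The kernel centred at [w] is a test function, since its support box lies in [Omega]. The sign in
    the definition of the weak derivative cancels the one from differentiating the kernel in [y]. *)
Lemma conv_wderiv_x u g i j (w : R * R) : is_wderiv Omega e_x u g ->
  leb2.-integrable [set: plane R] (EFin \o (u \_ Omega)) ->
  leb2.-integrable [set: plane R] (EFin \o (g \_ Omega)) ->
  box (w.1 - h) (w.1 + h) (w.2 - h) (w.2 + h) `<=` Omega ->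
  conv k i.+1 j (u \_ Omega) w = conv k i j (g \_ Omega) w.
Proof.
move=> [_ _ H] iu ig wO.
have dk : forall n x, is_derive x (1 : R) (k n) (k n.+1 x) by case: mk.
have k_out : forall n x, h <= `|x| -> k n x = 0 by case: mk.
have := H _ (ker2_test dk k_out i j wO).
rewrite [LHS]Rintegral_mkcond [in RHS]Rintegral_mkcond => E.
have e1 : \int[leb2]_y ((fun y => u y * 'D_e_x (ker2 k i j w) y) \_ Omega) y =
    - conv k i.+1 j (u \_ Omega) w.
  rewrite -mulN1r -RintegralZl//; last exact: (conv_integrable dk k_out).
  apply: eq_Rintegral => y _; rewrite !patchE; case: ifP => _.
    by rewrite derive_ker2_x// mulN1r mulrN.
  by rewrite mul0r mulr0.
have e2 : \int[leb2]_y ((fun y => g y * ker2 k i j w y) \_ Omega) y =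
    conv k i j (g \_ Omega) w.
  apply: eq_Rintegral => y _; rewrite !patchE; case: ifP => // _.
  by rewrite mul0r.
by apply: oppr_inj; rewrite -e1 -e2.
Qed.

Lemma conv_wderiv_z u g i j (w : R * R) : is_wderiv Omega e_z u g ->
  leb2.-integrable [set: plane R] (EFin \o (u \_ Omega)) ->
  leb2.-integrable [set: plane R] (EFin \o (g \_ Omega)) ->
  box (w.1 - h) (w.1 + h) (w.2 - h) (w.2 + h) `<=` Omega ->
  conv k i j.+1 (u \_ Omega) w = conv k i j (g \_ Omega) w.
Proof.
move=> [_ _ H] iu ig wO.
have dk : forall n x, is_derive x (1 : R) (k n) (k n.+1 x) by case: mk.
have k_out : forall n x, h <= `|x| -> k n x = 0 by case: mk.
have := H _ (ker2_test dk k_out i j wO).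
rewrite [LHS]Rintegral_mkcond [in RHS]Rintegral_mkcond => E.
have e1 : \int[leb2]_y ((fun y => u y * 'D_e_z (ker2 k i j w) y) \_ Omega) y =
    - conv k i j.+1 (u \_ Omega) w.
  rewrite -mulN1r -RintegralZl//; last exact: (conv_integrable dk k_out).
  apply: eq_Rintegral => y _; rewrite !patchE; case: ifP => _.
    by rewrite derive_ker2_z// mulN1r mulrN.
  by rewrite mul0r mulr0.
have e2 : \int[leb2]_y ((fun y => g y * ker2 k i j w y) \_ Omega) y =
    conv k i j (g \_ Omega) w.
  apply: eq_Rintegral => y _; rewrite !patchE; case: ifP => // _.
  by rewrite mul0r.
by apply: oppr_inj; rewrite -e1 -e2.
Qed.

End weak_derivative.

(** * Approximation by smooth potentials *)

Section integral_bounds.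
Context {R : realType} (D : set (plane R)).
Hypothesis mD : measurable D.
Implicit Types (F G : plane R -> R) (x y : R).

(** Stated in the extended reals, so that a bound includes finiteness; the real-valued integral
    would assign 0 to an infinite one. *)
Definition int_le F x : Prop := (\int[leb2]_(w in D) (F w)%:E <= x%:E)%E.

Lemma int_le_trans F x y : int_le F x -> x <= y -> int_le F y.
Proof. by move=> Fx xy; apply: (le_trans Fx); rewrite lee_fin. Qed.

Lemma int_leD F G x y :
  measurable_fun [set: plane R] F -> measurable_fun [set: plane R] G ->
  (forall w, 0 <= F w) -> (forall w, 0 <= G w) ->
  int_le F x -> int_le G y -> int_le (fun w => F w + G w) (x + y).
Proof.
move=> mF mG F0 G0 Fx Gy; rewrite /int_le.
under eq_integral do rewrite EFinD.
rewrite ge0_integralD//.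
- by rewrite EFinD; exact: leeD.
- by move=> w _; rewrite lee_fin.
- by apply/measurable_EFinP; exact: measurable_funS mF.
- by move=> w _; rewrite lee_fin.
- by apply/measurable_EFinP; exact: measurable_funS mG.
Qed.

Lemma int_leZ F (k x : R) : measurable_fun [set: plane R] F ->
  (forall w, 0 <= F w) -> 0 <= k ->
  int_le F x -> int_le (fun w => k * F w) (k * x).
Proof.
move=> mF F0 k0 Fx; rewrite /int_le.
under eq_integral do rewrite EFinM.
rewrite ge0_integralZl//.
- by rewrite EFinM; apply: lee_wpmul2l.
- by apply/measurable_EFinP; exact: measurable_funS mF.
- by move=> w _; rewrite lee_fin.
Qed.

Lemma int_le_le F G x : measurable_fun [set: plane R] F ->
  measurable_fun [set: plane R] G -> (forall w, 0 <= F w) ->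
  (forall w, D w -> F w <= G w) -> int_le G x -> int_le F x.
Proof.
move=> mF mG F0 FG; apply: le_trans; apply: ge0_le_integral => //.
- by move=> w _; rewrite lee_fin.
- by apply/measurable_EFinP; exact: measurable_funS mF.
- by apply/measurable_EFinP; exact: measurable_funS mG.
Qed.

Lemma int_le_cst (k A : R) : leb2 D = A%:E -> int_le (fun=> k) (k * A).
Proof. by move=> DA; rewrite /int_le integral_cst// DA -EFinM. Qed.

End integral_bounds.

Section pointwise.
Context {R : realType}.
Implicit Types (t m c q i delta : R).

Lemma cube_add t m : 0 <= t -> 0 <= m -> (t + m) ^+ 3 <= 4 * (t ^+ 3 + m ^+ 3).
Proof.
move=> t0 m0; rewrite -subr_ge0.
have -> : 4 * (t ^+ 3 + m ^+ 3) - (t + m) ^+ 3 = 3 * ((t + m) * (t - m) ^+ 2) by ring.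
apply: mulr_ge0 => //; apply: mulr_ge0; [exact: addr_ge0|exact: sqr_ge0].
Qed.

Lemma pow6_add t m : (t + m) ^+ 6 <= 32 * (t ^+ 6 + m ^+ 6).
Proof.
have h : (t + m) ^+ 2 <= 2 * (t ^+ 2 + m ^+ 2).
  by rewrite -subr_ge0 (_ : _ - _ = (t - m) ^+ 2) ?sqr_ge0//; ring.
have h3 : ((t + m) ^+ 2) ^+ 3 <= (2 * (t ^+ 2 + m ^+ 2)) ^+ 3.
  by apply: lerXn2r; rewrite ?nnegrE ?sqr_ge0// mulr_ge0// addr_ge0 ?sqr_ge0.
have := cube_add (sqr_ge0 t) (sqr_ge0 m).
by move: h3; rewrite exprMn -!exprM/=; lra.
Qed.

(** Split at [t = 1 / delta]. Sixth powers are merely bounded in mean and get the small coefficient;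
    the first power, which mollification makes small in mean, can afford the large one. *)
Lemma interpolate_41_6 t delta : 0 <= t -> 0 < delta ->
  t ^+ 4 <= delta ^+ 2 * t ^+ 6 + delta ^- 3 * t.
Proof.
move=> t0 d0; have [h|h] := leP 1 (delta * t).
  have h2 : 1 <= (delta * t) ^+ 2 by exact: exprn_ege1.
  have := ler_wpM2r (exprn_ge0 4 t0) h2.
  have : 0 <= delta ^- 3 * t by rewrite mulr_ge0// invr_ge0 exprn_ge0// ltW.
  have -> : (delta * t) ^+ 2 * t ^+ 4 = delta ^+ 2 * t ^+ 6 by ring.
  lra.
have h3 : (delta * t) ^+ 3 <= 1 by rewrite expr_le1// ?mulr_ge0// ltW.
have : 0 <= delta ^+ 2 * t ^+ 6 by rewrite mulr_ge0// exprn_ge0// ltW.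
suff : t ^+ 4 <= delta ^- 3 * t by lra.
have -> : t ^+ 4 = delta ^- 3 * ((delta * t) ^+ 3 * t) by field; rewrite gt_eqF.
by rewrite ler_wpM2l ?invr_ge0 ?exprn_ge0 ?(ltW d0)// ler_piMl.
Qed.

Lemma interpolate_21_3 t delta : 0 <= t -> 0 < delta ->
  t ^+ 2 <= delta * t ^+ 3 + delta^-1 * t.
Proof.
move=> t0 d0; have [h|h] := leP 1 (delta * t).
  have := ler_wpM2r (exprn_ge0 2 t0) h.
  have : 0 <= delta^-1 * t by rewrite mulr_ge0// invr_ge0 ltW.
  have -> : delta * t * t ^+ 2 = delta * t ^+ 3 by ring.
  lra.
have : 0 <= delta * t ^+ 3 by rewrite mulr_ge0 ?exprn_ge0// ltW.
suff : t ^+ 2 <= delta^-1 * t by lra.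
have -> : t ^+ 2 = delta^-1 * ((delta * t) * t) by field; rewrite gt_eqF.
by rewrite ler_wpM2l ?invr_ge0 ?(ltW d0)// ler_piMl// ltW.
Qed.

Lemma dist4_le m c delta : 0 < delta -> delta <= 1 ->
  (m - c) ^+ 4 <= delta * (32 * (m ^+ 6 + c ^+ 6)) + delta ^- 4 * `|m - c|.
Proof.
move=> d0 d1; have := interpolate_41_6 (normr_ge0 (m - c)) d0.
rewrite (norm_even (m - c) 2) (norm_even (m - c) 3) => h; apply: (le_trans h).
have p6 := pow6_add m (- c); rewrite (_ : (- c) ^+ 6 = c ^+ 6) in p6; last by ring.
have p60 : 0 <= (m - c) ^+ 6 by rewrite (exprM (m - c) 3 2) sqr_ge0.
apply: lerD.
  apply: ler_pM => //; first by rewrite sqr_ge0.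
  by rewrite expr2 ler_piMl// ltW.
apply: ler_wpM2r => //; rewrite lef_pV2 ?posrE ?exprn_gt0//.
by rewrite exprS ler_piMl// ?exprn_ge0// ltW.
Qed.

(** To be read with [c], [q] and [i] the mollifications of [m], of [m ^+ 2] and of the residue. The
    commutator [q - c ^+ 2] is split through [m ^+ 2]; then 68 is 64 from [m ^+ 2 - c ^+ 2] plus 4
    from [q - m ^+ 2]. *)
Lemma residue_moll_le m c q i delta : 0 < delta -> delta <= 1 ->
  (i + 2^-1 * (q - c ^+ 2)) ^+ 2 <= 2 * i ^+ 2 +
    (delta * (1 + 68 * m ^+ 6 + 64 * c ^+ 6 + 4 * `|q| ^+ 3) +
     delta ^- 4 * (`|q - m ^+ 2| + `|m - c|)).
Proof.
move=> d0 d1.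
have e6 t : 0 <= t ^+ 6 by rewrite (exprM t 3 2) sqr_ge0.
set al := q - m ^+ 2; set be := m ^+ 2 - c ^+ 2.
have qce : q - c ^+ 2 = al + be by rewrite /al /be addrA subrK.
have s1 : (i + 2^-1 * (q - c ^+ 2)) ^+ 2 <= 2 * i ^+ 2 + (al ^+ 2 + be ^+ 2).
  rewrite qce.
  have := sqr_ge0 (i - 2^-1 * (al + be)); have := sqr_ge0 (al - be).
  by rewrite -subr_ge0 => h1; nra.
have d10 : 0 < delta^-1 by rewrite invr_gt0.
have d1i : 1 <= delta^-1 by rewrite invf_ge1.
have s2 : al ^+ 2 <= delta * (4 * (`|q| ^+ 3 + m ^+ 6)) + delta ^- 4 * `|al|.
  have := interpolate_21_3 (normr_ge0 al) d0.
  rewrite real_normK ?num_real// => h; apply: (le_trans h).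
  apply: lerD.
    apply: ler_wpM2l; first exact: ltW.
    have := cube_add (normr_ge0 q) (sqr_ge0 m); rewrite -exprM/= => h'.
    apply: le_trans h'; apply: lerXn2r; rewrite ?nnegrE ?addr_ge0 ?sqr_ge0//.
    by apply: (le_trans (ler_normB _ _)); rewrite (ger0_norm (sqr_ge0 m)).
  apply: ler_wpM2r => //; rewrite -exprVn.
  by rewrite exprS ler_peMr ?(ltW d10)// exprn_ege1.
have s3 : be ^+ 2 <= delta * (1 + 64 * (m ^+ 6 + c ^+ 6)) + delta ^- 4 * `|m - c|.
  have h1 := interpolate_41_6 (normr_ge0 (m - c)) d0.
  rewrite (norm_even (m - c) 2) (norm_even (m - c) 3) in h1.
  have be2 : be ^+ 2 <= delta^-1 * (m - c) ^+ 4 + delta * (m + c) ^+ 4.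
    have := mulr_ge0 (ltW d0) (sqr_ge0 (delta^-1 * (m - c) ^+ 2 - (m + c) ^+ 2)).
    have -> : delta * (delta^-1 * (m - c) ^+ 2 - (m + c) ^+ 2) ^+ 2 =
      delta^-1 * (m - c) ^+ 4 + delta * (m + c) ^+ 4 - 2 * be ^+ 2.
      by rewrite /be; field; rewrite gt_eqF.
    by have := sqr_ge0 be; lra.
  have p6 := pow6_add m (- c); rewrite (_ : (- c) ^+ 6 = c ^+ 6) in p6; last by ring.
  have p6' := pow6_add m c.
  have s46 := pow4_le1D6 (m + c).
  have h2 : delta^-1 * (m - c) ^+ 4 <= delta * (m - c) ^+ 6 + delta ^- 4 * `|m - c|.
    have := ler_wpM2l (ltW d10) h1.
    have -> : delta^-1 * (delta ^+ 2 * (m - c) ^+ 6 + delta ^- 3 * `|m - c|) =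
      delta * (m - c) ^+ 6 + delta ^- 4 * `|m - c|.
      by field; rewrite gt_eqF.
    exact.
  have h3 := ler_wpM2l (ltW d0) s46; have h4 := ler_wpM2l (ltW d0) p6.
  have h5 := ler_wpM2l (ltW d0) p6'.
  by apply: (le_trans be2); move: h2 h3 h4 h5; move: (_ * `|m - c|) => Y; lra.
apply: (le_trans s1); rewrite lerD2l; apply: (le_trans (lerD s2 s3)).
rewrite (mulrDr (delta ^- 4)).
have := mulr_ge0 (ltW d0) (e6 m); have := mulr_ge0 (ltW d0) (e6 c).
lra.
Qed.

End pointwise.

Section tangents.
Context {R : realType}.
Implicit Types (a t : R).

Lemma sqr_tangent a t : a ^+ 2 + 2 * a * (t - a) <= t ^+ 2.
Proof. by rewrite -subr_ge0 (_ : _ - _ = (t - a) ^+ 2) ?sqr_ge0//; ring. Qed.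

Lemma cube_tangent (x y : R) : 0 <= x -> 0 <= y ->
  x ^+ 3 + 3 * x ^+ 2 * (y - x) <= y ^+ 3.
Proof.
move=> x0 y0; rewrite -subr_ge0 (_ : _ - _ = (y - x) ^+ 2 * (y + 2 * x)); last by ring.
by rewrite mulr_ge0 ?sqr_ge0// addr_ge0// mulr_ge0.
Qed.

Lemma norm_cube_tangent a t : `|a| ^+ 3 + 3 * `|a| * a * (t - a) <= `|t| ^+ 3.
Proof.
apply: le_trans (cube_tangent (normr_ge0 a) (normr_ge0 t)); rewrite lerD2l.
have : `|a| * (a * t) <= `|a| * (`|a| * `|t|).
  by rewrite ler_wpM2l// -normrM ler_norm.
have := real_normK (num_real a); rewrite !expr2 => e.
rewrite (_ : 3 * `|a| * a * (t - a) = 3 * (`|a| * (a * t)) - 3 * (`|a| * (a * a))); last by ring.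
rewrite -e (_ : _ * (`|t| - `|a|) = 3 * (`|a| * (`|a| * `|t|)) - 3 * (`|a| * (`|a| * `|a|))); last by ring.
lra.
Qed.

Lemma pow6_tangent a t : a ^+ 6 + 6 * a ^+ 5 * (t - a) <= t ^+ 6.
Proof.
have := cube_tangent (sqr_ge0 a) (sqr_ge0 t); rewrite -!exprM/=.
apply: le_trans; rewrite lerD2l.
have := ler_wpM2l (_ : 0 <= 3 * a ^+ 4) (sqr_tangent a t).
rewrite (exprM a 2 2) mulr_ge0 ?sqr_ge0// => /(_ isT).
by rewrite -(exprM a 2 2)/=; lra.
Qed.

End tangents.

Section smooth_approximation.
Context {R : realType}.
Variables (Omega : set (plane R)) (u m q X : plane R -> R).
Variables (a b c d h0 M6 rho MX : R).
Local Notation B := (box a b c d).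
Local Notation T := [set: plane R].
Hypotheses (ab : a <= b) (cd : c <= d) (h00 : 0 < h0).
Hypothesis margin : forall w, B w ->
  box (w.1 - h0) (w.1 + h0) (w.2 - h0) (w.2 + h0) `<=` Omega.
Hypotheses (um : is_wderiv Omega e_x u m) (uq : is_wderiv Omega e_z u q)
  (mX : is_wderiv Omega e_x m X).
Hypotheses (iu : leb2.-integrable T (EFin \o (u \_ Omega)))
  (im : leb2.-integrable T (EFin \o (m \_ Omega)))
  (im2 : leb2.-integrable T (EFin \o (fun w => (m \_ Omega) w ^+ 2)))
  (iq : leb2.-integrable T (EFin \o (q \_ Omega)))
  (iX : leb2.-integrable T (EFin \o (X \_ Omega))).
Hypotheses (m6 : int_le T (fun w => (m \_ Omega) w ^+ 6) M6)
  (r2 : int_le T (fun w => ((q \_ Omega) w - 2^-1 * (m \_ Omega) w ^+ 2) ^+ 2) rho)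
  (X2 : int_le T (fun w => (X \_ Omega) w ^+ 2) MX).

Let mB : measurable (B : set (plane R)). Proof. exact: measurable_box. Qed.

(* The mollified residue is the residue of the mollification up to the commutator
   (m^2 * rho - (m * rho)^2)/2, which tends to 0 in L^2 because m is in L^6. *)
Lemma mollified_potential tau : 0 < tau -> exists v : potential R,
  [/\ int_le B (fun w => pot_x v w ^+ 6) M6,
      int_le B (fun w => residue v w ^+ 2) (2 * rho + tau),
      int_le B (fun w => pot_xx v w ^+ 2) MX
    & int_le B (fun w => ((m \_ Omega) w - pot_x v w) ^+ 4) tau].
Proof.
move=> tau0.
pose f := m \_ Omega; pose g := fun w => f w ^+ 2.
have M60 : 0 <= M6.
  rewrite -lee_fin; apply: le_trans m6; apply: integral_ge0 => w _.
  by rewrite lee_fin (exprM _ 3 2) sqr_ge0.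
pose A : R := (b - a) * (d - c).
have A0 : 0 <= A by rewrite mulr_ge0// subr_ge0.
have hA : leb2 (B : set (plane R)) = A%:E by exact: leb2_box.
(* 136 is 68 + 64 + 4, the coefficients in [residue_moll_le] of the three sixth-power quantities,
   each of which has integral at most [M6]. The choice of [del] makes this part at most
   [tau / 2]. *)
pose N : R := A + 136 * M6 + 1.
have N0 : 0 < N by rewrite ltr_wpDl// addr_ge0// mulr_ge0.
pose del : R := Num.min 1 (tau / (2 * N)).
have del0 : 0 < del by rewrite lt_min ltr01/= divr_gt0// mulr_gt0.
have del1 : del <= 1 by rewrite ge_min lexx.
have delN : del * N <= tau / 2.
  rewrite -ler_pdivlMr//; apply: (@le_trans _ _ (tau / (2 * N))); first by rewrite ge_min lexx orbT.
  by rewrite invfM mulrA.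
(* The [L^1] errors are multiplied by [del ^- 4] and there are two of them, which makes another
   [tau / 2]. *)
pose eta : R := del ^+ 4 * (tau / 4).
have d40 : 0 < del ^+ 4 by rewrite exprn_gt0.
have eta0 : 0 < eta by rewrite mulr_gt0// divr_gt0.
have etaE : del ^- 4 * eta = tau / 4 by rewrite /eta mulrA mulVf ?gt_eqF// mul1r.
have [h1 h10 H1] := conv_cvg_L1 a b c d im eta0.
have [h2 h20 H2] := conv_cvg_L1 a b c d im2 eta0.
pose h : R := Num.min h0 (Num.min h1 h2).
have hp : 0 < h by rewrite !lt_min h00 h10 h20.
have hh0 : h <= h0 by rewrite ge_min lexx.
have hh1 : h <= h1 by rewrite !ge_min lexx orbT.
have hh2 : h <= h2 by rewrite !ge_min lexx !orbT.
have [k kP] := kernel_exists hp.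
have mk : mollifier h k by exact: kP.
have dk : forall n x, is_derive x (1 : R) (k n) (k n.+1 x) by case: mk.
have k_out : forall n x, h <= `|x| -> k n x = 0 by case: mk.
have {}H1 := H1 _ _ hp hh1 mk; have {}H2 := H2 _ _ hp hh2 mk.
have sub w : B w -> box (w.1 - h) (w.1 + h) (w.2 - h) (w.2 + h) `<=` Omega.
  move=> Bw; apply: subset_trans (margin Bw); apply: sub_box.
  - by rewrite lerD2l lerN2.
  - by rewrite lerD2l.
  - by rewrite lerD2l lerN2.
  - by rewrite lerD2l.
pose v := conv_potential dk k_out iu.
pose cm := conv k 0 0 f; pose cg := conv k 0 0 g.
have vx w : B w -> pot_x v w = cm w.
  by move=> Bw; exact: (conv_wderiv_x mk 0 0 um iu im (sub w Bw)).
have vz w : B w -> pot_z v w = conv k 0 0 (q \_ Omega) w.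
  by move=> Bw; exact: (conv_wderiv_z mk 0 0 uq iu iq (sub w Bw)).
have vxx w : B w -> pot_xx v w = conv k 0 0 (X \_ Omega) w.
  move=> Bw; rewrite -(conv_wderiv_x mk 0 0 mX im iX (sub w Bw)).
  exact: (conv_wderiv_x mk 1 0 um iu im (sub w Bw)).
pose rr w := (q \_ Omega) w - 2^-1 * f w ^+ 2.
have ir : leb2.-integrable T (EFin \o rr).
  have := integrableB measurableT iq (integrableZl measurableT 2^-1 im2).
  by apply: eq_integrable => // w _.
pose cr := conv k 0 0 rr.
have vr w : B w -> residue v w = cr w + 2^-1 * (cg w - cm w ^+ 2).
  move=> Bw; rewrite /residue vz// vx//.
  suff -> : conv k 0 0 (q \_ Omega) w = cr w + 2^-1 * cg w by ring.
  rewrite /cr /cg /conv -RintegralZl//; last exact: (conv_integrable dk k_out).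
  rewrite -RintegralD//; last 2 first.
  - exact: (conv_integrable dk k_out).
  - have := integrableZl measurableT 2^-1 (conv_integrable dk k_out 0 0 w im2).
    by apply: eq_integrable => // y _.
  by apply: eq_Rintegral => y _; rewrite /rr /g; ring.
have mf : measurable_fun T f by apply/measurable_EFinP; exact: measurable_int im.
have mcm : measurable_fun T cm.
  exact: (continuous_measurable_plane (conv_continuous dk k_out im)).
have mcg : measurable_fun T cg.
  exact: (continuous_measurable_plane (conv_continuous dk k_out im2)).
have mcr : measurable_fun T cr.
  exact: (continuous_measurable_plane (conv_continuous dk k_out ir)).
have e6 (t : R) : 0 <= t ^+ 6 by rewrite (exprM t 3 2) sqr_ge0.
have B6 : int_le B (fun w => cm w ^+ 6) M6.
  apply: le_trans m6; apply: (conv_integral_le mk mB im (phi := fun t => t ^+ 6) (slope := fun t => 6 * t ^+ 5)) => //.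
  - exact: pow6_tangent.
have Bg : int_le B (fun w => `|cg w| ^+ 3) M6.
  apply: (@le_trans _ _ (\int[leb2]_y (`|g y| ^+ 3)%:E)%E).
    apply: (conv_integral_le mk mB im2 (phi := fun t => `|t| ^+ 3) (slope := fun t => 3 * `|t| * t)).
    - by apply: measurable_funX; exact: normr_measurable.
    - by move=> t; rewrite exprn_ge0.
    - exact: norm_cube_tangent.
  apply: le_trans m6; rewrite le_eqVlt; apply/orP; left; apply/eqP.
  by apply: eq_integral => w _; rewrite ger0_norm ?sqr_ge0// -exprM.
have Bm : int_le B (fun w => f w ^+ 6) M6.
  apply: le_trans m6; apply: ge0_subset_integral => //.
  - by apply/measurable_EFinP; exact: measurable_funX.
  - by move=> w _; rewrite lee_fin.
have Br : int_le B (fun w => cr w ^+ 2) rho.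
  apply: le_trans r2; apply: (conv_integral_le mk mB ir (phi := fun t => t ^+ 2) (slope := fun t => 2 * t)) => //.
  - by move=> t; exact: sqr_ge0.
  - exact: sqr_tangent.
have L1 : int_le B (fun w => `|f w - cm w|) eta.
  by apply: le_trans H1; rewrite /L1dist; under eq_integral do rewrite distrC.
have L2 : int_le B (fun w => `|cg w - f w ^+ 2|) eta by exact: H2.
have mN (p : plane R -> R) : measurable_fun T p -> measurable_fun T (fun w => `|p w|).
  by move=> mp; apply: (measurableT_comp _ mp); exact: normr_measurable.
exists v; split.
- apply: (int_le_le mB _ _ _ _ B6) => //.
  + by apply: measurable_funX; exact: (continuous_measurable_plane (@pot_x_cont R v)).
  + exact: measurable_funX.
  + by move=> w Bw; rewrite vx.
- have mres : measurable_fun T (residue v).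
    apply: measurable_funB; first exact: (continuous_measurable_plane (@pot_z_cont R v)).
    apply: measurable_funM => //; apply: measurable_funX.
    exact: (continuous_measurable_plane (@pot_x_cont R v)).
  pose F w := del * (1 + 68 * f w ^+ 6 + 64 * cm w ^+ 6 + 4 * `|cg w| ^+ 3) +
     del ^- 4 * (`|cg w - f w ^+ 2| + `|f w - cm w|).
  have d4p : 0 <= del ^- 4 by rewrite invr_ge0 ltW.
  have m1 : measurable_fun T (fun w => 68 * f w ^+ 6) by apply: measurable_funM => //; exact: measurable_funX.
  have m2 : measurable_fun T (fun w => 64 * cm w ^+ 6) by apply: measurable_funM => //; exact: measurable_funX.
  have m3 : measurable_fun T (fun w => 4 * `|cg w| ^+ 3).
    by apply: measurable_funM => //; apply: measurable_funX; exact: mN.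
  have m4 : measurable_fun T (fun w => `|cg w - f w ^+ 2|).
    by apply: mN; apply: measurable_funB => //; exact: measurable_funX.
  have m5 : measurable_fun T (fun w => `|f w - cm w|) by apply: mN; exact: measurable_funB.
  have m01 : measurable_fun T (fun w => 1 + 68 * f w ^+ 6) by exact: measurable_funD.
  have m02 : measurable_fun T (fun w => 1 + 68 * f w ^+ 6 + 64 * cm w ^+ 6) by exact: measurable_funD.
  have m03 : measurable_fun T (fun w => 1 + 68 * f w ^+ 6 + 64 * cm w ^+ 6 + 4 * `|cg w| ^+ 3).
    exact: measurable_funD.
  have m45 : measurable_fun T (fun w => `|cg w - f w ^+ 2| + `|f w - cm w|) by exact: measurable_funD.
  have p1 w : 0 <= 68 * f w ^+ 6 by rewrite mulr_ge0.
  have p2 w : 0 <= 64 * cm w ^+ 6 by rewrite mulr_ge0.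
  have p3 w : 0 <= 4 * `|cg w| ^+ 3 by rewrite mulr_ge0// exprn_ge0.
  have p01 w : 0 <= 1 + 68 * f w ^+ 6 by rewrite addr_ge0.
  have p02 w : 0 <= 1 + 68 * f w ^+ 6 + 64 * cm w ^+ 6 by rewrite addr_ge0.
  have p03 w : 0 <= 1 + 68 * f w ^+ 6 + 64 * cm w ^+ 6 + 4 * `|cg w| ^+ 3 by rewrite addr_ge0.
  have mF : measurable_fun T F by apply: measurable_funD; exact: measurable_funM.
  have F0 w : 0 <= F w by rewrite addr_ge0// mulr_ge0 ?(ltW del0) ?addr_ge0.
  have FB : int_le B F tau.
    apply: (@int_le_trans _ _ _ (del * (1 * A + 68 * M6 + 64 * M6 + 4 * M6) +
       del ^- 4 * (eta + eta))).
      apply: int_leD => //; first exact: measurable_funM.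
      - exact: measurable_funM.
      - by move=> w; rewrite mulr_ge0// ltW.
      - by move=> w; rewrite mulr_ge0// addr_ge0.
      - apply: int_leZ => //; first exact: ltW.
        apply: int_leD => //; last by apply: int_leZ => //; apply: measurable_funX; exact: mN.
        apply: int_leD => //; last by apply: int_leZ => //; exact: measurable_funX.
        apply: int_leD => //; last by apply: int_leZ => //; exact: measurable_funX.
        exact: int_le_cst.
      - apply: int_leZ => //; exact: int_leD.
    rewrite (mulrDr (del ^- 4)) etaE; move: delN; rewrite /N; lra.
  have hF : int_le B (fun w => 2 * cr w ^+ 2 + F w) (2 * rho + tau).
    apply: int_leD => //.
    - by apply: measurable_funM => //; exact: measurable_funX.
    - by move=> w; rewrite mulr_ge0 ?sqr_ge0.
    - apply: int_leZ => //; first exact: measurable_funX.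
      by move=> w; exact: sqr_ge0.
  apply: (int_le_le mB _ _ _ _ hF) => //.
  + exact: measurable_funX.
  + apply: measurable_funD => //; apply: measurable_funM => //; exact: measurable_funX.
  + by move=> w; exact: sqr_ge0.
  + by move=> w Bw; rewrite vr//; exact: residue_moll_le.
- apply: (@le_trans _ _ (\int[leb2]_(w in B) (conv k 0 0 (X \_ Omega) w ^+ 2)%:E)%E).
    rewrite le_eqVlt; apply/orP; left; apply/eqP.
    by apply: eq_integral => w /set_mem Bw; rewrite vxx.
  apply: le_trans X2; apply: (conv_integral_le mk mB iX (phi := fun t => t ^+ 2) (slope := fun t => 2 * t)) => //.
  + by move=> t; exact: sqr_ge0.
  + exact: sqr_tangent.
- pose F w := del * (32 * (f w ^+ 6 + cm w ^+ 6)) + del ^- 4 * `|f w - cm w|.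
  have d4p : 0 <= del ^- 4 by rewrite invr_ge0 ltW.
  have m0 : measurable_fun T (fun w => f w ^+ 6 + cm w ^+ 6).
    by apply: measurable_funD => //; exact: measurable_funX.
  have m1 : measurable_fun T (fun w => 32 * (f w ^+ 6 + cm w ^+ 6)) by exact: measurable_funM.
  have m5 : measurable_fun T (fun w => `|f w - cm w|) by apply: mN; exact: measurable_funB.
  have p0 w : 0 <= f w ^+ 6 + cm w ^+ 6 by rewrite addr_ge0.
  have p1 w : 0 <= 32 * (f w ^+ 6 + cm w ^+ 6) by rewrite mulr_ge0.
  have FB : int_le B F tau.
    apply: (@int_le_trans _ _ _ (del * (32 * (M6 + M6)) + del ^- 4 * eta)).
      apply: int_leD => //; first exact: measurable_funM.
      - exact: measurable_funM.
      - by move=> w; rewrite mulr_ge0// ltW.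
      - by move=> w; rewrite mulr_ge0.
      - apply: int_leZ => //; first exact: ltW.
        apply: int_leZ => //; apply: int_leD => //; exact: measurable_funX.
      - exact: int_leZ.
    have : 0 <= del * M6 by rewrite mulr_ge0// ltW.
    have : 0 <= del * A by rewrite mulr_ge0// ltW.
    rewrite etaE; move: delN; rewrite /N; lra.
  apply: (int_le_le mB _ _ _ _ FB) => //.
  + apply: measurable_funX; apply: measurable_funB => //.
    exact: (continuous_measurable_plane (@pot_x_cont R v)).
  + by apply: measurable_funD; exact: measurable_funM.
  + by move=> w; rewrite (exprM _ 2 2) sqr_ge0.
  + by move=> w Bw; rewrite vx//; exact: dist4_le.
Qed.

End smooth_approximation.

(** * Total boundedness in L^4_loc and L^q *)

Definition int_coverable (R : realType) (D : set (plane R))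
    (F : nat -> nat -> plane R -> R) : Prop :=
  forall delta : R, 0 < delta -> exists (K : finType) (c : nat -> K),
    forall i j, c i = c j -> int_le D (F i j) delta.

Section local_compactness.
Context {R : realType}.
Variables (Omega : set (plane R)) (u m q X : nat -> plane R -> R).
Variables (eps : nat -> R) (M6 K : R).
Local Notation T := [set: plane R].
Hypotheses (um : forall n, is_wderiv Omega e_x (u n) (m n))
  (uq : forall n, is_wderiv Omega e_z (u n) (q n))
  (mX : forall n, is_wderiv Omega e_x (m n) (X n)).
Hypotheses (iu : forall n, leb2.-integrable T (EFin \o (u n \_ Omega)))
  (im : forall n, leb2.-integrable T (EFin \o (m n \_ Omega)))
  (im2 : forall n, leb2.-integrable T (EFin \o (fun w => (m n \_ Omega) w ^+ 2)))
  (iq : forall n, leb2.-integrable T (EFin \o (q n \_ Omega)))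
  (iX : forall n, leb2.-integrable T (EFin \o (X n \_ Omega))).
Hypotheses (eps0 : forall n, 0 < eps n) (epsle : forall n, eps n <= eps 0%N)
  (epscvg : eps @ \oo --> (0 : R)) (K0 : 0 <= K).
Hypotheses (m6 : forall n, int_le T (fun w => (m n \_ Omega) w ^+ 6) M6)
  (r2 : forall n, int_le T
    (fun w => ((q n \_ Omega) w - 2^-1 * (m n \_ Omega) w ^+ 2) ^+ 2) (K * eps n))
  (X2 : forall n, int_le T (fun w => (X n \_ Omega) w ^+ 2) (K / eps n)).

Lemma pow4_add3 (x y z : R) : (x + y + z) ^+ 4 <= 27 * (x ^+ 4 + y ^+ 4 + z ^+ 4).
Proof.
have h (a b c : R) : (a + b + c) ^+ 2 <= 3 * (a ^+ 2 + b ^+ 2 + c ^+ 2).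
  rewrite -subr_ge0 (_ : _ - _ = (a - b) ^+ 2 + (b - c) ^+ 2 + (a - c) ^+ 2); last by ring.
  by rewrite !addr_ge0 ?sqr_ge0.
have := h (x ^+ 2) (y ^+ 2) (z ^+ 2); rewrite -(exprM x 2 2) -(exprM y 2 2) -(exprM z 2 2)/=.
have : ((x + y + z) ^+ 2) ^+ 2 <= (3 * (x ^+ 2 + y ^+ 2 + z ^+ 2)) ^+ 2.
  by apply: lerXn2r; rewrite ?nnegrE ?sqr_ge0// mulr_ge0// !addr_ge0 ?sqr_ge0.
rewrite (exprMn _ 3 (x ^+ 2 + _ + _)) -(exprM (x + y + z) 2 2)/=.
rewrite (_ : (2 * 2)%N = 4%N)// (_ : 3 ^+ 2 = 9); last by ring.
by move: ((x ^+ 2 + _ + _) ^+ 2) => S; lra.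
Qed.

(** Every [m n] is within [eta], in integrated fourth power, of the derivative of a smooth
    potential, so two indices are compared through their potentials by a three-term split of
    [m i - m j]. *)
Lemma local_coverable (a b c d h0 delta : R) : 0 < h0 -> 0 < delta ->
  b - a = delta ^+ 2 -> d - c = delta ^+ 4 ->
  (forall w, box a b c d w ->
    box (w.1 - h0) (w.1 + h0) (w.2 - h0) (w.2 + h0) `<=` Omega) ->
  int_coverable (box a b c d) (fun i j w =>
    `|cutoff a b c d w| * ((m i \_ Omega) w - (m j \_ Omega) w) ^+ 4).
Proof.
move=> h00 d0 ba dc margin tau tau0.
have ab : a <= b by rewrite -subr_ge0 ba exprn_ge0// ltW.
have cd : c <= d by rewrite -subr_ge0 dc exprn_ge0// ltW.
have K0' := K0; set B := box a b c d.
have mB : measurable (B : set (plane R)) by exact: measurable_box.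
have [L L0 HL] := cutoff_bounded a b c d.
pose L1 : R := L + 1.
have L10 : 0 < L1 by rewrite /L1; lra.
(* 27 is the constant of [pow4_add3]: the two approximation errors contribute
   [27 * L1 * 2 * eta = tau / 2], and the potentials, coloured at level [tau / 54], the other
   half. *)
pose eta : R := tau / (108 * L1).
have eta0 : 0 < eta by rewrite divr_gt0// mulr_gt0.
(* The bound by [eps n] keeps the residue of the approximating potential of order [eps n], as
   [smooth_coverable] requires; the bound by [eta] makes the approximation good. *)
pose t n : R := Num.min (eps n) eta.
have t0 n : 0 < t n by rewrite lt_min eps0.
have /choice [v Hv] : forall n, exists v : potential R,
    [/\ int_le B (fun w => pot_x v w ^+ 6) M6,
      int_le B (fun w => residue v w ^+ 2) (2 * (K * eps n) + t n),
      int_le B (fun w => pot_xx v w ^+ 2) (K / eps n)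
    & int_le B (fun w => ((m n \_ Omega) w - pot_x v w) ^+ 4) (t n)].
  move=> n; exact: (mollified_potential ab cd h00 margin (um n) (uq n) (mX n)).
have RB (F : R * R -> R) x : continuous F -> int_le B F x -> \int[leb2]_(w in B) F w <= x.
  by move=> cF; rewrite /int_le (EFin_Rintegral_box _ _ _ _ cF) lee_fin.
have BR (F : R * R -> R) x : continuous F -> \int[leb2]_(w in B) F w <= x -> int_le B F x.
  by move=> cF; rewrite /int_le (EFin_Rintegral_box _ _ _ _ cF) lee_fin.
pose K2 : R := 2 * K + 1.
have M60 : 0 <= M6.
  rewrite -lee_fin; apply: le_trans (m6 0%N); apply: integral_ge0 => w _.
  by rewrite lee_fin (exprM _ 3 2) sqr_ge0.
pose M : R := M6 + K2 + K.
have M0 : 0 <= M by rewrite /M /K2; lra.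
have res n : \int[leb2]_(w in B) residue (v n) w ^+ 2 <= K2 * eps n.
  have [_ h _ _] := Hv n; apply: (@le_trans _ _ (2 * (K * eps n) + t n)).
    by apply: RB => //; continuity.
  have : t n <= eps n by rewrite ge_min lexx.
  by rewrite /K2; lra.
have Keps : (fun n => K2 * eps n) @ \oo --> (0 : R).
  by rewrite -(mulr0 K2); apply: cvgM => //; exact: cvg_cst.
have Keps0 n : K2 * eps n <= K2 * eps 0%N by rewrite ler_wpM2l// /K2; lra.
have p6 n : \int[leb2]_(w in B) pot_x (v n) w ^+ 6 <= M.
  have [h _ _ _] := Hv n; apply: (@le_trans _ _ M6); first by apply: RB => //; continuity.
  by rewrite /M /K2; lra.
have pr n : \int[leb2]_(w in B) `|pot_xx (v n) w * residue (v n) w| <= M.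
  have [_ _ hX _] := Hv n.
  have e0 := eps0 n.
  (* Young's inequality with weight [eps n]: the residue is of order [eps n] and [pot_xx ^+ 2] of
     order [1 / eps n] in mean, so both terms stay bounded in [n]. *)
  apply: (@le_trans _ _ (\int[leb2]_(w in B)
     ((eps n)^-1 * residue (v n) w ^+ 2 + eps n * pot_xx (v n) w ^+ 2))).
    apply: le_Rintegral_box; [continuity|continuity|move=> w _].
    rewrite normrM -(real_normK (num_real (residue _ _))) -(real_normK (num_real (pot_xx _ _))).
    have := mulr_ge0 (normr_ge0 (pot_xx (v n) w)) (normr_ge0 (residue (v n) w)).
    move: `|pot_xx _ _| `|residue _ _| => /= x y xy.
    have := mulr_ge0 (ltW e0) (sqr_ge0 ((eps n)^-1 * y - x)).
    have -> : eps n * ((eps n)^-1 * y - x) ^+ 2 = (eps n)^-1 * y ^+ 2 + eps n * x ^+ 2 - 2 * (x * y).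
      by field; rewrite gt_eqF.
    by lra.
  rewrite Rintegral_boxD; [|continuity|continuity].
  rewrite !Rintegral_boxZ; [|continuity|continuity].
  have hx : \int[leb2]_(w in B) pot_xx (v n) w ^+ 2 <= K / eps n by apply: RB => //; continuity.
  have h1 : eps n * \int[leb2]_(w in B) pot_xx (v n) w ^+ 2 <= K.
    by rewrite mulrC -ler_pdivlMr.
  have h2 : (eps n)^-1 * \int[leb2]_(w in B) residue (v n) w ^+ 2 <= K2.
    by rewrite mulrC ler_pdivrMr.
  by rewrite /M; lra.
have tau4 : 0 < tau / 54 by rewrite divr_gt0.
have [F [col Hcol]] := smooth_coverable d0 ba dc M0 Keps Keps0 p6 res pr tau4.
exists F, col => i j /Hcol hij.
have mT n : measurable_fun T (m n \_ Omega).
  by apply/measurable_EFinP; exact: measurable_int (im n).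
have mp n : measurable_fun T (pot_x (v n) : plane R -> R).
  exact: (continuous_measurable_plane (@pot_x_cont R (v n))).
have e4 (x : R) : 0 <= x ^+ 4 by rewrite (exprM x 2 2) sqr_ge0.
have cc : continuous (cutoff a b c d) by rewrite /cutoff; continuity.
have mc : measurable_fun T (fun w => `|cutoff a b c d w|).
  apply: measurableT_comp; first exact: normr_measurable.
  exact: (continuous_measurable_plane cc).
pose D n w := ((m n \_ Omega) w - pot_x (v n) w) ^+ 4.
have mD n : measurable_fun T (D n) by apply: measurable_funX; exact: measurable_funB.
pose E w := `|cutoff a b c d w| * (pot_x (v i) w - pot_x (v j) w) ^+ 4.
have mE : measurable_fun T E.
  by apply: measurable_funM => //; apply: measurable_funX; exact: measurable_funB.
have E0 w : 0 <= E w by rewrite mulr_ge0.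
have hE : int_le B E (tau / 54).
  rewrite /int_le.
  have -> : (\int[leb2]_(w in B) (E w)%:E = \int[leb2]_(w in B)
     (cutoff a b c d w * (pot_x (v i) w - pot_x (v j) w) ^+ 4)%:E)%E.
    apply: eq_integral => w /set_mem[]; rewrite /= !in_itv/= => /andP[w1 w2] /andP[w3 w4].
    rewrite /E ger0_norm// /cutoff; apply: mulr_ge0; apply: mulr_ge0; by rewrite subr_ge0.
  by apply: BR hij; rewrite /cutoff; continuity.
have hD n : int_le B (D n) eta.
  have [_ _ _ h] := Hv n; apply: (int_le_trans h); by rewrite ge_min lexx orbT.
pose G w := 27 * (L1 * (D i w + D j w) + E w).
have mDD : measurable_fun T (fun w => D i w + D j w) by exact: measurable_funD.
have mLD : measurable_fun T (fun w => L1 * (D i w + D j w)) by exact: measurable_funM.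
have mLE : measurable_fun T (fun w => L1 * (D i w + D j w) + E w) by exact: measurable_funD.
have DD0 w : 0 <= D i w + D j w by rewrite addr_ge0 ?e4.
have LD0 w : 0 <= L1 * (D i w + D j w) by rewrite mulr_ge0// ltW.
have hG : int_le B G tau.
  apply: (@int_le_trans _ _ _ (27 * (L1 * (eta + eta) + tau / 54))); last first.
    by rewrite le_eqVlt /eta; apply/orP; left; apply/eqP; field; rewrite gt_eqF.
  apply: int_leZ => //.
    by move=> w; rewrite addr_ge0.
  apply: int_leD => //; apply: int_leZ => //; first exact: ltW.
  by apply: int_leD => // w; exact: e4.
apply: (int_le_le mB _ _ _ _ hG).
- by apply: measurable_funM => //; apply: measurable_funX; exact: measurable_funB.
- exact: measurable_funM.
- by move=> w; rewrite mulr_ge0.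
- move=> w Bw; rewrite /G /E /D.
  have [hc _ _] := HL w Bw.
  set x := (m i \_ Omega) w; set y := (m j \_ Omega) w.
  set x' := pot_x (v i) w; set y' := pot_x (v j) w; set p := `|cutoff _ _ _ _ _|.
  have pL : p <= L1 by rewrite /L1; apply: (le_trans hc); lra.
  have := ler_wpM2l (normr_ge0 (cutoff a b c d w)) (pow4_add3 (x - x') (x' - y') (y' - y)).
  rewrite -/p (_ : x - x' + (x' - y') + (y' - y) = x - y); last by ring.
  rewrite (_ : (y' - y) ^+ 4 = (y - y') ^+ 4); last by ring.
  have h1 := ler_wpM2r (e4 (x - x')) pL; have h2 := ler_wpM2r (e4 (y - y')) pL.
  by move=> h; apply: (le_trans h); lra.
Qed.

End local_compactness.

(** * From boxes inside [Omega] to all of [Omega] *)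

Section coverable.
Context {R : realType} (D : set (plane R)).
Hypothesis mD : measurable D.
Local Notation T := [set: plane R].
Implicit Types (F : nat -> nat -> plane R -> R).

Lemma int_coverable_sum (G : nat -> nat -> nat -> plane R -> R) N :
  (forall n i j, measurable_fun T (G n i j)) -> (forall n i j w, 0 <= G n i j w) ->
  (forall n, int_coverable D (G n)) ->
  int_coverable D (fun i j w => \sum_(n < N) G n i j w).
Proof.
move=> mG G0 cG; elim: N => [|N IH] delta delta0.
  exists unit, (fun=> tt) => i j _; rewrite /int_le integral0_eq ?lee_fin ?ltW//.
  by move=> w _; rewrite big_ord0.
have delta2 : 0 < delta / 2 by rewrite divr_gt0.
have [K [c Hc]] := IH _ delta2; have [K' [c' Hc']] := cG N _ delta2.
exists (K * K')%type, (fun n => (c n, c' n)) => i j [/Hc h /Hc' h'].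
have -> : (fun w => \sum_(n < N.+1) G n i j w) =
    (fun w => \sum_(n < N) G n i j w + G N i j w).
  by apply/funext => w; rewrite big_ord_recr.
rewrite (_ : delta = delta / 2 + delta / 2); last by lra.
apply: int_leD => //.
- exact: measurable_sum.
- by move=> w; rewrite sumr_ge0.
Qed.

End coverable.

Section patching.
Context {R : realType} (Omega : set (plane R)).
Local Notation T := [set: plane R].
Hypotheses (mOmega : measurable Omega) (fOmega : (leb2 Omega < +oo)%E).
Variables (chi : nat -> plane R -> R) (F : nat -> nat -> plane R -> R).
Hypotheses (mchi : forall n, measurable_fun T (chi n)) (chi0 : forall n w, 0 <= chi n w).
Hypotheses (mF : forall i j, measurable_fun T (F i j)) (F0 : forall i j w, 0 <= F i j w).
Hypothesis chiF : forall n, int_coverable Omega (fun i j w => chi n w * F i j w).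
Hypothesis chi_gt0 : forall w, Omega w -> exists n, 0 < chi n w.

Let S N w := N%:R * \sum_(n < N) chi n w.

Let mS N : measurable_fun T (S N).
Proof. by apply: measurable_funM => //; exact: measurable_sum. Qed.

Let S0 N w : 0 <= S N w. Proof. by rewrite mulr_ge0// sumr_ge0. Qed.

Let S_homo w N M : (N <= M)%N -> S N w <= S M w.
Proof.
move=> NM; rewrite /S; apply: ler_pM => //; first by rewrite sumr_ge0.
  by rewrite ler_nat.
by rewrite -(subnKC NM) big_split_ord/= lerDl sumr_ge0.
Qed.

(** The weights have no positive lower bound on [Omega], but [S N], thanks to its factor [N],
    exceeds 1 at every point eventually. Where it does, [F] is at most [N] times a finite weighted
    sum, which is coverable. The remaining set has small measure, and there the truncation by 1
    suffices. *)
Lemma truncated_coverable : int_coverable Omega (fun i j w => Num.min 1 (F i j w)).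
Proof.
move=> delta delta0; have delta2 : 0 < delta / 2 by rewrite divr_gt0.
pose H N : set (plane R) := Omega `&` [set w | S N w <= 1].
have mH N : measurable (H N).
  apply: measurableI => //; rewrite -[X in measurable X]setTI.
  rewrite (_ : [set w | S N w <= 1] = S N @^-1` `]-oo, 1]%classic).
    exact: mS.
  by apply/seteqP; split => w /=; rewrite in_itv/=.
have H0 : \bigcap_N H N = set0.
  apply/seteqP; split => // w Hw.
  have Ow : Omega w by have [] := Hw 0%N I.
  have [n cn] := chi_gt0 Ow.
  pose k := (Num.truncn (chi n w)^-1).+1.
  have hk : (chi n w)^-1 < k%:R by exact: Num.Theory.truncnS_gt.
  have [_ /=] := Hw (maxn n.+1 k) I; apply/negP; rewrite -ltNge.
  have nm : (n < maxn n.+1 k)%N by rewrite leq_max ltnSn.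
  apply: (@lt_le_trans _ _ (k%:R * chi n w)); first by rewrite -ltr_pdivrMr// mul1r.
  rewrite /S; apply: ler_pM => //; first by rewrite ler_nat leq_maxr.
  by rewrite (bigD1 (Ordinal nm))//= lerDl sumr_ge0.
have : (leb2 \o H) @ \oo --> leb2 (\bigcap_N H N).
  apply: nonincreasing_cvg_mu => //.
  - by apply: (le_lt_trans _ fOmega); apply: le_measure; rewrite ?inE//; exact: subIsetl.
  - by rewrite H0.
  - move=> N M NM; apply/subsetPset => w [Ow h]; split => //=.
    exact: le_trans (S_homo w NM) h.
rewrite H0 measure0 => /cvge0_exists_le/(_ delta2)[N hN].
pose eta := delta / 2 / (N%:R + 1).
have N1 : 0 < N%:R + 1 :> R by rewrite ltr_wpDl.
have eta0 : 0 < eta by rewrite divr_gt0.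
have mG n i j : measurable_fun T (fun w => chi n w * F i j w) by exact: measurable_funM.
have G0 n i j w : 0 <= chi n w * F i j w by rewrite mulr_ge0.
have [K [c Hc]] := @int_coverable_sum _ _ mOmega (fun n i j w => chi n w * F i j w) N
  mG G0 chiF eta eta0.
exists K, c => i j /Hc h.
have m1 : measurable_fun T (fun w => \1_(H N) w : R) by exact: measurable_indic.
have m2 : measurable_fun T (fun w => \sum_(n < N) chi n w * F i j w).
  by apply: measurable_sum => n; exact: measurable_funM.
have m3 : measurable_fun T (fun w => N%:R * \sum_(n < N) chi n w * F i j w) by exact: measurable_funM.
have s0 w : 0 <= \sum_(n < N) chi n w * F i j w.
  by apply: sumr_ge0 => n _; rewrite mulr_ge0.
have hG : int_le Omega (fun w => \1_(H N) w + N%:R * \sum_(n < N) chi n w * F i j w) delta.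
  apply: (@int_le_trans _ _ _ (delta / 2 + N%:R * eta)).
    apply: int_leD => //.
    - by move=> w; rewrite mulr_ge0.
    - rewrite /int_le integral_indic// (_ : H N `&` Omega = H N)//.
      by apply: setIidl; exact: subIsetl.
    - exact: int_leZ.
  rewrite [leRHS](_ : _ = delta / 2 + (N%:R + 1) * eta); last first.
    by rewrite /eta; field; rewrite gt_eqF.
  by rewrite lerD2l ler_wpM2r// ?(ltW eta0)// lerDl.
apply: (int_le_le mOmega _ _ _ _ hG).
- exact: measurable_minr.
- exact: measurable_funD.
- by move=> w; rewrite le_min ler01 F0.
- move=> w Ow; rewrite -mulr_suml mulrA -/(S N w) indicE.
  have [hS|hS] := leP (S N w) 1.
    rewrite mem_set//= ?mulr1n.
    by apply: (@le_trans _ _ 1); rewrite ?ge_min ?lexx// lerDl mulr_ge0.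
  rewrite memNset ?mulr0n ?add0r.
    by rewrite ge_min; apply/orP; right; rewrite ler_peMl// ltW.
  by move=> [_ /=]; rewrite leNgt hS.
Qed.

End patching.

Section globalization.
Context {R : realType} (Omega : set (plane R)).
Local Notation T := [set: plane R].
Hypotheses (oOmega : open Omega) (mOmega : measurable Omega) (fOmega : (leb2 Omega < +oo)%E).
Variable F : nat -> nat -> plane R -> R.
Hypotheses (mF : forall i j, measurable_fun T (F i j)) (F0 : forall i j w, 0 <= F i j w).
Hypothesis local : forall a b c d h0 delta : R, 0 < h0 -> 0 < delta ->
  b - a = delta ^+ 2 -> d - c = delta ^+ 4 ->
  (forall w, box a b c d w ->
    box (w.1 - h0) (w.1 + h0) (w.2 - h0) (w.2 + h0) `<=` Omega) ->
  int_coverable (box a b c d) (fun i j w => `|cutoff a b c d w| * F i j w).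

Let side (k : nat) : R := k.+1%:R^-1.
Let cell (t : rat * rat * nat) : set (R * R) :=
  box (ratr t.1.1) (ratr t.1.1 + side t.2 ^+ 2) (ratr t.1.2) (ratr t.1.2 + side t.2 ^+ 4).
Let weight (t : rat * rat * nat) : R * R -> R :=
  cutoff (ratr t.1.1) (ratr t.1.1 + side t.2 ^+ 2) (ratr t.1.2) (ratr t.1.2 + side t.2 ^+ 4).
Let good (t : rat * rat * nat) := exists2 h0 : R, 0 < h0 & forall w, cell t w ->
    box (w.1 - h0) (w.1 + h0) (w.2 - h0) (w.2 + h0) `<=` Omega.
(** Countably many cells, with rational corner and side parameter [1 / (k + 1)], enumerated by
    [pickle]. Codes of no cell, and cells without a margin inside [Omega], get weight 0 so that the
    family is indexed by all of [nat]. *)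
Let chi (n : nat) (w : plane R) : R :=
  if unpickle n is Some t then
    if `[< good t >] then `|weight t w| * \1_(cell t) w else 0
  else 0.

Let mcell t : measurable (cell t : set (plane R)). Proof. exact: measurable_box. Qed.

Let mweight t : measurable_fun T (fun w => `|weight t w|).
Proof.
apply: measurableT_comp; first exact: normr_measurable.
by apply: continuous_measurable_plane; rewrite /weight /cutoff; continuity.
Qed.

Let mchi n : measurable_fun T (chi n).
Proof.
rewrite /chi; case: unpickle => [t|]; last exact: measurable_cst.
case: asboolP => _; last exact: measurable_cst.
by apply: measurable_funM => //; exact: measurable_indic.
Qed.

Let chi0 n w : 0 <= chi n w.
Proof.
rewrite /chi; case: unpickle => // t; by case: asboolP => // _; rewrite mulr_ge0.
Qed.

Let zero_coverable : int_coverable Omega (fun i j w => 0 * F i j w).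
Proof.
move=> delta delta0; exists unit, (fun=> tt) => i j _; rewrite /int_le.
by rewrite integral0_eq ?lee_fin ?ltW// => w _; rewrite mul0r.
Qed.

Let chiF n : int_coverable Omega (fun i j w => chi n w * F i j w).
Proof.
rewrite /chi; case: unpickle => [t|]; last exact: zero_coverable.
case: asboolP => [[h0 h00 H]|_]; last exact: zero_coverable.
move=> delta delta0.
have s0 : 0 < side t.2 by rewrite invr_gt0 ltr0n.
have e1 (x y : R) : x + y - x = y by lra.
have [K [c Hc]] := local h00 s0 (e1 _ _) (e1 _ _) H delta0.
exists K, c => i j /Hc h; apply: le_trans h.
have -> : (\int[leb2]_(w in Omega) (`|weight t w| * \1_(cell t) w * F i j w)%:E =
    \int[leb2]_(w in Omega `&` cell t) (`|weight t w| * F i j w)%:E)%E.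
  rewrite integral_mkcondr; apply: eq_integral => w _; rewrite patchE indicE.
  by case: (w \in cell t); rewrite ?mulr1// mulr0 mul0r.
apply: ge0_subset_integral => //.
- exact: measurableI.
- exact: mcell.
- by apply/measurable_EFinP; apply: measurable_funTS; exact: measurable_funM.
- by move=> w _; rewrite lee_fin mulr_ge0.
Qed.

Let chi_gt0 w : Omega w -> exists n, 0 < chi n w.
Proof.
move=> Ow.
have [r r0 Hr] : exists2 r : R, 0 < r & forall y : R * R, `|y.1 - w.1| <= r ->
    `|y.2 - w.2| <= r -> Omega y.
  have /nbhs_ballP[e /= e0 He] := open_nbhs_nbhs (conj oOmega Ow).
  exists (e / 2); first by rewrite divr_gt0.
  move=> y h1 h2; apply: He; split; rewrite /ball/= distrC.
    by apply: (le_lt_trans h1); lra.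
  by apply: (le_lt_trans h2); lra.
have [k hk] : exists k : nat, side k <= Num.min 1 (r / 2).
  have m0 : 0 < Num.min 1 (r / 2) by rewrite lt_min ltr01 divr_gt0.
  exists (Num.truncn (Num.min 1 (r / 2))^-1).
  rewrite /side invf_ple ?posrE// ltW//; exact: Num.Theory.truncnS_gt.
have s0 : 0 < side k by rewrite invr_gt0 ltr0n.
have s1 : side k <= 1 by apply: (le_trans hk); rewrite ge_min lexx.
have sr : side k <= r / 2 by apply: (le_trans hk); rewrite ge_min lexx orbT.
have s2 : side k ^+ 2 <= side k by rewrite expr2 ler_piMl// ltW.
have s4 : side k ^+ 4 <= side k.
  by rewrite exprS ler_piMr ?(ltW s0)// exprn_ile1// ltW.
have s20 : 0 < side k ^+ 2 by rewrite exprn_gt0.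
have s40 : 0 < side k ^+ 4 by rewrite exprn_gt0.
(* A corner strictly below and to the left of [w], by less than the sides, puts [w] in the interior
   of the cell, where the weight is positive. The sides and the margin are each at most [r / 2]. *)
have h1 : w.1 - side k ^+ 2 < w.1 by lra.
have h2 : w.2 - side k ^+ 4 < w.2 by lra.
have [x1 /[!in_itv]/= /andP[x11 x12]] := rat_in_itvoo h1.
have [x2 /[!in_itv]/= /andP[x21 x22]] := rat_in_itvoo h2.
exists (pickle (x1, x2, k)); rewrite /chi pickleK.
have cw : cell (x1, x2, k) w.
  by split => /=; rewrite in_itv/=; apply/andP; split; lra.
have gt : good (x1, x2, k).
  exists (r / 2) => [|y [/=]]; first by rewrite divr_gt0.
  rewrite !in_itv/= => /andP[y1 y2] /andP[y3 y4] z [/=].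
  rewrite !in_itv/= => /andP[z1 z2] /andP[z3 z4].
  by apply: Hr; rewrite ler_norml; apply/andP; split; lra.
rewrite asboolT// indicE mem_set// mulr1 normr_gt0 gt_eqF// /weight /cutoff/=.
by rewrite !mulr_gt0//; lra.
Qed.

Lemma global_coverable : int_coverable Omega (fun i j w => Num.min 1 (F i j w)).
Proof. exact: truncated_coverable mchi chi0 mF F0 chiF chi_gt0. Qed.

End globalization.

(** * From truncated differences to L^q *)

Section powers.
Context {R : realType}.
Implicit Types (t p q : R).

(** Three regimes: below [s] one has [t^q <= t <= alpha]; above [M] the power [p] dominates, with
    [M] chosen so that [M^(p - q) = 1 / alpha]; in between, [min 1 (t ^+ 4)] is at least [s ^+ 4]
    and [t^q] at most [M^q]. *)
Lemma interpolate_powR p q (alpha : R) : 1 <= q -> q < p -> 0 < alpha ->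
  exists2 C : R, 0 <= C & forall t, 0 <= t ->
    t `^ q <= alpha * (1 + t `^ p) + C * Num.min 1 (t ^+ 4).
Proof.
move=> q1 qp a0; have q0 : 0 < q by apply: lt_le_trans q1.
pose s : R := Num.min 1 alpha.
have s0 : 0 < s by rewrite lt_min ltr01.
have s1 : s <= 1 by rewrite ge_min lexx.
have sa : s <= alpha by rewrite ge_min lexx orbT.
pose M : R := (alpha^-1) `^ ((p - q)^-1).
have pq0 : 0 < p - q by rewrite subr_gt0.
have M0 : 0 < M by rewrite powR_gt0// invr_gt0.
have MpE : M `^ (p - q) = alpha^-1.
  by rewrite /M -powRrM mulVf ?gt_eqF// powRr1// invr_ge0 ltW.
have s40 : 0 < s ^+ 4 by rewrite exprn_gt0.
pose C := M `^ q / s ^+ 4.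
have C0 : 0 <= C by rewrite divr_ge0 ?powR_ge0// ltW.
exists C => // t t0.
have m0 : 0 <= Num.min 1 (t ^+ 4) by rewrite le_min ler01 exprn_ge0.
have Cm0 := mulr_ge0 C0 m0.
have tp0 : 0 <= alpha * t `^ p by rewrite mulr_ge0 ?powR_ge0// ltW.
rewrite mulrDr mulr1.
have [ts|st] := leP t s.
  suff : t `^ q <= s by lra.
  apply: (le_trans _ ts); have [->|tn0] := eqVneq t 0; first by rewrite powR0// gt_eqF.
  have tt : 0 < t <= 1 by rewrite lt_neqAle eq_sym tn0 t0/=; lra.
  by rewrite -[leRHS]powRr1//; exact: ger_powR.
have tgt0 : 0 < t by apply: lt_trans st.
have [tM|Mt] := leP t M.
  have : t `^ q <= C * Num.min 1 (t ^+ 4).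
    apply: (@le_trans _ _ (M `^ q)).
      by apply: ge0_ler_powR; rewrite ?nnegrE// ltW.
    rewrite -[leLHS](divfK (x := s ^+ 4)) ?gt_eqF// ler_wpM2l// le_min.
    by rewrite exprn_ile1 ?(ltW s0)//= lerXn2r// ?nnegrE ltW.
  lra.
have : t `^ q <= alpha * t `^ p.
  have -> : t `^ p = t `^ q * t `^ (p - q).
    by rewrite -powRD ?(gt_eqF tgt0)/= ?implybT//; congr (_ `^ _); lra.
  rewrite mulrCA ler_peMr ?powR_ge0// -ler_pdivrMl// mulr1 -MpE.
  by apply: ge0_ler_powR; rewrite ?nnegrE ltW.
lra.
Qed.

Lemma powR_dist (x y p : R) : 0 <= p ->
  `|x - y| `^ p <= 2 `^ p * (`|x| `^ p + `|y| `^ p).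
Proof.
move=> p0; have h : `|x - y| <= 2 * Num.max `|x| `|y|.
  apply: (le_trans (ler_normB _ _)).
  have : `|x| <= Num.max `|x| `|y| by rewrite le_max lexx.
  have : `|y| <= Num.max `|x| `|y| by rewrite le_max lexx orbT.
  by lra.
have M0 : 0 <= Num.max `|x| `|y| by rewrite le_max normr_ge0.
apply: (@le_trans _ _ ((2 * Num.max `|x| `|y|) `^ p)).
  by apply: ge0_ler_powR; rewrite ?nnegrE ?mulr_ge0.
rewrite powRM// ler_wpM2l ?powR_ge0//.
by rewrite maxEle; case: ifP => _; rewrite ?lerDl ?lerDr powR_ge0.
Qed.

Lemma pow6_le_powR t p : 6 < p -> t ^+ 6 <= 1 + `|t| `^ p.
Proof.
move=> p6; rewrite -(norm_even t 3) -powR_mulrn//.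
have [t1|t1] := leP `|t| 1.
  have : `|t| `^ 6 <= 1.
    by rewrite powR_mulrn// exprn_ile1.
  by have := powR_ge0 `|t| p; lra.
have := ler_powR (ltW t1) (ltW p6); lra.
Qed.

End powers.

Section Lq_coverable.
Context {R : realType} (Omega : set (plane R)) (f : nat -> plane R -> R).
Local Notation T := [set: plane R].
Variables (P p : R).
Hypotheses (mOmega : measurable Omega) (fOmega : (leb2 Omega < +oo)%E).
Hypotheses (mf : forall n, measurable_fun T (f n))
  (fP : forall n, int_le Omega (fun w => `|f n w| `^ p) P).
Hypothesis f_cov : int_coverable Omega (fun i j w => Num.min 1 ((f i w - f j w) ^+ 4)).

Lemma Lq_coverable q : 1 <= q -> q < p ->
  int_coverable Omega (fun i j w => `|f i w - f j w| `^ q).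
Proof.
move=> q1 qp delta delta0.
have p0 : 0 <= p by lra.
have P0 : 0 <= P.
  rewrite -lee_fin; apply: le_trans (fP 0%N); apply: integral_ge0 => w _.
  by rewrite lee_fin powR_ge0.
pose A := fine (leb2 Omega).
have hA : leb2 Omega = A%:E by rewrite /A fineK// ge0_fin_numE.
have A0 : 0 <= A by rewrite fine_ge0.
(* An upper bound for the integral of [1 + |f_i - f_j|^p], uniform in the indices; [alpha] and [eta]
   each account for [delta / 2]. *)
pose N := 1 * A + 2 `^ p * (P + P) + 1.
have N0 : 0 < N.
  by rewrite ltr_wpDl// mul1r addr_ge0// mulr_ge0 ?powR_ge0// addr_ge0.
pose alpha := delta / (2 * N).
have a0 : 0 < alpha by rewrite divr_gt0// mulr_gt0.
have [C C0 HC] := interpolate_powR q1 qp a0.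
pose eta := delta / (2 * (C + 1)).
have C1 : 0 < C + 1 by rewrite ltr_wpDl.
have eta0 : 0 < eta by rewrite divr_gt0// mulr_gt0.
have [K [c Hc]] := f_cov eta0.
exists K, c => i j /Hc h.
have mX (g : plane R -> R) r : measurable_fun T g -> measurable_fun T (fun w => `|g w| `^ r).
  move=> mg; apply: (@measurableT_comp _ _ _ _ _ _ (fun x : R => x `^ r)).
    exact: measurable_powR.
  by apply: (measurableT_comp _ mg); exact: normr_measurable.
have mD : measurable_fun T (fun w => f i w - f j w) by exact: measurable_funB.
have mfp n := mX _ p (mf n).
have m1 : measurable_fun T (fun w => `|f i w| `^ p + `|f j w| `^ p) by exact: measurable_funD.
have m2 : measurable_fun T (fun w => 2 `^ p * (`|f i w| `^ p + `|f j w| `^ p)) by exact: measurable_funM.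
have m3 : measurable_fun T (fun w => 1 + 2 `^ p * (`|f i w| `^ p + `|f j w| `^ p)) by exact: measurable_funD.
have m4 : measurable_fun T (fun w => alpha * (1 + 2 `^ p * (`|f i w| `^ p + `|f j w| `^ p))) by exact: measurable_funM.
have m5 : measurable_fun T (fun w => Num.min 1 ((f i w - f j w) ^+ 4)).
  by apply: measurable_minr => //; exact: measurable_funX.
have m6 : measurable_fun T (fun w => C * Num.min 1 ((f i w - f j w) ^+ 4)) by exact: measurable_funM.
have p1 w : 0 <= `|f i w| `^ p + `|f j w| `^ p by rewrite addr_ge0 ?powR_ge0.
have p2 w : 0 <= 2 `^ p * (`|f i w| `^ p + `|f j w| `^ p) by rewrite mulr_ge0 ?powR_ge0.
have p3 w : 0 <= 1 + 2 `^ p * (`|f i w| `^ p + `|f j w| `^ p) by rewrite addr_ge0.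
have p4 w : 0 <= alpha * (1 + 2 `^ p * (`|f i w| `^ p + `|f j w| `^ p)) by rewrite mulr_ge0// ltW.
have p5 w : 0 <= Num.min 1 ((f i w - f j w) ^+ 4).
  by rewrite le_min ler01/= (exprM _ 2 2) sqr_ge0.
have hG : int_le Omega (fun w => alpha * (1 + 2 `^ p * (`|f i w| `^ p + `|f j w| `^ p)) +
    C * Num.min 1 ((f i w - f j w) ^+ 4)) delta.
  apply: (@int_le_trans _ _ _ (alpha * (1 * A + 2 `^ p * (P + P)) + C * eta)).
    apply: int_leD => //; first by move=> w; rewrite mulr_ge0.
      apply: int_leZ => //; first exact: ltW.
      apply: int_leD => //; first exact: int_le_cst.
      apply: int_leZ => //.
      exact: int_leD.
    exact: int_leZ.
  have h1 : alpha * (1 * A + 2 `^ p * (P + P)) <= alpha * N.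
    by rewrite ler_wpM2l ?(ltW a0)// /N lerDl.
  have h2 : C * eta <= (C + 1) * eta by rewrite ler_wpM2r ?(ltW eta0)// lerDl.
  apply: (le_trans (lerD h1 h2)).
  rewrite le_eqVlt; apply/orP; left; apply/eqP; rewrite /alpha /eta.
  by field; rewrite !gt_eqF.
apply: (int_le_le mOmega _ _ _ _ hG).
- exact: mX.
- exact: measurable_funD.
- by move=> w; rewrite powR_ge0.
- move=> w _; apply: (le_trans (HC _ (normr_ge0 _))).
  rewrite (norm_even _ 2) lerD2r ler_wpM2l ?(ltW a0)// lerD2l; exact: powR_dist.
Qed.

End Lq_coverable.

(** * Compactness in L^q *)

Section einf.
Context {R : realType}.
Implicit Types (u : (\bar R)^nat) (l : \bar R).

Lemma limn_einf_ge u l : (\forall n \near \oo, (l <= u n)%E) -> (l <= limn_einf u)%E.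
Proof.
move=> [N _ HN]; rewrite limn_einf_lim; apply: lime_ge; first exact: is_cvg_einfs.
exists N => // n /= Nn; apply: le_ereal_inf_tmp => _ [m /= nm <-].
by apply: HN; exact: leq_trans nm.
Qed.

Lemma limn_einf_le u l : (forall n, (u n <= l)%E) -> (limn_einf u <= l)%E.
Proof.
move=> ul; rewrite limn_einf_lim; apply: lime_le; first exact: is_cvg_einfs.
apply: nearW => n; apply: (le_trans _ (ul n)); apply: ereal_inf_lbound.
by exists n => /=.
Qed.

End einf.

Section riesz_fischer.
Context d (T : measurableType d) {R : realType} (mu : {measure set T -> \bar R}).
Variables (q : R) (h : nat -> T -> R).
Hypotheses (q1 : 1 <= q) (mh : forall n, measurable_fun [set: T] (h n)).

(* With this rate the integral of sum_k 2^(kq) |h_(k+1) - h_k|^q is finite, so almost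
   everywhere the increments are bounded by a geometric sequence. *)
Definition rate (k : nat) : R := (1 / (2 ^ k.+1)%:R) / (2 ^+ k) `^ q.

Hypothesis h_cauchy : forall k j, (k <= j)%N ->
  (\int[mu]_x (`|h j x - h k x| `^ q)%:E <= (rate k)%:E)%E.

Let q0 : 0 < q. Proof. exact: lt_le_trans q1. Qed.

Let mq (g : T -> R) : measurable_fun [set: T] g ->
  measurable_fun [set: T] (fun x => `|g x| `^ q).
Proof.
move=> mg; apply: (@measurableT_comp _ _ _ _ _ _ (fun x : R => x `^ q)).
  exact: measurable_powR.
by apply: (measurableT_comp _ mg); exact: normr_measurable.
Qed.

Let F k x : \bar R := ((2 ^+ k) `^ q * `|h k.+1 x - h k x| `^ q)%:E.
Let G x : \bar R := (\sum_(0 <= k <oo) F k x)%E.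

Let F0 k x : (0 <= F k x)%E. Proof. by rewrite lee_fin mulr_ge0 ?powR_ge0. Qed.

Let mF k : measurable_fun [set: T] (F k).
Proof.
apply/measurable_EFinP; apply: measurable_funM; first exact: measurable_cst.
by apply: mq; exact: measurable_funB.
Qed.

Let mG : measurable_fun [set: T] G.
Proof.
have := @ge0_emeasurable_sum _ T R setT F xpredT (fun k x _ _ => F0 k x) (fun k _ => mF k).
exact.
Qed.

Let intG : (\int[mu]_x G x <= 1)%E.
Proof.
rewrite integral_nneseries//; apply: le_trans (epsilon_trick0 xpredT ler01).
apply: lee_nneseries => k _; first by move=> _; apply: integral_ge0.
have p0 : 0 < (2 ^+ k) `^ q :> R by rewrite powR_gt0// exprn_gt0.
rewrite /F; under eq_integral do rewrite EFinM.
rewrite ge0_integralZl//; last by apply/measurable_EFinP; apply: mq; exact: measurable_funB.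
apply: (@le_trans _ _ (((2 ^+ k) `^ q)%:E * (rate k)%:E)%E).
  by apply: lee_wpmul2l; [rewrite lee_fin ltW|exact: h_cauchy].
by rewrite -EFinM lee_fin /rate mulrC divfK// gt_eqF.
Qed.

Let N := [set x | (+oo <= G x)%E].

Let mN : measurable N.
Proof. by have := emeasurable_fun_c_infty measurableT mG +oo%E; rewrite setTI. Qed.

Let muN : mu N = 0%E.
Proof.
have iG : mu.-integrable [set: T] G.
  apply/integrableP; split => //.
  under eq_integral do rewrite gee0_abs ?nneseries_ge0//.
  exact: (le_lt_trans intG (ltry _)).
have := integrable_ae measurableT iG => nG.
apply: measure_negligible => //; apply: negligibleS nG => x /= Nx /(_ I).
by rewrite ge0_fin_numE ?nneseries_ge0// ltNge Nx.
Qed.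

Let cvg_h x : ~ N x -> cvgn (h ^~ x).
Proof.
move=> /negP; rewrite -ltNge => Gx.
have GE : G x = (fine (G x))%:E by rewrite fineK// ge0_fin_numE ?nneseries_ge0.
pose B := fine (G x) `^ q^-1.
have dB k : `|h k.+1 x - h k x| <= geometric B 2^-1 k.
  have : (F k x <= G x)%E.
    apply: (@le_trans _ _ (\sum_(0 <= i < k.+1) F i x)%E).
      by rewrite big_nat_recr//= leeDr// sume_ge0.
    exact: nneseries_lim_ge.
  rewrite GE lee_fin -powRM// => hk.
  rewrite /= exprVn ler_pdivlMr ?exprn_gt0// mulrC.
  have -> : 2 ^+ k * `|h k.+1 x - h k x| = ((2 ^+ k * `|h k.+1 x - h k x|) `^ q) `^ q^-1.
    by rewrite -powRrM mulfV ?gt_eqF// powRr1// mulr_ge0.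
  by apply: ge0_ler_powR => //; rewrite ?nnegrE ?invr_ge0 ?(ltW q0) ?powR_ge0//; exact: le_trans hk; rewrite powR_ge0.
have B0 : 0 <= B by exact: powR_ge0.
have c1 : cvgn [normed series (telescope (h ^~ x))].
  apply: (series_le_cvg _ _ dB).
  - by move=> k.
  - by move=> k; rewrite /= mulr_ge0// exprn_ge0// invr_ge0.
  - by apply: is_cvg_geometric_series; rewrite ger0_norm ?invr_ge0// invf_lt1// ltr1n.
have := normed_cvg c1; rewrite telescopeK => c2.
rewrite (_ : h ^~ x = (fun n => (h n x - h 0%N x) + h 0%N x)); last by apply/funext => n; rewrite subrK.
by apply: is_cvgD => //; exact: is_cvg_cst.
Qed.

(* The factor [2 `^ q] makes continuity of [`^ q] unnecessary in Fatou's lemma: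
   eventually |h_j - h_k| >= |g - h_k| / 2. *)
Lemma riesz_fischer : exists2 g : T -> R, measurable_fun [set: T] g &
  forall k, (\int[mu]_x (`|g x - h k x| `^ q)%:E <= (2 `^ q * rate k)%:E)%E.
Proof.
pose h' n x := h n x * \1_(~` N) x.
have mCN : measurable (~` N) by exact: measurableC.
have mh' n : measurable_fun [set: T] (h' n).
  by apply: measurable_funM => //; exact: measurable_indic.
pose g x : R := if x \in N then 0 else limn (h ^~ x).
have gP x : ~ N x -> h ^~ x @ \oo --> g x.
  by move=> Nx; rewrite /g memNset//; exact: cvg_h.
have mg : measurable_fun [set: T] g.
  apply: (@measurable_fun_cvg _ _ _ _ h') => // x _.
  rewrite /h' indicE in_setC; case: (boolP (x \in N)) => Nx /=.
    by rewrite /g Nx; under eq_fun do rewrite mulr0; exact: cvg_cst.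
  under eq_fun do rewrite mulr1.
  by apply: gP => /mem_set; exact/negP.
exists g => // k.
have mk0 : measurable_fun [set: T] (fun x => (`|g x - h k x| `^ q)%:E).
  by apply/measurable_EFinP; apply: mq; exact: measurable_funB.
rewrite (ge0_negligible_integral mN measurableT mk0)//.
rewrite setTD.
pose f j x : \bar R := (2 `^ q * `|h (k + j)%N x - h k x| `^ q)%:E.
have f0 j x : (0 <= f j x)%E by rewrite lee_fin mulr_ge0 ?powR_ge0.
have mf j : measurable_fun [set: T] (f j).
  apply/measurable_EFinP; apply: measurable_funM; first exact: measurable_cst.
  by apply: mq; exact: measurable_funB.
apply: (@le_trans _ _ (\int[mu]_(x in ~` N) limn_einf (f ^~ x))%E).
  apply: ge0_le_integral => //.
  - exact: measurable_funTS.
  - apply: (@emeasurable_fun_cvg _ _ _ _ (fun n x => einfs (f ^~ x) n)).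
      by move=> n; apply: measurable_fun_einfs => j; exact: measurable_funTS.
    by move=> x _; rewrite limn_einf_lim; exact: is_cvg_einfs.
  move=> x Nx; apply: limn_einf_ge.
  have [e|ne] := eqVneq (g x) (h k x).
    by apply: nearW => j; rewrite e subrr normr0 powR0 ?gt_eqF.
  have r0 : 0 < `|g x - h k x| / 2 by rewrite divr_gt0// normr_gt0 subr_eq0.
  have /cvgrPdist_lt/(_ _ r0)[M _ HM] := gP _ Nx.
  exists M => // j /= Mj; rewrite lee_fin -powRM//.
  apply: ge0_ler_powR; rewrite ?nnegrE ?mulr_ge0// ?(ltW q0)//.
  have := HM (k + j)%N (leq_trans Mj (leq_addl _ _)).
  have := ler_distD (h (k + j)%N x) (g x) (h k x); lra.
apply: (@le_trans _ _ (limn_einf (fun j => \int[mu]_(x in ~` N) f j x)%E)).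
  by apply: fatou => // n; exact: measurable_funTS.
apply: limn_einf_le => j.
apply: (@le_trans _ _ (\int[mu]_x f j x)%E).
  by apply: ge0_subset_integral.
rewrite /f; under eq_integral do rewrite EFinM.
rewrite ge0_integralZl//; last by apply/measurable_EFinP; apply: mq; exact: measurable_funB.
by rewrite EFinM; apply: lee_wpmul2l; [rewrite lee_fin powR_ge0|apply: h_cauchy; exact: leq_addr].
Qed.

End riesz_fischer.

Section Lfun_integral.
Context d (T : measurableType d) {R : realType} (mu : {measure set T -> \bar R}).
Variable q : R.
Hypothesis q0 : 0 < q.
Implicit Types f g : T -> R.

Lemma integral_powR_Lnorm f :
  (\int[mu]_x (`|f x| `^ q)%:E = 'N[mu]_q%:E[EFin \o f] `^ q)%E.
Proof. by rewrite poweR_Lnorm ?gt_eqF//; apply: eq_integral => x _; rewrite -poweR_EFin. Qed.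

Lemma in_LfunP f : f \in Lfun mu q%:E <->
  measurable_fun [set: T] f /\ (\int[mu]_x (`|f x| `^ q)%:E < +oo)%E.
Proof.
rewrite integral_powR_Lnorm; have := Lnorm_ge0 mu q%:E (EFin \o f).
set N := 'N[mu]_q%:E[EFin \o f]%E => N0; split.
- move=> /andP[/set_mem mf /set_mem/= fin]; split => //.
  move: fin; rewrite /finite_norm -/N; case: N N0 => //= r _ _; exact: ltry.
- move=> [mf fin]; apply/andP; split; first by rewrite inE.
  rewrite inE/= /finite_norm -/N; case: N N0 fin => [r _ _| _|//]; first by rewrite ltry.
  by rewrite poweRE gt_eqF//= eqxx.
Qed.

End Lfun_integral.

Section Lfun_precompact.
Context d (T : measurableType d) {R : realType} (mu : {measure set T -> \bar R}).
Variables (q : R) (q1 : (1 <= q%:E)%E).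
Local Notation E := (LfunType mu q1).

Let q0 : 0 < q. Proof. by rewrite -lte_fin; apply: lt_le_trans q1. Qed.

Lemma Lfun_dist_ge0 (f g : E) : 0 <= Lfun_dist f g.
Proof. by rewrite fine_ge0// Lnorm_ge0. Qed.

Lemma integral_Lfun_dist (f g : E) :
  (\int[mu]_x (`|f x - g x| `^ q)%:E = ((Lfun_dist f g) `^ q)%:E)%E.
Proof.
rewrite (integral_powR_Lnorm mu q0 (f - g : E)) -poweR_EFin; congr (_ `^ _)%E.
by rewrite /Lfun_dist (finite_norm_fine (f - g : E)).
Qed.

Let rootK (r : R) : 0 <= r -> (r `^ q) `^ q^-1 = r.
Proof. by move=> r0; rewrite -powRrM mulfV ?gt_eqF// powRr1. Qed.

Let rootX (r : R) : 0 <= r -> (r `^ q^-1) `^ q = r.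
Proof. by move=> r0; rewrite -powRrM mulVf ?gt_eqF// powRr1. Qed.

Lemma ball_integral (f g : E) e : ball f e g ->
  (\int[mu]_x (`|f x - g x| `^ q)%:E <= (e `^ q)%:E)%E.
Proof.
move=> fg; have {}fg : Lfun_dist f g < e by exact: fg.
have d0 := Lfun_dist_ge0 f g.
rewrite integral_Lfun_dist lee_fin; apply: ge0_ler_powR; rewrite ?nnegrE ?(ltW q0)//.
  exact: le_trans (ltW fg).
exact: ltW.
Qed.

(** Balls are defined by a strict inequality and integral bounds are weak; halving the radius passes
    from one to the other. *)
Lemma integral_ball (f g : E) (e : R) : 0 < e ->
  (\int[mu]_x (`|f x - g x| `^ q)%:E <= ((e / 2) `^ q)%:E)%E -> ball f e g.
Proof.
move=> e0; rewrite integral_Lfun_dist lee_fin => h.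
suff : Lfun_dist f g < e by [].
have d0 := Lfun_dist_ge0 f g; have e2 : 0 <= e / 2 by rewrite divr_ge0// ltW.
apply: (@le_lt_trans _ _ (e / 2)); last by lra.
rewrite -(rootK d0) -(rootK e2); apply: ge0_ler_powR; rewrite ?nnegrE ?invr_ge0 ?powR_ge0 ?(ltW q0)//.
Qed.

Let rate_gt0 k : 0 < rate q k.
Proof. by rewrite !divr_gt0// ?ltr0n ?expn_gt0// powR_gt0// exprn_gt0. Qed.

Let rate_le k j : (k <= j)%N -> rate q j <= rate q k.
Proof.
move=> kj; rewrite /rate !mul1r; apply: ler_pM; rewrite ?invr_ge0 ?powR_ge0//.
  by rewrite lef_pV2 ?posrE ?ltr0n ?expn_gt0// ler_nat leq_exp2l.
rewrite lef_pV2 ?posrE ?powR_gt0 ?exprn_gt0//; apply: ge0_ler_powR.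
- exact: ltW.
- by rewrite nnegrE exprn_ge0.
- by rewrite nnegrE exprn_ge0.
- by rewrite ler_eXn2l// ltr1n.
Qed.

Let rate_small (eta : R) : 0 < eta -> exists k, rate q k <= eta.
Proof.
move=> eta0; exists (Num.truncn eta^-1).
set k := Num.truncn _.
have k1 : eta^-1 < k.+1%:R by exact: Num.Theory.truncnS_gt.
apply: (@le_trans _ _ (k.+1%:R^-1)); last first.
  by rewrite invf_ple ?posrE ?ltr0n// ltW.
rewrite /rate mul1r ler_pdivrMr ?powR_gt0 ?exprn_gt0//.
have p1 : 1 <= (2 ^+ k) `^ q :> R.
  have e1 : 1 `^ q = 1 :> R by rewrite powR1.
  rewrite -[leLHS]e1; apply: ge0_ler_powR; rewrite ?nnegrE ?(ltW q0) ?exprn_ge0//.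
  by rewrite exprn_ege1// ler1n.
apply: (@le_trans _ _ (k.+1%:R^-1)); last by rewrite ler_peMr// invr_ge0.
by rewrite lef_pV2 ?posrE ?ltr0n ?expn_gt0// ler_nat ltnW// ltn_expl.
Qed.

(** An ultrafilter on the closure contains balls of every radius around members of the sequence.
    Centres with radii shrinking at the rate of [riesz_fischer] form a Cauchy sequence, and the
    ultrafilter converges to its limit. *)
Lemma precompact_coverable (f : nat -> T -> R) :
  (forall n, f n \in Lfun mu q%:E) ->
  (forall delta : R, 0 < delta -> exists (K : finType) (c : nat -> K),
    forall i j, c i = c j ->
    (\int[mu]_x (`|f i x - f j x| `^ q)%:E <= delta%:E)%E) ->
  precompact [set g : E | exists n, g = f n :> (T -> R)].
Proof.
move=> fL cov; set S := [set g : E | _].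
pose F n : E := Lfun_Sub q1 (fL n).
rewrite precompactE compact_ultra => U UU US.
have net (e : R) : 0 < e -> exists n, U (ball (F n) e).
  move=> e0; have e40 : 0 < ((e / 2) / 2) `^ q by rewrite powR_gt0// !divr_gt0.
  have [K [c Hc]] := cov _ e40.
  apply: contrapT => /forallNP none.
  (* A colour that is not attained gets the representative 0, which is harmless: only colours of
     actual indices are used below. If no ball around a representative belongs to [U], then the
     finite intersection of their complements does. *)
  pose rep (k : K) := xget 0%N [set n | c n = k].
  have far k : U (~` ball (F (rep k)) e).
    by have [/none|] := in_ultra_setVsetC (ball (F (rep k)) e) UU.
  have [g [/= Sg gfar]] := filter_ex (filterI US
    (filter_forall (f := fun k => ~` ball (F (rep k)) e) _ far)).
  have e20 : 0 < e / 2 by rewrite divr_gt0.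
  have [h [[n hn] bg]] := Sg _ (nbhsx_ballx g (e / 2) e20).
  have repn : c (rep (c n)) = c n by apply: (@xgetPex _ _ [set m | c m = c n]); exists n.
  apply: (gfar (c n)); rewrite (splitr e); apply: ball_triangle (ball_sym bg).
  apply: integral_ball => //; apply: le_trans (Hc _ _ repn); rewrite le_eqVlt; apply/orP; left.
  by apply/eqP; apply: eq_integral => x _; rewrite hn.
(* Two balls that belong to [U] intersect, so their centres are closer than the sum of the radii;
   half of the [q]-th root turns that into the integral bound [rate q k]. *)
pose rho k : R := (rate q k) `^ q^-1 / 2.
have rho0 k : 0 < rho k by rewrite divr_gt0// powR_gt0.
have [m Hm] := choice (fun k => net _ (rho0 k)).
have rhoX k : (rho k + rho k) `^ q = rate q k by rewrite -splitr rootX// ltW.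
have cauchy k j : (k <= j)%N ->
    (\int[mu]_x (`|f (m j) x - f (m k) x| `^ q)%:E <= (rate q k)%:E)%E.
  move=> kj; have [g [/= gk gj]] := filter_ex (filterI (Hm k) (Hm j)).
  rewrite -rhoX; apply: (@ball_integral (F (m j)) (F (m k))).
  have rho_le : rho j + rho k <= rho k + rho k.
    apply: lerD; last exact: lexx.
    apply: ler_wpM2r; first by rewrite invr_ge0.
    apply: ge0_ler_powR; [by rewrite invr_ge0 ltW|by rewrite nnegrE ltW..|exact: rate_le].
  apply: (le_ball rho_le).
  exact: ball_triangle gj (ball_sym gk).
have mf n : measurable_fun [set: T] (f n) by have /(in_LfunP mu q0)[] := fL n.
have [g mg Hg] := riesz_fischer q1 (fun n => mf (m n)) cauchy.
have mq (h : T -> R) : measurable_fun [set: T] h ->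
    measurable_fun [set: T] (fun x => (`|h x| `^ q)%:E).
  move=> mh; apply/measurable_EFinP.
  apply: (@measurableT_comp _ _ _ _ _ _ (fun x : R => x `^ q)); first exact: measurable_powR.
  by apply: (measurableT_comp _ mh); exact: normr_measurable.
have gL : g \in Lfun mu q%:E.
  apply/(in_LfunP mu q0); split => //.
  have /(in_LfunP mu q0)[_ f0] := fL (m 0%N).
  have mD : measurable_fun [set: T] (fun x => g x - f (m 0%N) x) by exact: measurable_funB.
  apply: (@le_lt_trans _ _ ((2 `^ q)%:E * (\int[mu]_x (`|g x - f (m 0%N) x| `^ q)%:E +
     \int[mu]_x (`|f (m 0%N) x| `^ q)%:E))%E).
    rewrite -ge0_integralD//; [|by apply: mq..].
    have m1 : measurable_fun [set: T] (fun x =>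
        (`|g x - f (m 0%N) x| `^ q)%:E + (`|f (m 0%N) x| `^ q)%:E)%E.
      by apply: emeasurable_funD; exact: mq.
    have p1 x : (0 <= (`|g x - f (m 0%N) x| `^ q)%:E + (`|f (m 0%N) x| `^ q)%:E)%E.
      by rewrite -EFinD lee_fin addr_ge0 ?powR_ge0.
    rewrite -ge0_integralZl//.
    apply: ge0_le_integral => //.
    - exact: mq.
    - exact: measurable_funeM.
    - move=> x _; rewrite -EFinD -EFinM lee_fin -[X in X `^ q <= _](normrN).
      have := powR_dist (g x - f (m 0%N) x) (- f (m 0%N) x) (ltW q0).
      by rewrite opprK subrK !normrN.
  rewrite lte_mul_pinfty ?lee_fin ?powR_ge0//.
  by apply: lte_add_pinfty f0; apply: (le_lt_trans (Hg 0%N)); rewrite ltry.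
pose g' : E := Lfun_Sub q1 gL.
have Ug : U --> g'.
  apply/cvg_ballP => e e0.
  (* [e1] places the centre [F (m k)] within [e / 2] of the limit, the divisor compensating the
     factor in [riesz_fischer]; [e2] makes the radius [rho k] at most [e / 2]. *)
  pose e1 := ((e / 2) / 2) `^ q / 2 `^ q; pose e2 := (e / 2) `^ q.
  have p2 : 0 < 2 `^ q :> R by rewrite powR_gt0.
  have e10 : 0 < Num.min e1 e2.
    by rewrite lt_min /e1 /e2 divr_gt0 ?powR_gt0// !divr_gt0.
  have [k] := rate_small e10; rewrite le_min => /andP[k1 k2].
  apply: filterS (Hm k) => h bh.
  rewrite (splitr e); apply: (@ball_triangle _ _ (F (m k))).
    apply: integral_ball; first by rewrite divr_gt0.
    by apply: (le_trans (Hg k)); rewrite lee_fin mulrC -ler_pdivlMr.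
  apply: (le_ball _ bh); have h2 : 0 <= e / 2 by rewrite divr_ge0// ltW.
  have : rate q k `^ q^-1 <= e / 2.
    rewrite -(rootK h2); apply: ge0_ler_powR; rewrite ?nnegrE ?invr_ge0 ?powR_ge0 ?(ltW q0)//.
    exact: ltW.
  have := powR_ge0 (rate q k) q^-1; rewrite /rho; lra.
(* Every neighbourhood of [g'] belongs to [U], hence meets the closure of [S]; so [g'] adheres to a
   closed set and lies in it. *)
exists g'; split => //; apply: closed_closure => B /Ug UB.
exact: filter_ex (filterI US UB).
Qed.

End Lfun_precompact.

(** * The sequence of the theorem *)

Section extension_by_zero.
Context {R : realType} (Omega : set (plane R)).
Local Notation T := [set: plane R].
Hypotheses (mOmega : measurable Omega) (fOmega : (leb2 Omega < +oo)%E).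

Lemma integral_off (F : plane R -> R) : (forall w, ~ Omega w -> F w = 0) ->
  (\int[leb2]_w (F w)%:E = \int[leb2]_(w in Omega) (F w)%:E)%E.
Proof.
move=> F0; rewrite [RHS]integral_mkcond; apply: eq_integral => w _; rewrite patchE.
by case: ifPn => // /negP h; rewrite F0// => Ow; apply: h; rewrite inE.
Qed.

Lemma int_le_setT (F : plane R -> R) x : (forall w, ~ Omega w -> F w = 0) ->
  int_le Omega F x -> int_le T F x.
Proof. by move=> F0; rewrite /int_le integral_off. Qed.

Lemma patch_off (f : plane R -> R) w : ~ Omega w -> (f \_ Omega) w = 0.
Proof. by move=> nO; rewrite patchE memNset. Qed.

Lemma patch_on (f : plane R -> R) w : Omega w -> (f \_ Omega) w = f w.
Proof. by move=> O; rewrite patchE mem_set. Qed.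

Let A := fine (leb2 Omega).
Let hA : leb2 Omega = A%:E. Proof. by rewrite /A fineK// ge0_fin_numE. Qed.

Lemma powR_le_add1 (t p q : R) : 0 <= t -> 0 <= q -> q <= p -> t `^ q <= 1 + t `^ p.
Proof.
move=> t0 q0 qp; have [t1|t1] := leP t 1.
  have e1 : 1 `^ q = 1 :> R by rewrite powR1.
  have : t `^ q <= 1 by rewrite -[leRHS]e1; apply: ge0_ler_powR; rewrite ?nnegrE.
  by have := powR_ge0 t p; lra.
by have := ler_powR (ltW t1) qp; lra.
Qed.

Lemma in_Lp_le (f : plane R -> R) (p q : R) : 0 < q -> q <= p ->
  in_Lp Omega p f -> in_Lp Omega q f.
Proof.
move=> q0 qp; have p0 : 0 < p by apply: lt_le_trans qp.
move=> /(in_LfunP leb2 p0)[mf fp]; apply/(in_LfunP leb2 q0); split => //.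
have mq r : measurable_fun T (fun w => `|(f \_ Omega) w| `^ r).
  apply: (@measurableT_comp _ _ _ _ _ _ (fun x : R => x `^ r)); first exact: measurable_powR.
  by apply: (measurableT_comp _ mf); exact: normr_measurable.
rewrite integral_off => [|w nO]; last by rewrite patch_off// normr0 powR0 ?gt_eqF.
apply: (@le_lt_trans _ _ (\int[leb2]_(w in Omega) (1%:E + (`|(f \_ Omega) w| `^ p)%:E))%E).
  apply: ge0_le_integral => //.
  - by apply: measurable_funTS; apply/measurable_EFinP.
  - by apply: measurable_funTS; apply: emeasurable_funD => //; apply/measurable_EFinP.
  - by move=> w _; rewrite -EFinD lee_fin; apply: powR_le_add1 => //; exact: ltW.
rewrite ge0_integralD//; last by apply: measurable_funTS; apply/measurable_EFinP.
rewrite integral_cst// mul1e; apply: lte_add_pinfty => //.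
by rewrite -integral_off// => w nO; rewrite patch_off// normr0 powR0 ?gt_eqF.
Qed.

Lemma in_Lp_integrable (f : plane R -> R) (p : R) : 1 <= p ->
  in_Lp Omega p f -> leb2.-integrable T (EFin \o (f \_ Omega)).
Proof.
move=> p1 /(in_Lp_le ltr01 p1)/(in_LfunP leb2 ltr01)[mf fin].
apply/integrableP; split; first exact/measurable_EFinP.
by apply: le_lt_trans fin; under [leRHS]eq_integral do rewrite powRr1//.
Qed.

Lemma in_L2_integrable_sqr (f : plane R -> R) : in_Lp Omega 2 f ->
  leb2.-integrable T (EFin \o (fun w => (f \_ Omega) w ^+ 2)).
Proof.
have p2 : 0 < 2 :> R by [].
move=> /(in_LfunP leb2 p2)[mf fin]; apply/integrableP; split.
  by apply/measurable_EFinP; exact: measurable_funX.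
apply: le_lt_trans fin; rewrite le_eqVlt; apply/orP; left; apply/eqP.
by apply: eq_integral => w _; rewrite powR_mulrn//= normrX.
Qed.

Lemma int_le_Lp_norm (f : plane R -> R) (p C : R) : 0 < p ->
  (Lp_norm Omega p f <= C%:E)%E ->
  int_le T (fun w => `|(f \_ Omega) w| `^ p) (C `^ p).
Proof.
move=> p0 h; rewrite /int_le (integral_powR_Lnorm leb2 p0) -poweR_EFin.
have N0 := Lnorm_ge0 leb2 p%:E (EFin \o (f \_ Omega)).
apply: gt0_ler_poweR => //; rewrite ?in_itv/= ?leey ?andbT//; first exact: ltW.
exact: le_trans h.
Qed.

End extension_by_zero.

Section L2_coverable.
Context {R : realType} (Omega : set (plane R)) (m q : nat -> plane R -> R).
Variables (eps : nat -> R) (M6 K : R).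
Local Notation T := [set: plane R].
Hypotheses (mOmega : measurable Omega) (fOmega : (leb2 Omega < +oo)%E).
Hypotheses (mm : forall n, measurable_fun T (m n)) (mq : forall n, measurable_fun T (q n)).
Hypotheses (epscvg : eps @ \oo --> (0 : R)).
Hypotheses (m6 : forall n, int_le Omega (fun w => m n w ^+ 6) M6)
  (r2 : forall n, int_le Omega (fun w => (q n w - 2^-1 * m n w ^+ 2) ^+ 2) (K * eps n)).
Hypothesis m_cov : int_coverable Omega (fun i j w => (m i w - m j w) ^+ 4).

(** Replacing [q] by residue plus [m ^+ 2 / 2] leaves the product [(m1 - m2) (m1 + m2)]. Young's
    inequality with weight [a] gives the small coefficient to the sum, which sixth powers control,
    and the large one to the difference. *)
Lemma flux_dist_le (q1 q2 m1 m2 a : R) : 0 < a ->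
  (q1 - q2) ^+ 2 <=
    4 * ((q1 - 2^-1 * m1 ^+ 2) ^+ 2 + (q2 - 2^-1 * m2 ^+ 2) ^+ 2) +
    ((4 * a)^-1 * (m1 - m2) ^+ 4 + 2 * a * (2 + m1 ^+ 6 + m2 ^+ 6)).
Proof.
move=> a0; set r1 := q1 - 2^-1 * m1 ^+ 2; set r2' := q2 - 2^-1 * m2 ^+ 2.
have -> : q1 - q2 = (r1 - r2') + 2^-1 * ((m1 - m2) * (m1 + m2)) by rewrite /r1 /r2'; field.
set P := (m1 - m2) * (m1 + m2).
have hP : P ^+ 2 <= (2 * a)^-1 * (m1 - m2) ^+ 4 + 4 * a * (2 + m1 ^+ 6 + m2 ^+ 6).
  have := mulr_ge0 (ltW a0) (sqr_ge0 ((2 * a)^-1 * (m1 - m2) ^+ 2 - 2^-1 * (m1 + m2) ^+ 2)).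
  have -> : a * ((2 * a)^-1 * (m1 - m2) ^+ 2 - 2^-1 * (m1 + m2) ^+ 2) ^+ 2 =
     2^-1 * ((2 * a)^-1 * (m1 - m2) ^+ 4 + a / 2 * (m1 + m2) ^+ 4 - P ^+ 2).
    by rewrite /P; field; rewrite gt_eqF.
  have := ler_wpM2l (_ : 0 <= a / 2) (pow4_add m1 m2).
  rewrite divr_ge0 ?(ltW a0)// => /(_ isT) h1 h2.
  lra.
have e4a : (4 * a)^-1 = 2^-1 * (2 * a)^-1 by field; rewrite gt_eqF.
have s1 := sqr_ge0 (r1 - r2' - 2^-1 * P); have s2 := sqr_ge0 (r1 + r2').
rewrite e4a -(mulrA 2^-1) -(mulrA 2 a); rewrite -(mulrA 4 a) in hP.
move: hP s1 s2; move: P r1 r2' => P r1 r2'.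
move: ((2 * a)^-1 * _) (a * _) => x y; lra.
Qed.

Lemma L2_coverable : int_coverable Omega (fun i j w => (q i w - q j w) ^+ 2).
Proof.
move=> delta delta0.
have e6 (t : R) : 0 <= t ^+ 6 by rewrite (exprM t 3 2) sqr_ge0.
have e4 (t : R) : 0 <= t ^+ 4 by rewrite (exprM t 2 2) sqr_ge0.
have M60 : 0 <= M6.
  rewrite -lee_fin; apply: le_trans (m6 0%N); apply: integral_ge0 => w _.
  by rewrite lee_fin.
pose A := fine (leb2 Omega).
have hA : leb2 Omega = A%:E by rewrite /A fineK// ge0_fin_numE.
have A0 : 0 <= A by rewrite fine_ge0.
pose N1 := A + M6 + 1.
have N10 : 0 < N1 by rewrite ltr_wpDl// addr_ge0.
(* Three thirds of [delta]: [a] bounds the sixth-power part through [4 * a * N1 = delta / 3], [eta]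
   is the tolerance for [(m i - m j) ^+ 4], and [rho] gives [4 * (rho + rho) = delta / 3] for the
   residues. *)
pose a := delta / (12 * N1).
have a0 : 0 < a by rewrite divr_gt0// mulr_gt0.
pose eta := 4 * a * (delta / 3).
have eta0 : 0 < eta by apply: mulr_gt0; [exact: mulr_gt0|exact: divr_gt0].
pose rho := delta / 24.
have rho0 : 0 < rho by rewrite divr_gt0.
have Kcvg : (fun n => K * eps n) @ \oo --> (0 : R).
  by rewrite -(mulr0 K); apply: cvgM => //; exact: cvg_cst.
have [N _ hN] : \forall n \near \oo, K * eps n <= rho.
  have /cvgrPdist_lt/(_ _ rho0) := Kcvg; apply: filterS => n.
  by rewrite sub0r normrN => /ltW; apply: le_trans; exact: ler_norm.
have [F [c Hc]] := m_cov eta0.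
(* Indices below [N], whose residue may exceed [rho], are isolated by a colour of their own. *)
exists ('I_N.+1 * F)%type, (fun n => (inord (minn n N), c n)).
move=> i j [/(congr1 val)]; rewrite /= !inordK ?ltnS ?geq_minr// => hmin /Hc hc.
have [->|ij] := eqVneq i j.
  rewrite /int_le integral0_eq ?lee_fin ?ltW// => w _.
  by rewrite subrr expr0n.
have [iN jN] : (N <= i)%N /\ (N <= j)%N.
  move: hmin ij; rewrite /minn; case: (ltnP i N); case: (ltnP j N) => //.
  - by move=> _ _ ->; rewrite eqxx.
  - by move=> h1 h2 e; rewrite e ltnn in h2.
  - by move=> h1 h2 e; rewrite -e ltnn in h1.
pose r n w := (q n w - 2^-1 * m n w ^+ 2) ^+ 2.
have mr n : measurable_fun T (r n).
  apply: measurable_funX; apply: measurable_funB => //.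
  by apply: measurable_funM => //; exact: measurable_funX.
have r0 n w : 0 <= r n w by exact: sqr_ge0.
have rN n : (N <= n)%N -> int_le Omega (r n) rho.
  by move=> Nn; apply: int_le_trans (r2 n) _; exact: hN.
have mm6 n : measurable_fun T (fun w => m n w ^+ 6) by exact: measurable_funX.
have m1 : measurable_fun T (fun w => r i w + r j w) by exact: measurable_funD.
have m2 : measurable_fun T (fun w => (m i w - m j w) ^+ 4).
  by apply: measurable_funX; exact: measurable_funB.
have m3 : measurable_fun T (fun w => 2 + m i w ^+ 6) by exact: measurable_funD.
have m4 : measurable_fun T (fun w => 2 + m i w ^+ 6 + m j w ^+ 6) by exact: measurable_funD.
have m5 : measurable_fun T (fun w => (4 * a)^-1 * (m i w - m j w) ^+ 4) by exact: measurable_funM.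
have m7 : measurable_fun T (fun w => 2 * a * (2 + m i w ^+ 6 + m j w ^+ 6)) by exact: measurable_funM.
have m8 : measurable_fun T (fun w => (4 * a)^-1 * (m i w - m j w) ^+ 4 +
   2 * a * (2 + m i w ^+ 6 + m j w ^+ 6)) by exact: measurable_funD.
have m9 : measurable_fun T (fun w => 4 * (r i w + r j w)) by exact: measurable_funM.
have a4 : 0 <= (4 * a)^-1 by rewrite invr_ge0 mulr_ge0// ltW.
have a2 : 0 <= 2 * a by rewrite mulr_ge0// ltW.
have p1 w : 0 <= r i w + r j w by rewrite addr_ge0.
have p3 w : 0 <= 2 + m i w ^+ 6 by rewrite addr_ge0.
have p4 w : 0 <= 2 + m i w ^+ 6 + m j w ^+ 6 by rewrite addr_ge0.
have p5 w : 0 <= (4 * a)^-1 * (m i w - m j w) ^+ 4 by rewrite mulr_ge0.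
have p7 w : 0 <= 2 * a * (2 + m i w ^+ 6 + m j w ^+ 6) by rewrite mulr_ge0.
have p8 w : 0 <= (4 * a)^-1 * (m i w - m j w) ^+ 4 +
   2 * a * (2 + m i w ^+ 6 + m j w ^+ 6) by rewrite addr_ge0.
have p9 w : 0 <= 4 * (r i w + r j w) by rewrite mulr_ge0.
have hG : int_le Omega (fun w => 4 * (r i w + r j w) +
   ((4 * a)^-1 * (m i w - m j w) ^+ 4 + 2 * a * (2 + m i w ^+ 6 + m j w ^+ 6))) delta.
  apply: (@int_le_trans _ _ _ (4 * (rho + rho) +
    ((4 * a)^-1 * eta + 2 * a * (2 * A + M6 + M6)))).
    apply: int_leD => //.
      apply: int_leZ => //; apply: int_leD => //; exact: rN.
    apply: int_leD => //; first exact: int_leZ.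
    apply: int_leZ => //; apply: int_leD => //; apply: int_leD => //; exact: int_le_cst.
  have -> : (4 * a)^-1 * eta = delta / 3 by rewrite /eta; field; rewrite gt_eqF.
  have h1 : 4 * a * (A + M6) <= 4 * a * N1.
    by apply: ler_wpM2l; [rewrite mulr_ge0// ltW|rewrite /N1 lerDl].
  have h2 : 4 * a * N1 = delta / 3 by rewrite /a; field; rewrite gt_eqF.
  by move: h1; rewrite h2 /rho; lra.
apply: (int_le_le mOmega _ _ _ _ hG).
- by apply: measurable_funX; exact: measurable_funB.
- exact: measurable_funD.
- by move=> w; exact: sqr_ge0.
- by move=> w _; exact: flux_dist_le.
Qed.

End L2_coverable.

Lemma bounded_leb2_lty (R : realType) (Omega : set (R * R)) :
  measurable (Omega : set (plane R)) -> bounded_set Omega -> (leb2 Omega < +oo)%E.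
Proof.
move=> mO bO; have [M HM] := @filter_ex _ _ (@proper_pinfty_nbhs R) _ bO.
apply: (le_lt_trans _ (leb2_box_lty (- M) M (- M) M)).
apply: le_measure; rewrite ?inE//; first exact: measurable_box.
move=> [x z] /HM; rewrite /= prod_normE ge_max/= => /andP[hx hz].
by split; rewrite /= in_itv/= -ler_norml.
Qed.

Lemma wderivP (R : realType) (Omega : set (R * R)) (v : R * R) (u : R * R -> R) :
  has_wderiv Omega v u -> is_wderiv Omega v u (wderiv Omega v u).
Proof. by move=> h; apply: (@xgetPex _ _ [set g | is_wderiv Omega v u g]). Qed.

(** Both summands of the energy are nonnegative, so each is bounded separately. The bounds scale as
    [e] and [1 / e]; their product does not depend on [e], which is what keeps the entropy
    production bounded. *)
Lemma energy_bounds (R : realType) (Omega : set (plane R)) (m q X : plane R -> R)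
    (e C : R) : measurable Omega -> 0 < e ->
  measurable_fun [set: plane R] (m \_ Omega) ->
  measurable_fun [set: plane R] (q \_ Omega) ->
  measurable_fun [set: plane R] (X \_ Omega) ->
  ((2^-1)%:E * \int[leb2]_(w in Omega)
     (e^-1 * (q w - 2^-1 * m w ^+ 2) ^+ 2 + e * X w ^+ 2)%:E <= C%:E)%E ->
  int_le Omega (fun w => ((q \_ Omega) w - 2^-1 * (m \_ Omega) w ^+ 2) ^+ 2) (2 * C * e) /\
  int_le Omega (fun w => (X \_ Omega) w ^+ 2) (2 * C / e).
Proof.
move=> mO e0 mm mq mX hC.
pose r w := ((q \_ Omega) w - 2^-1 * (m \_ Omega) w ^+ 2) ^+ 2.
pose Y w := (X \_ Omega) w ^+ 2.
have mr : measurable_fun [set: plane R] r.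
  apply: measurable_funX; apply: measurable_funB => //.
  by apply: measurable_funM => //; exact: measurable_funX.
have mY : measurable_fun [set: plane R] Y by exact: measurable_funX.
have ei0 : 0 <= e^-1 by rewrite invr_ge0 ltW.
have r0 w : 0 <= r w by exact: sqr_ge0.
have Y0 w : 0 <= Y w by exact: sqr_ge0.
have mer : measurable_fun [set: plane R] (fun w => e^-1 * r w) by exact: measurable_funM.
have meY : measurable_fun [set: plane R] (fun w => e * Y w) by exact: measurable_funM.
have er0 w : 0 <= e^-1 * r w by rewrite mulr_ge0.
have eY0 w : 0 <= e * Y w by rewrite mulr_ge0// ltW.
have mS : measurable_fun [set: plane R] (fun w => e^-1 * r w + e * Y w) by exact: measurable_funD.
have S : int_le Omega (fun w => e^-1 * r w + e * Y w) (2 * C).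
  have two0 : (0 <= 2%:E :> \bar R)%E by rewrite lee_fin.
  have := lee_wpmul2l two0 hC.
  rewrite muleA -!EFinM mulfV// mul1e; apply: le_trans; rewrite le_eqVlt.
  apply/orP; left; apply/eqP; apply: eq_integral => w /set_mem Ow.
  by rewrite /r /Y !patch_on.
have half (F : plane R -> R) (k l : R) : 0 < k -> k * l = 1 ->
    measurable_fun [set: plane R] F -> (forall w, 0 <= F w) ->
    (forall w, l * F w <= e^-1 * r w + e * Y w) -> int_le Omega F (k * (2 * C)).
  move=> k0 kl mF F0 h.
  apply: (@int_le_le _ _ mO _ (fun w => k * (e^-1 * r w + e * Y w))) => //.
  - exact: measurable_funM.
  - by move=> w _; have := ler_wpM2l (ltW k0) (h w); rewrite mulrA kl mul1r.
  - by apply: int_leZ => //; [move=> w; rewrite addr_ge0|exact: ltW].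
split.
  rewrite mulrC; apply: (half r e e^-1) => //; first by rewrite mulfV ?gt_eqF.
  by move=> w; rewrite lerDl.
rewrite mulrC; apply: (half Y e^-1 e); rewrite ?invr_gt0 ?mulVf ?gt_eqF//.
by move=> w; rewrite lerDr.
Qed.

Lemma residue_off (R : realType) (Omega : set (plane R)) (f g : plane R -> R) w :
  ~ Omega w -> ((g \_ Omega) w - 2^-1 * (f \_ Omega) w ^+ 2) ^+ 2 = 0.
Proof.
move=> nO; have -> : (f \_ Omega) w = 0 by exact: patch_off.
have -> : (g \_ Omega) w = 0 by exact: patch_off.
by ring.
Qed.

Theorem theorem3p1 (R : realType) (Omega : set (R * R)%type)
    (eps : nat -> R) (u : nat -> (R * R)%type -> R) (C p : R) :
  domain Omega -> bounded_set Omega ->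
  (forall n, 0 < eps n) -> nonincreasing_seq eps -> eps @ \oo --> (0 : R) ->
  (forall n, in_H1 Omega (u n)) ->
  6 < p ->
  (forall n, (Lp_norm Omega p (wderiv Omega e_x (u n)) <= C%:E)%E) ->
  (forall n, has_wderiv Omega e_x (wderiv Omega e_x (u n)) /\
             in_Lp Omega 2 (wderiv Omega e_x (wderiv Omega e_x (u n)))) ->
  (forall n, (energy Omega (eps n) (u n) <= C%:E)%E) ->
  (forall (q : R) (q1 : (1 <= q%:E)%E), q < p ->
     relatively_compact_Lp Omega q1 (fun n => wderiv Omega e_x (u n))) /\
  relatively_compact_Lp Omega (lee1n 2) (fun n => wderiv Omega e_z (u n)).
Proof.
move=> [_ oO _] bO eps0 epsmono epscvg H1 p6 Lp W2 En.
have mO : measurable (Omega : set (plane R)) by exact: open_measurable_plane.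
have fO := bounded_leb2_lty mO bO.
pose m n := wderiv Omega e_x (u n); pose q n := wderiv Omega e_z (u n).
pose X n := wderiv Omega e_x (m n).
pose T := [set: plane R].
have uL n : in_Lp Omega 2 (u n) by have [] := H1 n.
have xmem : (e_x : R * R) \in [:: e_x; e_z] by rewrite inE eqxx.
have zmem : (e_z : R * R) \in [:: e_x; e_z] by rewrite !inE eqxx orbT.
have [um mL] : (forall n, is_wderiv Omega e_x (u n) (m n)) /\
    (forall n, in_Lp Omega 2 (m n)).
  by split=> n; have [_ /(_ _ xmem)[/wderivP]] := H1 n.
have [uq qL] : (forall n, is_wderiv Omega e_z (u n) (q n)) /\
    (forall n, in_Lp Omega 2 (q n)).
  by split=> n; have [_ /(_ _ zmem)[/wderivP]] := H1 n.
have [mX XL] : (forall n, is_wderiv Omega e_x (m n) (X n)) /\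
    (forall n, in_Lp Omega 2 (X n)).
  by split=> n; have [/wderivP] := W2 n.
have two0 : 0 < 2 :> R by [].
have meas f : in_Lp Omega 2 f -> measurable_fun T (f \_ Omega).
  by move=> /(in_LfunP leb2 two0)[].
have mm n := meas _ (mL n); have mq n := meas _ (qL n); have mXX n := meas _ (XL n).
have L2i f : in_Lp Omega 2 f -> leb2.-integrable T (EFin \o (f \_ Omega)).
  by apply: in_Lp_integrable => //; exact: ler1n.
have C0 : 0 <= C by rewrite -lee_fin; apply: le_trans (Lp 0%N); exact: Lnorm_ge0.
have p0 : 0 < p by lra.
pose P := C `^ p.
have mP n : int_le T (fun w => `|(m n \_ Omega) w| `^ p) P
  by exact: int_le_Lp_norm p0 (Lp n).
have mp n : measurable_fun T (fun w => `|(m n \_ Omega) w| `^ p).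
  apply: (@measurableT_comp _ _ _ _ _ _ (fun x : R => x `^ p)); first exact: measurable_powR.
  by apply: (measurableT_comp _ (mm n)); exact: normr_measurable.
have mPO n : int_le Omega (fun w => `|(m n \_ Omega) w| `^ p) P.
  rewrite /int_le -integral_off; first exact: mP.
  by move=> w nO; rewrite patch_off// normr0 powR0 ?gt_eqF.
pose A := fine (leb2 Omega).
have hA : leb2 Omega = A%:E by rewrite /A fineK// ge0_fin_numE.
(* The sixth power is at most [1 + |.|^p], and [Omega], being bounded, has finite measure [A]. *)
pose M6 := 1 * A + P.
have e6 (t : R) : 0 <= t ^+ 6 by rewrite (exprM t 3 2) sqr_ge0.
have m6O n : int_le Omega (fun w => (m n \_ Omega) w ^+ 6) M6.
  apply: (@int_le_le _ _ mO _ (fun w => 1 + `|(m n \_ Omega) w| `^ p)) => //.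
  - exact: measurable_funX.
  - exact: measurable_funD.
  - by move=> w _; exact: pow6_le_powR.
  - by apply: int_leD => //; exact: int_le_cst.
have m6 n : int_le T (fun w => (m n \_ Omega) w ^+ 6) M6.
  by apply: int_le_setT (m6O n) => w nO; rewrite patch_off// expr0n.
have En2 n := energy_bounds mO (eps0 n) (mm n) (mq n) (mXX n) (En n).
pose K := 2 * C.
have K0 : 0 <= K by rewrite mulr_ge0.
have r2O n : int_le Omega
    (fun w => ((q n \_ Omega) w - 2^-1 * (m n \_ Omega) w ^+ 2) ^+ 2) (K * eps n).
  by have [] := En2 n.
have r2 n : int_le T
    (fun w => ((q n \_ Omega) w - 2^-1 * (m n \_ Omega) w ^+ 2) ^+ 2) (K * eps n).
  apply: int_le_setT (r2O n) => w nO.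
  exact: residue_off.
have X2 n : int_le T (fun w => (X n \_ Omega) w ^+ 2) (K / eps n).
  have [_ h] := En2 n; apply: int_le_setT h => w nO.
  by rewrite (patch_off _ nO) (expr0n _ _).
have epsle n : eps n <= eps 0%N by exact: epsmono.
pose F i j w := ((m i \_ Omega) w - (m j \_ Omega) w) ^+ 4.
have mF i j : measurable_fun T (F i j) by apply: measurable_funX; exact: measurable_funB.
have F0 i j w : 0 <= F i j w by rewrite /F (exprM _ 2 2) sqr_ge0.
have gcov := global_coverable oO mO fO mF F0
  (local_coverable um uq mX (fun n => L2i _ (uL n)) (fun n => L2i _ (mL n))
    (fun n => in_L2_integrable_sqr (mL n)) (fun n => L2i _ (qL n))
    (fun n => L2i _ (XL n)) eps0 epsle epscvg K0 m6 r2 X2).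
have qcov r : 1 <= r -> r < p ->
    int_coverable Omega (fun i j w => `|(m i \_ Omega) w - (m j \_ Omega) w| `^ r).
  move=> r1 rp; exact: (Lq_coverable mO fO mm mPO gcov r1 rp).
(* Compactness is stated for the extensions by zero on the plane, while the estimates live on
   [Omega]; the differences vanish outside. *)
have toT r (f : nat -> plane R -> R) : 0 < r ->
    int_coverable Omega (fun i j w => `|(f i \_ Omega) w - (f j \_ Omega) w| `^ r) ->
    int_coverable T (fun i j w => `|(f i \_ Omega) w - (f j \_ Omega) w| `^ r).
  move=> r0 h delta /h[L [c Hc]]; exists L, c => i j /Hc; apply: int_le_setT => w nO.
  by rewrite (patch_off (f i) nO) (patch_off (f j) nO) subrr normr0 powR0 ?gt_eqF.
split=> [r r1 rp|].
  have r1' : 1 <= r by rewrite -lee_fin.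
  have mLr n : in_Lp Omega r (m n).
    apply: (in_Lp_le mO fO (p := p)) => //; [lra|lra|].
    apply/(in_LfunP leb2 p0); split => //.
    by apply: (le_lt_trans (mP n)); rewrite ltry.
  split => //; apply: (@precompact_coverable _ (plane R) _ leb2 _ r1 (fun n => m n \_ Omega) mLr).
  by apply: toT; [lra|exact: qcov].
split; first exact: qL.
apply: (@precompact_coverable _ (plane R) _ leb2 _ (lee1n 2) (fun n => q n \_ Omega) qL).
apply: toT; first exact: two0.
(* The exponent 4 lies below [p], so the truncation has been removed for it and the untruncated
   fourth powers are available. *)
have cov4 : int_coverable Omega F.
  move=> delta delta0; have [||L [c Hc]] := qcov 4 _ _ delta delta0; [lra|lra|].
  exists L, c => i j /Hc; rewrite /int_le => h; apply: le_trans h.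
  rewrite le_eqVlt; apply/orP; left; apply/eqP; apply: eq_integral => w _.
  by rewrite powR_mulrn// (norm_even _ 2).
move=> delta delta0.
have [L [c Hc]] := L2_coverable mO fO mm mq epscvg m6O r2O cov4 delta0.
exists L, c => i j /Hc; rewrite /int_le => h; apply: le_trans h.
rewrite le_eqVlt; apply/orP; left; apply/eqP; apply: eq_integral => w _.
by rewrite powR_mulrn// (norm_even _ 1).
Qed.
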